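(* Let $N\ge2$, $R>0$, $\Omega=B(0,R)\subset\mathbb{R}^N$, let $g\in L^2(\Omega)$ be radial, and let $u(t)$ be the solution of the total variation flow $$-\partial_t u(t)\in\partial TV(u(t))\quad\text{for a.e. }t\in[0,T],\qquad u(0)=g .$$ Then for every $t\in(0,T]$, $u(t)$ is the unique minimizer of $$\min_{u\in BV(\Omega)}\ t\int_\Omega|Du|+\frac12\|u-g\|_{L^2(\Omega)}^2 .$$
   Context: $B(0,R)$ is the open ball of radius $R$ centered at $0$. $BV(\Omega)$ is the space of functions of bounded variation on $\Omega$. $TV(u)=\int_\Omega|Du|$ is the total variation of $u$ in the open set $\Omega$ (so Neumann boundary conditions), regarded as a convex lower semicontinuous functional on $L^2(\Omega)$ with value $+\infty$ when $u\notin BV(\Omega)$, and $\partial TV$ is its subdifferential in $L^2(\Omega)$. For any $g\in L^2(\Omega)$ and $T>0$ the gradient flow has a unique solution $u\in C([0,T];L^2(\Omega))$ with $u(0)=g$ (in the usual sense of the theory of maximal monotone operators). *)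

(* Defs.v *)
From HB Require Import structures.
From mathcomp Require Import all_boot all_order all_algebra.
From mathcomp Require Import all_classical all_reals all_analysis.
From mathcomp Require Import measurable_realfun.

Set Implicit Arguments.
Unset Strict Implicit.
Unset Printing Implicit Defensive.

Import Order.TTheory GRing.Theory Num.Def Num.Theory.
Import numFieldNormedType.Exports.

Local Open Scope classical_set_scope.
Local Open Scope ring_scope.

(* The sigma-algebra on R^n generated by the coordinates, i.e. the Borel one. *)
Section measurable_rV.
Context (R : realType) (n : nat).

Let coord (i : 'I_n) (x : 'rV[R]_n) : R := x 0 i.

Let rV_set0 : g_sigma_preimage coord set0.
Proof. exact: sigma_algebra0. Qed.

Let rV_setC A : g_sigma_preimage coord A -> g_sigma_preimage coord (~` A).
Proof. exact: sigma_algebraC. Qed.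

Let rV_bigcup (F : (set 'rV[R]_n)^nat) :
  (forall i, g_sigma_preimage coord (F i)) ->
  g_sigma_preimage coord (\bigcup_i (F i)).
Proof. exact: sigma_algebra_bigcup. Qed.

Fact rV_display : measure_display. Proof. exact. Qed.

HB.instance Definition _ := @isMeasurable.Build rV_display
  'rV[R]_n (g_sigma_preimage coord) rV_set0 rV_setC rV_bigcup.

Lemma measurable_coord (i : 'I_n) :
  measurable_fun [set: 'rV[R]_n] (fun x : 'rV[R]_n => x 0 i).
Proof.
move=> _ Y mY; rewrite setTI; apply: sub_sigma_algebra => /=.
rewrite -bigcup_seq/=; exists i => /=; first by rewrite mem_index_enum.
by exists Y => //; rewrite setTI.
Qed.

Lemma measurable_fun_coordP d (T : measurableType d) (f : T -> 'rV[R]_n) :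
  (forall i, measurable_fun [set: T] (fun t => f t 0 i)) ->
  measurable_fun [set: T] f.
Proof.
move=> mf.
have : g_sigma_preimage (fun i => coord i \o f) `<=` measurable.
  apply: smallest_sub; first exact: sigma_algebra_measurable.
  rewrite -bigcup_seq; apply: bigcup_sub => i _.
  by move=> A [B mB <-]; exact: mf.
by rewrite g_sigma_preimage_comp => prefS _ A mA; apply: prefS; exists A.
Qed.

End measurable_rV.

(* N-dimensional Lebesgue measure: the image of the product of the
   one-dimensional measure and the (N-1)-dimensional one. *)
Definition rV_cons (R : realType) (n : nat) (p : measurableTypeR R * 'rV[R]_n) :
    'rV[R]_n.+1 :=
  row_mx (p.1 : R)%:M p.2.

Lemma measurable_rV_cons (R : realType) (n : nat) :
  measurable_fun [set: measurableTypeR R * 'rV[R]_n] (@rV_cons R n).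
Proof.
apply: measurable_fun_coordP => i.
case: (split_ordP (i : 'I_(1 + n))) => j ->.
  rewrite (_ : (fun _ => _) = fst) //.
  by apply/funext => -[a x]; apply: (etrans (row_mxEl _ _ _ _));
     rewrite (ord1 j) mxE.
rewrite (_ : (fun _ => _) = (fun x : 'rV[R]_n => x 0 j) \o snd); last first.
  by apply/funext => -[a x]; exact: (row_mxEr a%:M x).
by apply: measurableT_comp; [exact: measurable_coord|].
Qed.

Definition lebesgue_cons (R : realType) (n : nat)
    (m : {measure set 'rV[R]_n -> \bar R}) : set 'rV[R]_n.+1 -> \bar R :=
  pushforward (@lebesgue_measure R \x^ m)%E (@rV_cons R n).

Section lebesgue_cons_measure.
Context (R : realType) (n : nat) (m : {measure set 'rV[R]_n -> \bar R}).
Let mcons := @measurable_rV_cons R n.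

Let lebesgue_cons0 : lebesgue_cons m set0 = 0%E.
Proof. exact: measure0. Qed.

Let lebesgue_cons_ge0 A : (0 <= lebesgue_cons m A)%E.
Proof. exact: measure_ge0. Qed.

Let lebesgue_cons_sigma_additive : semi_sigma_additive (lebesgue_cons m).
Proof. exact: measure_semi_sigma_additive. Qed.

HB.instance Definition _ := isMeasure.Build _ _ _ (lebesgue_cons m)
  lebesgue_cons0 lebesgue_cons_ge0 lebesgue_cons_sigma_additive.

End lebesgue_cons_measure.

Fixpoint lebesgue_rV (R : realType) (n : nat) :
    {measure set 'rV[R]_n -> \bar R} :=
  match n with
  | 0 => \d_(0 : 'rV[R]_0)
  | m.+1 => lebesgue_cons (lebesgue_rV R m)
  end.

Lemma lebesgue_rV_box (R : realType) (n : nat) (A : 'I_n -> set R) :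
  (forall i, measurable (A i)) ->
  @lebesgue_rV R n [set x | forall i, A i (x 0 i)] =
  (\prod_(i < n) lebesgue_measure (A i))%E.
Proof.
elim: n A => [|n IHn] A mA.
  rewrite big_ord0 /= diracE mem_set//= => -[].
  by case.
rewrite big_ord_recl -IHn; last by move=> i; exact: mA.
have mB : measurable [set x : 'rV[R]_n | forall i, A (lift ord0 i) (x 0 i)].
  rewrite (_ : [set _ | _] = \bigcap_(i in [set: 'I_n])
      ((fun x : 'rV[R]_n => x 0 i) @^-1` (A (lift ord0 i)))).
    apply: fin_bigcap_measurable => // i _.
    by rewrite -[X in measurable X]setTI; exact: measurable_coord.
  by apply/seteqP; split => x /= Ax i; [move=> _|]; apply: Ax.
rewrite -(@product_measure2E _ _ _ _ _ lebesgue_measure (lebesgue_rV R n))//;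
  last exact: mA.
rewrite /= /lebesgue_cons /pushforward; congr (_ _).
have E0 (a : R) (x : 'rV[R]_n) : rV_cons (a, x) 0 ord0 = a.
  rewrite (_ : ord0 = lshift n (ord0 : 'I_1)); last exact: val_inj.
  by apply: (etrans (row_mxEl _ _ _ _)); rewrite mxE.
have El (a : R) (x : 'rV[R]_n) i : rV_cons (a, x) 0 (lift ord0 i) = x 0 i.
  rewrite (_ : lift ord0 i = rshift 1 i); last exact: val_inj.
  exact: (row_mxEr a%:M x).
apply/seteqP; split => -[a x] /= Ax.
  by split => [|i]; [rewrite -(E0 a x)|rewrite -(El a x)]; exact: Ax.
move=> i; case: Ax => Aa Ax.
by case: (unliftP ord0 i) => [j|] ->; rewrite ?E0 ?El//; exact: Ax.
Qed.

Section euclidean.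
Context (R : realType) (N : nat).
Implicit Types x : 'rV[R]_N.

(* The library's norm on 'rV[R]_N is the sup norm. *)
Definition enorm x : R := Num.sqrt (\sum_i x 0 i ^+ 2).

Definition eball (r : R) : set 'rV[R]_N := [set x | enorm x < r].

Lemma measurable_enorm : measurable_fun [set: 'rV[R]_N] enorm.
Proof.
apply: (@measurableT_comp _ _ _ _ _ _ (@Num.sqrt R)).
  exact: continuous_measurable_fun (@sqrt_continuous R).
apply: measurable_sum => i.
by apply: measurable_funX; exact: measurable_coord.
Qed.

Lemma measurable_eball (r : R) : measurable (eball r).
Proof.
rewrite (_ : eball r = enorm @^-1` `]-oo, r[%classic).
  by rewrite -[X in measurable X]setTI; exact: measurable_enorm.
by apply/seteqP; split => x /=; rewrite in_itv.
Qed.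

End euclidean.
Arguments measurable_eball : clear implicits.

Section total_variation.
Context (R : realType) (N : nat).
Variables (Omega : set 'rV[R]_N) (mOmega : measurable Omega).

Definition lebesgue_on : {measure set 'rV[R]_N -> \bar R} :=
  mrestr (lebesgue_rV R N) mOmega.
Local Notation mu := lebesgue_on.

(* Elements of L^2(Omega) are handled through representatives defined on the
   whole of R^N; their values outside Omega are irrelevant. *)
Definition L2 := LfunType mu (lee1n 2).

Definition L2norm (f : 'rV[R]_N -> R) : \bar R :=
  ('N[mu]_2%:E [EFin \o f])%E.

Definition L2inner (f h : 'rV[R]_N -> R) : R := \int[mu]_x (f x * h x).

Definition C1_field (phi : 'rV[R]_N -> 'rV[R]_N) : Prop :=
  (forall x, differentiable phi x) /\
  forall i : 'I_N, continuous (fun x => 'D_(delta_mx 0 i) phi x).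

Definition test_field (phi : 'rV[R]_N -> 'rV[R]_N) : Prop :=
  let supp := closure [set x | phi x != 0] in
  [/\ C1_field phi, compact supp, supp `<=` Omega &
      forall x, enorm (phi x) <= 1].

Definition divergence (phi : 'rV[R]_N -> 'rV[R]_N) (x : 'rV[R]_N) : R :=
  \sum_i 'D_(delta_mx 0 i) (fun y => phi y 0 i) x.

(* \int_Omega |Du| in dual form, the supremum of \int_Omega u div(phi) over the
   fields phi in C^1_c(Omega; R^N) with |phi| <= 1; for u in L^2(Omega), with
   Omega bounded, it is +oo exactly when u is not in BV(Omega). *)
Definition TV (u : 'rV[R]_N -> R) : \bar R :=
  ereal_sup [set (\int[mu]_x (u x * divergence phi x)%:E)%E |
             phi in test_field].

Definition BV : set ('rV[R]_N -> R) :=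
  [set u | u \in Lfun mu 1 /\ (TV u < +oo)%E].

Definition radial (f : 'rV[R]_N -> R) : Prop :=
  exists h : R -> R, f = (fun x => h (enorm x)) %[ae mu].

Definition subdifferential (J : L2 -> \bar R) (u : L2) : set L2 :=
  [set p : L2 | forall v : L2, (J u + (L2inner p (v - u : L2)%R)%:E <= J v)%E].

Definition L2_continuous_on (D : set R) (u : R -> L2) : Prop :=
  forall t, D t -> L2norm (u s - u t : L2) @[s --> within D (nbhs t)] --> 0%E.

Definition L2_abs_continuous (a b : R) (u : R -> L2) : Prop :=
  forall e : R, 0 < e -> exists2 d : R, 0 < d &
    forall (n : nat) (s t : 'I_n -> R),
      (forall i, a <= s i /\ s i <= t i /\ t i <= b) ->
      (forall i j : 'I_n, (i < j)%N -> t i <= s j) ->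
      \sum_i (t i - s i) < d ->
      (\sum_i L2norm (u (t i) - u (s i) : L2)%R < e%:E)%E.

Definition L2_is_derive (u : R -> L2) (t : R) (w : L2) : Prop :=
  L2norm (h^-1 *: (u (t + h) - u t) - w : L2) @[h --> 0^'] --> 0%E.

(* Strong solutions in the sense of Brezis: absolute continuity is only
   required on the compact subintervals of ]0, T[. *)
Definition gradient_flow (J : L2 -> \bar R) (T : R) (g : L2) (u : R -> L2) :
    Prop :=
  [/\ L2_continuous_on `[0, T]%classic u,
      forall a b : R, 0 < a -> a <= b -> b < T -> L2_abs_continuous a b u,
      {ae @lebesgue_measure R, forall t, 0 < t < T ->
        exists2 w : L2, L2_is_derive u t w & subdifferential J (u t) (- w)} &
      u 0 = g %[ae mu]].

Definition TV_flow (T : R) (g : L2) (u : R -> L2) : Prop :=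
  gradient_flow (fun v : L2 => TV v) T g u.

Definition ROF_energy (t : R) (g v : 'rV[R]_N -> R) : \bar R :=
  (t%:E * TV v + (2^-1)%:E * L2norm (v \- g)%R ^+ 2)%E.

Definition is_minimizer_on (X : set ('rV[R]_N -> R))
    (E : ('rV[R]_N -> R) -> \bar R) (u : 'rV[R]_N -> R) : Prop :=
  X u /\ forall v, X v -> (E u <= E v)%E.

(* Uniqueness is up to a.e. equality on Omega, as in L^2(Omega). *)
Definition is_unique_minimizer_on (X : set ('rV[R]_N -> R))
    (E : ('rV[R]_N -> R) -> \bar R) (u : 'rV[R]_N -> R) : Prop :=
  is_minimizer_on X E u /\
  forall v, is_minimizer_on X E v -> v = u %[ae mu].

End total_variation.

(* Main.v *)
Require Import Defs.
From HB Require Import structures.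
From mathcomp Require Import all_boot all_order all_algebra.
From mathcomp Require Import all_classical all_reals all_analysis.
From mathcomp Require Import measurable_realfun ring lra.

(* For step data on concentric shells, the prox operator of TV reduces to a
   problem on radial fluxes Q_i through the spheres |x| = node i, with
   |Q_i| <= perimeter, solved by minimizing a quadratic energy.  Because the
   perimeter is a concave function of the enclosed volume, a jump of the solution
   at time s saturates the flux and can only shrink afterwards; the fluxes of
   successive steps therefore calibrate the later solution, their averages do
   too, and the prox operators form a semigroup.  The resulting path V
   satisfies (V_s - V_t)/(t - s) \in dTV(V_t) for all s < t, hence comparing
   Dini derivatives gives |u_t - V_t| <= |u_0 - V_0| for the flow u.  Radial
   data are L^2-limits of step data, so (g - u_t)/t \in dTV(u_t) by closedness
   of the subdifferential, which is the Euler inclusion of the strictly convex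
   problem. *)

Set Implicit Arguments.
Unset Strict Implicit.
Unset Printing Implicit Defensive.

Import Order.TTheory GRing.Theory Num.Def Num.Theory.
Import numFieldNormedType.Exports.

Local Open Scope classical_set_scope.
Local Open Scope ring_scope.

(** * Comparison of curves in a semi-inner product space *)

(** Abstract convexity does not make the prox operators a semigroup; the radial geometry does,
    through the concavity of the perimeter in the enclosed volume, which enters twice. At the nodes,
    a flux that touches its bound has ordered slopes, so that a jump keeps its sign backwards in
    time. Between the nodes, the flux is affine in the volume and hence stays below the perimeter,
    so that a discrete flux is carried by a genuine vector field of norm at most one. Both uses rest
    on Young's inequality in polynomial form: the perimeter is merely the derivative of the volume
    [omega * rho ^+ N], and neither surface measure nor coarea formula occurs. The two bounds on the
    total variation need different regularizations: cutoffs of balls against arbitrary test fields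
    for the upper bound, one-sided averages of a Lipschitz radial field for the lower one. The path
    V is never differentiated. Only its backward secants are subgradients, and this is exactly what
    the left Dini derivative of the distance to the flow requires. *)

Section semi_inner_product.
Context (R : realType) (V : lmodType R) (ip : V -> V -> R).
Hypothesis ipC : forall x y, ip x y = ip y x.
Hypothesis ipDl : forall x y z, ip (x + y) z = ip x z + ip y z.
Hypothesis ipZl : forall a x y, ip (a *: x) y = a * ip x y.
Hypothesis ip_ge0 : forall x, 0 <= ip x x.

Definition inorm x := Num.sqrt (ip x x).

Lemma ipDr x y z : ip x (y + z) = ip x y + ip x z.
Proof. by rewrite ipC ipDl (ipC y) (ipC z). Qed.

Lemma ipZr a x y : ip x (a *: y) = a * ip x y.
Proof. by rewrite ipC ipZl ipC. Qed.

Lemma ipNl x y : ip (- x) y = - ip x y.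
Proof. by rewrite -scaleN1r ipZl mulN1r. Qed.

Lemma ipNr x y : ip x (- y) = - ip x y.
Proof. by rewrite ipC ipNl ipC. Qed.

Lemma ipBl x y z : ip (x - y) z = ip x z - ip y z.
Proof. by rewrite ipDl ipNl. Qed.

Lemma ipBr x y z : ip x (y - z) = ip x y - ip x z.
Proof. by rewrite ipDr ipNr. Qed.

Lemma inorm_ge0 x : 0 <= inorm x. Proof. exact: sqrtr_ge0. Qed.

Lemma sqr_inorm x : inorm x ^+ 2 = ip x x.
Proof. by rewrite sqr_sqrtr. Qed.

Lemma inormN x : inorm (- x) = inorm x.
Proof. by rewrite /inorm ipNl ipNr opprK. Qed.

Lemma inormZ a x : inorm (a *: x) = `|a| * inorm x.
Proof.
by rewrite /inorm ipZl ipZr mulrA -expr2 sqrtrM ?sqr_ge0// sqrtr_sqr.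
Qed.

Lemma inormBC x y : inorm (x - y) = inorm (y - x).
Proof. by rewrite -inormN opprB. Qed.

(** The form is only semi-definite, as elements of L^2 are represented by functions and not by
    classes, so [ip x x = 0] does not give [x = 0] and is treated apart. *)
Lemma ip_sqr_le x y : ip x y ^+ 2 <= ip x x * ip y y.
Proof.
have H (a b : R) : 0 <= a ^+ 2 * ip x x + 2 * a * b * ip x y + b ^+ 2 * ip y y.
  have := ip_ge0 (a *: x + b *: y).
  rewrite ipDl !ipDr !ipZl !ipZr (ipC y x); lra.
have xx := ip_ge0 x; have yy := ip_ge0 y.
move: xx; rewrite le_eqVlt => /predU1P[xx0|xx].
  have -> : ip x y = 0; last by rewrite expr0n/= -xx0 mul0r.
  have [//|xy0] := eqVneq (ip x y) 0.
  (* With [ip x x = 0] the form is affine in the first coefficient, and this value makes it equal to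
     [-1]. *)
  have := H (- (ip y y + 1) / (2 * ip x y)) 1.
  rewrite -xx0 mulr0 add0r expr1n mulr1 mul1r.
  have -> : 2 * (- (ip y y + 1) / (2 * ip x y)) * ip x y = - (ip y y + 1) by field.
  lra.
have := H (- ip x y) (ip x x).
have -> : (- ip x y) ^+ 2 * ip x x + 2 * - ip x y * ip x x * ip x y +
   ip x x ^+ 2 * ip y y = ip x x * (ip x x * ip y y - ip x y ^+ 2) by ring.
by rewrite pmulr_rge0// subr_ge0.
Qed.

Lemma ip_le_inorm x y : ip x y <= inorm x * inorm y.
Proof.
rewrite (le_trans (ler_norm _))// -sqrtr_sqr -sqrtrM//.
by rewrite ler_wsqrtr// ip_sqr_le.
Qed.

Lemma normr_ip_le x y : `|ip x y| <= inorm x * inorm y.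
Proof.
by rewrite ler_norml ip_le_inorm lerNl -ipNl (le_trans (ip_le_inorm _ _))// inormN.
Qed.

Lemma inormD x y : inorm (x + y) <= inorm x + inorm y.
Proof.
rewrite -ler_sqr ?nnegrE ?addr_ge0 ?inorm_ge0// sqrrD !sqr_inorm.
rewrite ipDl !ipDr (ipC y x).
have := ip_le_inorm x y; lra.
Qed.

Lemma inormB x y : inorm (x - y) <= inorm x + inorm y.
Proof. by rewrite (le_trans (inormD _ _))// inormN. Qed.

Lemma ler_inorm_dist x y : `|inorm x - inorm y| <= inorm (x - y).
Proof.
rewrite ler_norml; apply/andP; split.
  by have := inormD (y - x) x; rewrite subrK inormBC; lra.
by have := inormD (x - y) y; rewrite subrK; lra.
Qed.

End semi_inner_product.

Section left_Dini.
Context (R : realType).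
Implicit Types (F : R -> R) (a b : R).

Definition ordered_family a b n (s t : 'I_n -> R) :=
  (forall i, a <= s i /\ s i <= t i /\ t i <= b) /\
  (forall i j : 'I_n, (i < j)%N -> t i <= s j).

Definition abs_cont a b F := forall e : R, 0 < e -> exists2 d : R, 0 < d &
  forall n (s t : 'I_n -> R), ordered_family a b s t ->
    \sum_i (t i - s i) < d -> \sum_i `|F (t i) - F (s i)| <= e.

(** Half-open intervals []s i, t i]] stay disjoint when neighbours share an endpoint, so the measure
    adds up exactly. *)
Lemma ordered_family_sum_le a b n (s t : 'I_n -> R) (U : set R) :
  measurable U -> ordered_family a b s t ->
  (forall i, `[s i, t i]%classic `<=` U) ->
  ((\sum_i (t i - s i))%:E <= lebesgue_measure U)%E.
Proof.
move=> mU [st o] sub.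
have E i : lebesgue_measure (`]s i, t i] : set R) = (t i - s i)%:E.
  rewrite lebesgue_measure_itv/= lte_fin; case: ltP => // ts.
  by have [_ [H _]] := st i; have -> : t i = s i; [lra|rewrite subrr].
rewrite -sumEFin -(eq_bigr _ (fun i _ => E i)) -measure_semi_additive_ord//.
- rewrite le_measure ?inE//; first exact: bigsetU_measurable.
  rewrite -bigcup_seq; apply: bigcup_sub => i _ x /=.
  rewrite in_itv/= => /andP[sx xt]; apply: (sub i); rewrite /= in_itv/= xt.
  by rewrite ltW.
- have o' (i j : 'I_n) (x : R) : (i < j)%N -> s i < x <= t i -> s j < x <= t j -> False.
    by move=> /o H1 /andP[? ?] /andP[? ?]; lra.
  move=> i j _ _ [x []] /=; rewrite !in_itv/= => H1 H2.
  apply/val_inj; case: (ltngtP i j) => // ij; exfalso.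
    exact: o' ij H1 H2.
  exact: o' ij H2 H1.
- exact: bigsetU_measurable.
Qed.

Lemma abs_cont_within a b F : abs_cont a b F -> forall x, a <= x <= b ->
  forall e, 0 < e -> exists2 d, 0 < d &
  forall y, a <= y <= b -> `|x - y| < d -> `|F x - F y| <= e.
Proof.
move=> ac x xab e /ac[d d0 H]; exists d => // y yab xyd.
wlog xy : x y xab yab xyd / y <= x.
  move=> W; case: (leP y x) => [|/ltW] xy; first exact: W.
  by rewrite distrC W// distrC.
have := H 1%N (fun=> y) (fun=> x); rewrite !big_ord1 => -> //.
  by split => [_|i j]; [lra|rewrite !ord1].
by move: xyd; rewrite ger0_norm// subr_ge0.
Qed.

(* Away from a null set [F] decreases at rate at most [e] to the left; the
   variation of [F] on a small open neighbourhood of the null set is at most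
   [e]. Sweeping from [b] down to [a] adds up the two bounds. *)
Lemma abs_cont_left_Dini_le a b F : a <= b -> abs_cont a b F ->
  {ae @lebesgue_measure R, forall t, a < t <= b -> forall e, 0 < e ->
    exists2 d, 0 < d & forall h, 0 < h < d -> F t - F (t - h) <= e * h} ->
  F b <= F a.
Proof.
move=> ab ac [N [mN N0 sN]].
suff H e : 0 < e -> F b - F a <= e * (b - a + 1).
  rewrite -subr_le0; apply/ler_addgt0Pr => e e0; rewrite add0r.
  have h : 0 < b - a + 1 by lra.
  have := H (e / (b - a + 1)); rewrite divr_gt0// divfK ?gt_eqF//; exact.
move=> e0; have [d d0 Hd] := ac _ e0.
have [|U [oU NU Ud]] := @lebesgue_regularity_outer R N d mN _ d0.
  by rewrite [X in (X < _)%E]N0 ltry.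
have mU : measurable U by exact: open_measurable.
have {}Ud : (lebesgue_measure U < d%:E)%E.
  rewrite -(setDUK NU); apply: le_lt_trans (measureU2 _ _ _) _ => //.
    exact: measurableD.
  by rewrite [X in (X + _)%E]N0 add0e.
(* [V x] below is the variation of [F] over the intervals of [[x, b]] contained in [U]; since [U]
   has measure less than [d], it is at most [e]. *)
pose fam x n (s t : 'I_n -> R) := ordered_family x b s t /\
  forall i, `[s i, t i]%classic `<=` U.
pose W x := [set y | exists n (s t : 'I_n -> R),
  fam x n s t /\ y = \sum_i `|F (t i) - F (s i)|].
have Wle x y : a <= x -> W x y -> y <= e.
  move=> ax [n [s [t [[[H1 H2] H3] ->]]]].
  have H4 : ordered_family a b s t.
    by split => // i; have := H1 i; lra.
  apply: Hd => //.
  by rewrite -lte_fin; apply: le_lt_trans Ud; exact: ordered_family_sum_le H3.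
have W0 x : W x 0.
  by exists 0%N, (fun=> 0), (fun=> 0); rewrite big_ord0; split => //; split; [split; case|case].
have hsW x : a <= x -> has_sup (W x).
  by move=> ax; split; [exists 0|exists e => y; exact: Wle].
pose V x := sup (W x).
have Vle x : a <= x -> V x <= e.
  by move=> ax; apply: sup_le_ub; [exists 0|move=> y; exact: Wle].
have Vmono x y : a <= x -> x <= y -> V y <= V x.
  move=> ax xy; apply: sup_le_ub; first by exists 0.
  move=> z [n [s [t [[[H1 H2] H3] ->]]]].
  apply: (sup_upper_bound (hsW _ ax)); exists n, s, t; split => //; split => //.
  by split => // i; have := H1 i; lra.
(* Continuous induction from the right: the infimum of [S] lies in [S] by continuity of [F], and if
   it exceeded [a] it could be moved further left, by the Dini bound outside [N] and by the
   variation in [U] on [N]. *)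
pose S := [set x | a <= x <= b /\ F b - F x <= e * (b - x) + V x].
have Sb : S b.
  split; first by rewrite ab lexx.
  rewrite !subrr mulr0 add0r; apply: (sup_upper_bound (hsW _ ab)); exact: W0.
have hiS : has_inf S by split; [exists b|exists a => x [/andP[]]].
pose c := inf S.
have ac' : a <= c by apply: lb_le_inf; [exists b|move=> x [/andP[]]].
have cb : c <= b by apply: inf_lbound => //; exact: hiS.2.
have Sc : S c.
  split; first by rewrite ac' cb.
  apply/ler_addgt0Pr => k k0.
  have [||dd dd0 Hdd] := @abs_cont_within a b F ac c _ k => //; first by rewrite ac' cb.
  have [x Sx xc] := inf_adherent dd0 hiS.
  have cx : c <= x by apply: inf_lbound => //; exact: hiS.2.
  case: Sx => xab Fx.
  have /(Hdd x xab) : `|c - x| < dd by rewrite ltr_norml; rewrite -/c in xc; lra.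
  rewrite ler_norml => /andP[h1 h2].
  have := Vmono _ _ ac' cx.
  have : e * (b - x) <= e * (b - c) by rewrite ler_pM2l//; lra.
  lra.
suff ca : c <= a.
  have Ea : c = a by apply/eqP; rewrite eq_le ca ac'.
  case: Sc; rewrite Ea => _; have := Vle a (lexx _); lra.
rewrite leNgt; apply/negP => a_lt_c.
suff [x [ax xc Sx]] : exists x, [/\ a <= x, x < c & F c - F x <= e * (c - x) + (V x - V c)].
  case: Sc => _ Sc.
  have : S x by split; [lra|lra].
  by move/(inf_lbound hiS.2); rewrite -/c; lra.
have [Nc|Nc] := pselect (N c); last first.
  have : forall e, 0 < e -> exists2 d, 0 < d & forall h, 0 < h < d -> F c - F (c - h) <= e * h.
    by apply: contrapT => H; apply: Nc; apply: sN => /= /(_ _)H'; apply: H; apply: H'; rewrite a_lt_c.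
  move=> /(_ _ e0)[k k0 Hk].
  pose h := Num.min (k / 2) (c - a).
  have hk : h <= k / 2 by rewrite ge_min lexx.
  have hc : h <= c - a by rewrite ge_min lexx orbT.
  have h0 : 0 < h by rewrite lt_min; lra.
  exists (c - h); split; [lra|lra|].
  have := Hk h; have := Vmono (c - h) c; lra.
have /= := open_subball oU (NU _ Nc) => -[k /= k0 Hk].
pose h := Num.min (k / 4) (c - a).
have hk : h <= k / 4 by rewrite ge_min lexx.
have hc : h <= c - a by rewrite ge_min lexx orbT.
have h0 : 0 < h by rewrite lt_min; lra.
have cU : `[c - h, c]%classic `<=` U.
  move=> z /=; rewrite in_itv/= => zc.
  apply: (Hk (k / 2)); rewrite /= ?/ball_ ?sub0r ?normrN ?gtr0_norm//; try lra.
  rewrite /ball/= /ball_/= ltr_norml; lra.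
exists (c - h); split; [lra|lra|].
suff : V c <= V (c - h) - `|F c - F (c - h)|.
  have := ler_norm (F c - F (c - h)); have : 0 <= e * (c - (c - h)).
    by apply: mulr_ge0; lra.
  lra.
apply: sup_le_ub; first by exists 0.
move=> z [n [s [t [[[H1 H2] H3] ->]]]].
rewrite lerBrDl; apply: (sup_upper_bound (hsW _ _)); first lra.
(* [[c - h, c]] takes index 0, to the left of the given family, which lies in [[c, b]]. *)
exists n.+1, (fun i => if unlift ord0 i is Some j then s j else c - h),
  (fun i => if unlift ord0 i is Some j then t j else c).
split; last first.
  by rewrite big_ord_recl unlift_none; congr (_ + _); apply: eq_bigr => i _; rewrite liftK.
split; [split|].
- by move=> i; case: unliftP => [j|] _; [have := H1 j; lra|lra].
- move=> i j; case: unliftP => [j'|] ->; case: unliftP => [i'|] ->//=.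
    by rewrite /bump !leq0n !add1n ltnS; exact: H2.
  by move=> _; have := H1 i'; lra.
- by move=> i; case: unliftP => [j|] _.
Qed.

End left_Dini.

Section flow_comparison.
Context (R : realType) (V : lmodType R) (ip : V -> V -> R).
Hypothesis ipC : forall x y, ip x y = ip y x.
Hypothesis ipDl : forall x y z, ip (x + y) z = ip x z + ip y z.
Hypothesis ipZl : forall a x y, ip (a *: x) y = a * ip x y.
Hypothesis ip_ge0 : forall x, 0 <= ip x x.
Local Notation inorm := (inorm ip).

Let ip_subZ (a b q r z : V) (h : R) : a - b = h *: q - h *: r ->
  ip a z = ip b z + h * ip q z - h * ip r z.
Proof.
move=> /(congr1 (ip^~ z)) /=; rewrite !(ipBl ipDl ipZl) (ipZl h q) (ipZl h r).
lra.
Qed.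

(** With [U'] and [U] the differences at [t - h] and [t], one has [U' - U = h *: q - h *: r], where
    [q] pairs nonnegatively with [U] by monotonicity and [r] is the remainder of the derivative of
    [u]. Cauchy-Schwarz on [ip U' U] and division by the norm of [U] give the claim; [v] enters only
    through its secant. *)
Lemma left_Dini_inorm (t : R) (u v : R -> V) (w : V) :
  (forall e, 0 < e -> exists2 d, 0 < d & forall h, h != 0 -> `|h| < d ->
     inorm (h^-1 *: (u (t + h) - u t) - w) <= e) ->
  (forall s, 0 <= s < t ->
     0 <= ip (- w - (t - s)^-1 *: (v s - v t)) (u t - v t)) ->
  0 < t -> forall e, 0 < e -> exists2 d, 0 < d & forall h, 0 < h < d ->
    inorm (u t - v t) - inorm (u (t - h) - v (t - h)) <= e * h.
Proof.
move=> du vm t0 e e0; have [d d0 Hd] := du _ e0.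
exists (Num.min d t); first by rewrite lt_min d0.
move=> h /andP[h0]; rewrite lt_min => /andP[hd ht].
set U := u t - v t; set U' := u (t - h) - v (t - h).
have [->|U0] := eqVneq (inorm U) 0.
  by rewrite add0r (@le_trans _ _ 0)// ?oppr_le0 ?inorm_ge0// mulr_ge0// ltW.
have {}U0 : 0 < inorm U by rewrite lt_neqAle eq_sym U0 inorm_ge0.
have /Hd : - h != 0 by rewrite oppr_eq0 gt_eqF.
rewrite normrN gtr0_norm// => /(_ hd); set r := _ - w => re.
have th : 0 <= t - h < t by apply/andP; split; lra.
have := vm _ th; rewrite (_ : t - (t - h) = h); last by ring.
set q := - w - _ => q0.
have UE : U' - U = h *: q - h *: r.
  have -> : h *: q = - (h *: w) - (v (t - h) - v t).
    by rewrite scalerBr scalerA mulfV ?gt_eqF// scale1r scalerN.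
  have -> : h *: r = - (u (t - h) - u t) - h *: w.
    by rewrite scalerBr scalerA invrN mulrN mulfV ?gt_eqF// scaleN1r.
  rewrite (opprB (- (u (t - h) - u t))) opprK addrACA addNr add0r.
  by rewrite /U' /U opprD addrACA -opprD addrC.
have H1 := ip_le_inorm ipC ipDl ipZl ip_ge0 U' U.
have H2 : ip U' U = inorm U ^+ 2 + h * ip q U - h * ip r U.
  by rewrite (ip_subZ U UE) sqr_inorm.
have H3 := ip_le_inorm ipC ipDl ipZl ip_ge0 r U.
rewrite -(ler_pM2r U0).
have H4 : h * ip r U <= e * h * inorm U.
  rewrite (mulrC e) -mulrA ler_pM2l//; apply: le_trans H3 _.
  by apply: ler_wpM2r => //; exact: inorm_ge0.
have H5 : 0 <= h * ip q U by rewrite mulr_ge0// ltW.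
rewrite mulrBl -expr2; lra.
Qed.

(** The Dini estimate makes the distance nonincreasing on every [[a, b]] inside []0, T[], where [u]
    is absolutely continuous; continuity of [u] and [v] then reaches the initial time and [T]. *)
Lemma inorm_flow_le (T L : R) (u v : R -> V) :
  (forall t, 0 <= t <= T -> forall e, 0 < e -> exists2 d, 0 < d &
     forall s, 0 <= s <= T -> `|s - t| < d -> inorm (u s - u t) <= e) ->
  (forall a b, 0 < a -> a <= b -> b < T -> forall e, 0 < e ->
     exists2 d, 0 < d & forall n (s t : 'I_n -> R), ordered_family a b s t ->
       \sum_i (t i - s i) < d -> \sum_i inorm (u (t i) - u (s i)) <= e) ->
  0 <= L ->
  (forall s t, 0 <= s <= T -> 0 <= t <= T ->
     inorm (v t - v s) <= L * `|t - s|) ->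
  {ae @lebesgue_measure R, forall t, 0 < t < T -> exists w,
    (forall e, 0 < e -> exists2 d, 0 < d & forall h, h != 0 -> `|h| < d ->
       inorm (h^-1 *: (u (t + h) - u t) - w) <= e) /\
    (forall s, 0 <= s < t ->
       0 <= ip (- w - (t - s)^-1 *: (v s - v t)) (u t - v t))} ->
  forall t, 0 <= t <= T -> inorm (u t - v t) <= inorm (u 0 - v 0).
Proof.
move=> uc uac L0 vL ae t tT.
pose F x := inorm (u x - v x).
have Fd x y : 0 <= x <= T -> 0 <= y <= T ->
    `|F x - F y| <= inorm (u x - u y) + L * `|x - y|.
  move=> xT yT; apply: le_trans (ler_inorm_dist ipC ipDl ipZl ip_ge0 _ _) _.
  rewrite (_ : _ - _ = (u x - u y) - (v x - v y)); last first.
    by rewrite opprD addrACA -opprD.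
  by apply: le_trans (inormB ipC ipDl ipZl ip_ge0 _ _) _; rewrite lerD2l vL.
have Fmono a b : 0 < a -> a <= b -> b < T -> F b <= F a.
  move=> a0 ab bT; apply: (@abs_cont_left_Dini_le _ a b) => //.
    move=> e e0; have e20 : 0 < e / 2 by lra.
    have [d d0 Hd] := uac _ _ a0 ab bT _ e20.
    have k0 : 0 < e / 2 / (L + 1) by rewrite divr_gt0//; lra.
    exists (Num.min d (e / 2 / (L + 1))); first by rewrite lt_min d0.
    move=> n s t' st; rewrite lt_min => /andP[sd sk].
    have := Hd _ _ _ st sd => H.
    apply: (@le_trans _ _ (\sum_i (inorm (u (t' i) - u (s i)) + L * (t' i - s i)))).
      apply: ler_sum => i _; have [/(_ i)[? [? ?]] _] := st.
      by apply: le_trans (Fd _ _ _ _) _; [lra|lra|rewrite ger0_norm//; lra].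
    rewrite big_split/= -mulr_sumr.
    have : L * \sum_i (t' i - s i) <= L * (e / 2 / (L + 1)) by rewrite ler_wpM2l// ltW.
    have : (L + 1) * (e / 2 / (L + 1)) = e / 2 by rewrite mulrC divfK// gt_eqF//; lra.
    rewrite mulrDl mul1r; lra.
  case: ae => M [mM M0 sM]; exists M; split => // x nx; apply: sM => /= H.
  apply: nx => /= xab.
  have [|w [H1 H2]] := H; first lra.
  by apply: left_Dini_inorm H1 H2 _; lra.
have Fcont x : 0 <= x <= T -> forall e, 0 < e -> exists2 d, 0 < d &
    forall y, 0 <= y <= T -> `|y - x| < d -> `|F y - F x| <= e.
  move=> xT e e0; have e20 : 0 < e / 2 by lra.
  have [d d0 Hd] := uc _ xT _ e20.
  have k0 : 0 < e / 2 / (L + 1) by rewrite divr_gt0//; lra.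
  exists (Num.min d (e / 2 / (L + 1))); first by rewrite lt_min d0.
  move=> y yT; rewrite lt_min => /andP[yd yk].
  have := Fd _ _ yT xT; have := Hd _ yT yd.
  have : L * `|y - x| <= L * (e / 2 / (L + 1)) by rewrite ler_wpM2l// ltW.
  have : (L + 1) * (e / 2 / (L + 1)) = e / 2 by rewrite mulrC divfK// gt_eqF//; lra.
  rewrite mulrDl mul1r; lra.
have [->//|tn0] := eqVneq t 0.
have t0 : 0 < t by rewrite lt_neqAle eq_sym tn0; case/andP: tT.
rewrite -/(F t) -/(F 0); apply/ler_addgt0Pr => e e0.
have e20 : 0 < e / 2 by lra.
have T0 : 0 <= (0 : R) <= T by lra.
have [d d0 Hd] := Fcont _ T0 _ e20.
have [k k0 Hk] := Fcont _ tT _ e20.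
(* The bounds by [t / 2] ensure [a <= b]; those by [k / 2] and [d / 2] stay strictly inside the two
   ranges of continuity. *)
pose b := t - Num.min (k / 2) (t / 2).
pose a := Num.min (d / 2) (t / 2).
have Hb1 : 0 < Num.min (k / 2) (t / 2) by rewrite lt_min; lra.
have Hb2 : t / 2 <= b by rewrite /b; have : Num.min (k / 2) (t / 2) <= t / 2; [rewrite ge_min lexx orbT|lra].
have Hb3 : t - b <= k / 2 by rewrite /b; have : Num.min (k / 2) (t / 2) <= k / 2; [rewrite ge_min lexx|lra].
have Hb4 : b < t by rewrite /b; lra.
have a0 : 0 < a by rewrite lt_min; lra.
have a1 : a <= d / 2 by rewrite ge_min lexx.
have a2 : a <= t / 2 by rewrite ge_min lexx orbT.
have {}Hd : `|F a - F 0| <= e / 2.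
  by apply: Hd; [lra|rewrite subr0 gtr0_norm//; lra].
have {}Hk : `|F b - F t| <= e / 2.
  by apply: Hk; [lra|rewrite distrC gtr0_norm ?subr_gt0//; lra].
have ab : a <= b by lra.
have bT : b < T by lra.
have := Fmono a b a0 ab bT; move: Hd Hk; rewrite !ler_norml; lra.
Qed.

End flow_comparison.

(** * The semi-inner product of L^2 *)

Section L2_inner.
Context (R : realType) (N : nat) (Omega : set 'rV[R]_N) (mO : measurable Omega).
Local Notation mu := (lebesgue_on mO).
Local Notation L2 := (L2 mO).
Implicit Types f g h : L2.

Lemma L2_integrable_mul f g : mu.-integrable setT (fun x => (f x * g x)%:E).
Proof.
by have /Lfun1_integrable := Lfun2_mul_Lfun1 (LfunP f) (LfunP g).
Qed.

Lemma L2innerC f g : L2inner mO f g = L2inner mO g f.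
Proof. by apply: eq_Rintegral => x _; rewrite mulrC. Qed.

Lemma L2innerDl f g h : L2inner mO (f + g : L2) h = L2inner mO f h + L2inner mO g h.
Proof.
rewrite /L2inner -RintegralD//; [|exact: L2_integrable_mul..].
by apply: eq_Rintegral => x _; rewrite -mulrDl.
Qed.

Lemma L2innerZl a f g : L2inner mO (a *: f : L2) g = a * L2inner mO f g.
Proof.
rewrite /L2inner -RintegralZl//; last exact: L2_integrable_mul.
by apply: eq_Rintegral => x _; rewrite mulrA.
Qed.

Lemma L2inner_ge0 f : 0 <= L2inner mO f f.
Proof. by apply: Rintegral_ge0 => x _; rewrite -expr2 sqr_ge0. Qed.

Lemma L2normE f : L2norm mO f = (inorm (fun f g : L2 => L2inner mO f g) f)%:E.
Proof.
rewrite /L2norm /inorm unlock.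
under eq_integral do rewrite /= powR_mulrn// -normrX ger0_norm ?sqr_ge0//.
rewrite -[X in (X `^ _)%E]fineK; last first.
  have := L2_integrable_mul f f => /integrable_fin_num.
  by under eq_integral do rewrite -expr2; apply.
rewrite poweR_EFin powR12_sqrt//; last first.
  by apply: Rintegral_ge0 => x _; rewrite sqr_ge0.
Qed.

End L2_inner.

(** * Lebesgue measure on R^n: sigma-finiteness, scaling, Borel sets *)

Lemma rV_cons0 (R : realType) n (z : measurableTypeR R * 'rV[R]_n) :
  rV_cons z 0 ord0 = z.1.
Proof.
rewrite (_ : ord0 = lshift n (ord0 : 'I_1)); last exact: val_inj.
by apply: (etrans (row_mxEl _ _ _ _)); rewrite mxE.
Qed.

Lemma rV_consS (R : realType) n (z : measurableTypeR R * 'rV[R]_n) i :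
  rV_cons z 0 (lift ord0 i) = z.2 0 i.
Proof.
rewrite (_ : lift ord0 i = rshift 1 i); last exact: val_inj.
exact: (row_mxEr z.1%:M z.2).
Qed.

Section lebesgue_rV_theory.
Context (R : realType).
Implicit Types n : nat.

(** A copy of [lebesgue_rV] as a plain set function, to which the sigma-finite structure required by
    Fubini can be attached. *)
Definition leb (n : nat) : set 'rV[R]_n -> \bar R := lebesgue_rV R n.

Arguments leb : clear implicits.
HB.instance Definition _ n := isMeasure.Build _ _ _ (leb n)
  (measure0 (lebesgue_rV R n)) (measure_ge0 (lebesgue_rV R n))
  (@measure_semi_sigma_additive _ _ _ (lebesgue_rV R n)).

Definition cube n (M : R) : set 'rV[R]_n := [set x | forall i, `[- M, M]%classic (x 0 i)].

Lemma measurable_cube n M : measurable (@cube n M).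
Proof.
rewrite (_ : @cube n M = \bigcap_(i in [set: 'I_n])
    ((fun x : 'rV[R]_n => x 0 i) @^-1` `[- M, M]%classic)).
  apply: fin_bigcap_measurable => // i _.
  by rewrite -[X in measurable X]setTI; exact: measurable_coord.
by apply/seteqP; split => x /= Ax i; [move=> _|]; apply: Ax.
Qed.

Lemma leb_cube_lty n M : (leb n (@cube n M) < +oo)%E.
Proof.
rewrite /leb [ltLHS](@lebesgue_rV_box R n (fun=> `[- M, M]%classic)) => [|i]; last exact: measurable_itv.
rewrite ltey_eq prode_fin_num// => i _; rewrite lebesgue_measure_itv/=; by case: ifP.
Qed.

Lemma sigma_finite_leb n : sigma_finite setT (leb n).
Proof.
exists (fun k => @cube n k%:R); last first.
  by move=> k; split; [exact: measurable_cube|exact: leb_cube_lty].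
apply/seteqP; split => // x _.
pose M := \sum_i `|x 0 i|.
have xM i : `|x 0 i| <= M by rewrite /M (bigD1 i)//= lerDl sumr_ge0.
exists (Num.truncn M).+1 => //= i.
by rewrite /= in_itv/= -ler_norml (le_trans (xM i))// ltW// truncnS_gt.
Qed.

HB.instance Definition _ n := Measure_isSigmaFinite.Build _ _ _ (leb n)
  (sigma_finite_leb n).

(** [c] times the image measure under [x |-> c * x] agrees with the Lebesgue measure on half-open
    intervals, so uniqueness identifies them. *)
Lemma lebesgue_measure_scale (c : R) (A : set R) : 0 < c -> measurable A ->
  lebesgue_measure ((fun x => c * x) @^-1` A) = (c^-1%:E * lebesgue_measure A)%E.
Proof.
move=> c0 mA.
have mc : measurable_fun [set: measurableTypeR R]
    ((fun x => c * x) : measurableTypeR R -> measurableTypeR R).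
  exact: mulrl_measurable.
have := @lebesgue_measure_unique R (mscale (NngNum (ltW c0))
  (pushforward (@lebesgue_measure R)
    ((fun x => c * x) : measurableTypeR R -> measurableTypeR R))).
move=> /(_ mc)/(_ _ A mA) ->; last first.
  move=> _ [[a b] _ <-]; change (lebesgue_measure `]a, b]%classic =
    (c%:E * lebesgue_measure ((fun x : R => (c * x)%R) @^-1` `]a, b]%classic))%E).
  rewrite (_ : _ @^-1` _ = `]c^-1 * a, c^-1 * b]%classic); last first.
    apply/seteqP; split => x; rewrite /= !in_itv/=.
      by rewrite ler_pdivlMl// ltr_pdivrMl.
    by rewrite ler_pdivlMl// ltr_pdivrMl.
  rewrite !lebesgue_measure_itv/= !lte_fin ltr_pM2l ?invr_gt0//.
  case: ifPn => _; last by rewrite mule0.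
  by rewrite -!EFinB -EFinM -mulrBr mulrA mulfV ?mul1r// gt_eqF.
by rewrite /mscale/= muleA -EFinM mulVf ?gt_eqF// mul1e.
Qed.

Lemma measurable_scale_rV n (c : R) :
  measurable_fun [set: 'rV[R]_n] (fun x : 'rV[R]_n => c *: x).
Proof.
apply: measurable_fun_coordP => i.
under eq_fun do rewrite mxE.
by apply: measurable_funM => //; exact: measurable_coord.
Qed.

(** The recursion is built on [\x^], the product that integrates in the other order; both products
    agree on rectangles, hence on all measurable sets. *)
Lemma leb_recE n (A : set 'rV[R]_n.+1) : measurable A ->
  leb n.+1 A = ((@lebesgue_measure R) \x (leb n))%E (@rV_cons R n @^-1` A).
Proof.
move=> mA; have mB : measurable (@rV_cons R n @^-1` A).
  by rewrite -[X in measurable X]setTI; exact: measurable_rV_cons.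
symmetry; apply: (@product_measure_unique _ _ _ _ _ (@lebesgue_measure R)
  (leb n) (lebesgue_measure \x^ (leb n))%E) => // B C mB' mC /=.
by rewrite product_measure2E.
Qed.

(** Induction on the dimension: on a rectangle the first side contributes [c^-1] and the induction
    hypothesis the remaining power, and rectangles determine the product measure. *)
Lemma leb_scale n (c : R) (A : set 'rV[R]_n) : 0 < c -> measurable A ->
  leb n ((fun x => c *: x) @^-1` A) = ((c ^- n)%:E * leb n A)%E.
Proof.
move=> c0; elim: n A => [|n IHn] A mA.
  rewrite expr0 invr1 mul1e; congr (leb 0 _).
  by apply/seteqP; split => x /=; rewrite (_ : c *: x = x)//; apply/rowP => -[].
have mcA : measurable ((fun x : 'rV[R]_n.+1 => c *: x) @^-1` A).
  by rewrite -[X in measurable X]setTI; exact: measurable_scale_rV.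
have mB : measurable (@rV_cons R n @^-1` A).
  by rewrite -[X in measurable X]setTI; exact: measurable_rV_cons.
rewrite !leb_recE//.
pose S (z : measurableTypeR R * 'rV[R]_n) : measurableTypeR R * 'rV[R]_n :=
  (c * z.1, c *: z.2).
have mS : measurable_fun setT S.
  apply/measurable_fun_pairP; split => /=.
    by apply: (measurableT_comp (@mulrl_measurable R setT c)).
  by apply: (measurableT_comp (@measurable_scale_rV n c)).
have -> : @rV_cons R n @^-1` ((fun x => c *: x) @^-1` A) = S @^-1` (@rV_cons R n @^-1` A).
  have E z : c *: rV_cons z = rV_cons (S z).
    apply/rowP => i; rewrite mxE.
    by case: (unliftP ord0 i) => [j|] ->; rewrite ?rV_consS ?rV_cons0// mxE.
  by apply/seteqP; split => z /=; rewrite E.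
have cn0 : 0 < c ^+ n.+1 by rewrite exprn_gt0.
have := @product_measure_unique _ _ _ _ _ (@lebesgue_measure R) (leb n)
  (mscale (NngNum (ltW cn0)) (pushforward ((@lebesgue_measure R) \x (leb n))%E S)).
move=> /(_ mS)/(_ _ _ mB) ->; last first.
  move=> B C mB' mC; change ((c ^+ n.+1)%:E * ((@lebesgue_measure R) \x (leb n))
    (S @^-1` (B `*` C)) = lebesgue_measure B * leb n C)%E.
  rewrite (_ : S @^-1` _ = ((fun x => c * x) @^-1` B) `*` ((fun x => c *: x) @^-1` C)) //.
  have mcB : measurable ((fun x : R => c * x) @^-1` B).
    rewrite -[X in measurable X]setTI.
    by apply: (@mulrl_measurable R setT c).
  have mcC : measurable ((fun x : 'rV[R]_n => c *: x) @^-1` C).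
    by rewrite -[X in measurable X]setTI; exact: measurable_scale_rV.
  rewrite [X in (_ * X)%E](_ : _ = (c^-1%:E * lebesgue_measure B) *
      ((c ^- n)%:E * leb n C))%E; last first.
    rewrite product_measure1E//; congr (_ * _)%E.
      exact: lebesgue_measure_scale.
    exact: IHn.
  rewrite (muleACA (c^-1)%:E) -EFinM [LHS]muleA -EFinM.
  by rewrite -invfM -exprS mulfV ?mul1e// gt_eqF.
by rewrite /mscale/= muleA -EFinM mulVf ?gt_eqF// mul1e.
Qed.

(** The sigma-algebra is generated by the coordinates, so an open set is written as the countable
    union of the open cubes with rational centre and side parameter [1 / (k + 1)] that it contains.
    A cube around a point has to be smaller than [e / 2] because its centre is not that point. *)
Lemma open_measurable_rV n (U : set 'rV[R]_n) : open U -> measurable U.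
Proof.
move=> oU.
pose B (z : 'rV[rat]_n * nat) : set 'rV[R]_n :=
  [set x | forall i, `|x 0 i - ratr (z.1 0 i)| < (z.2.+1%:R)^-1].
have mB z : measurable (B z).
  rewrite (_ : B z = \bigcap_(i in [set: 'I_n])
      ((fun x : 'rV[R]_n => x 0 i) @^-1` [set y | `|y - ratr (z.1 0 i)| < (z.2.+1%:R)^-1])).
    apply: fin_bigcap_measurable => // i _.
    rewrite -[X in measurable X]setTI; apply: measurable_coord => //.
    rewrite (_ : [set y | _] = `]ratr (z.1 0 i) - (z.2.+1%:R)^-1, ratr (z.1 0 i) + (z.2.+1%:R)^-1[%classic) //.
    move: (ratr _) (_.+1%:R^-1) => q e.
    by apply/seteqP; split => y /=; rewrite in_itv/= ltr_norml; lra.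
  by apply/seteqP; split => x /= Ax i; [move=> _|]; apply: Ax.
rewrite (_ : U = \bigcup_(z in [set: 'rV[rat]_n * nat]) (if `[< B z `<=` U >] then B z else set0)).
  apply: countable_bigcupT_measurable => // z; case: ifPn => _ //.
apply/seteqP; split => [x Ux|x [z _]]; last first.
  by case: ifPn => // /asboolP BU /BU.
have [e /= e0 He] := (nbhs_ballP _ _).1 (open_nbhs_nbhs (conj oU Ux)).
have [k ke] : exists k : nat, k.+1%:R^-1 < e / 2.
  exists (Num.truncn (e / 2)^-1); rewrite invf_plt ?posrE ?divr_gt0//.
  exact: truncnS_gt.
have k0 : 0 < (k.+1%:R)^-1 :> R by [].
have /choice[q Hq] : forall i : 'I_n, exists q : rat, `|x 0 i - ratr q| < k.+1%:R^-1.
  move=> i; have : x 0 i - k.+1%:R^-1 < x 0 i + k.+1%:R^-1 by move: k0; move: (k.+1%:R^-1) => ? ?; lra.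
  move=> /rat_in_itvoo[q]; rewrite in_itv/= => H.
  exists q; rewrite ltr_norml; move: (k.+1%:R^-1) (ratr q) H => k' q'; lra.
exists (\row_i q i, k) => //.
have Bx : B (\row_i q i, k) x by move=> i /=; rewrite mxE.
case: ifPn => [//|/asboolPn[]].
move=> y By; apply: He; split => // i j; rewrite (ord1 i).
move: ke (By j) (Bx j); rewrite /= mxE /ball/=.
move: (k.+1%:R^-1) (ratr _) => k' q'.
rewrite !ltr_norml; lra.
Qed.

Lemma continuous_measurable_rV n (f : 'rV[R]_n -> R) : continuous f ->
  measurable_fun setT f.
Proof.
move=> cf; apply: (measurability _ (RGenOpens.measurableE R)).
move=> _ [_ [a [b ->] <-]]; rewrite setTI; apply: open_measurable_rV.
by apply: open_comp => // x _; exact: cf.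
Qed.

End lebesgue_rV_theory.
Arguments leb : clear implicits.
Arguments cube : clear implicits.

(** * Integrals of divergences *)

Section divergence.
Context (R : realType).

Lemma integrable_bounded_support d (T : measurableType d)
    (mu : {measure set T -> \bar R}) (A : set T) (f : T -> R) (B : R) :
  measurable A -> (mu A < +oo)%E -> measurable_fun setT f ->
  (forall x, `|f x| <= B) -> (forall x, ~ A x -> f x = 0) ->
  mu.-integrable setT (EFin \o f).
Proof.
move=> mA Aoo mf fB f0.
have -> : EFin \o f = (EFin \o f) \_ A.
  apply/funext => x; rewrite patchE; case: ifPn => // /negP.
  by rewrite inE => /f0 /= ->.
rewrite -integrable_mkcond//; apply: measurable_bounded_integrable => //.
  exact: measurable_funTS.
exists B; split; first exact: num_real.
by move=> M BM x _ /=; rewrite (le_trans (fB x))// ltW.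
Qed.

Lemma continuous_rV (T : topologicalType) n (f : T -> 'rV[R]_n) :
  (forall i, continuous (fun t => f t 0 i)) -> continuous f.
Proof.
move=> cf t; apply/cvg_ballP => e e0; near=> s; split=> // i j; rewrite (ord1 i).
by move: j; near: s; apply: filter_forall => j; have /cvg_ballP := cf j t; exact.
Unshelve. all: by end_near. Qed.

Lemma compact_cube n (M : R) : compact (cube R n M).
Proof.
have := @rV_compact R n (fun=> `[- M, M]%classic); apply => i.
exact: segment_compact.
Qed.

Lemma closed_cube n (M : R) : closed (cube R n M).
Proof. by apply: compact_closed; [exact: norm_hausdorff|exact: compact_cube]. Qed.

Lemma continuous_bounded_support n (f : 'rV[R]_n -> R) (M : R) : continuous f ->
  (forall x, ~ cube R n M x -> f x = 0) -> exists B, forall x, `|f x| <= B.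
Proof.
move=> cf f0.
have [[c Mc]|c0] := pselect (exists x, cube R n M x); last first.
  by exists 0 => x; rewrite f0 ?normr0// => Mx; apply: c0; exists x.
have [||b _ H] := @EVT_max_rV R n (fun x => `|f x|) _ _ (@compact_cube n M).
- by exists c.
- apply: continuous_subspaceT => x; apply: continuous_comp; first exact: cf.
  exact: norm_continuous.
exists `|f b| => x; have [Mx|/f0 ->] := pselect (cube R n M x).
  by apply: H; rewrite inE.
by rewrite normr0.
Qed.

Lemma integrable_continuous_support n (f : 'rV[R]_n -> R) (M : R) : continuous f ->
  (forall x, ~ cube R n M x -> f x = 0) -> (leb R n).-integrable setT (EFin \o f).
Proof.
move=> cf f0; have [B fB] := continuous_bounded_support cf f0.
apply: integrable_bounded_support fB f0; [exact: measurable_cube| |].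
  exact: leb_cube_lty.
exact: continuous_measurable_rV.
Qed.

Lemma derive_support0 n (psi : 'rV[R]_n -> R) v (A : set 'rV[R]_n) :
  closed A -> (forall x, ~ A x -> psi x = 0) ->
  forall x, ~ A x -> 'D_v psi x = 0.
Proof.
move=> cA psi0 x Ax; rewrite -(derive_cst (0 : R) x v); apply: near_eq_derive.
have : nbhs x (~` A) by apply: open_nbhs_nbhs; split => //; exact: closed_openC.
by apply: filterS => y /psi0 ->.
Qed.

Lemma addr_delta_rVE n (u : 'rV[R]_n) h i j :
  (u + h *: delta_mx 0 j) 0 i = u 0 i + h * (i == j)%:R.
Proof. by rewrite !mxE eqxx. Qed.

Lemma rV_cons_shift0 n (a h : R) (x : 'rV[R]_n) :
  rV_cons (a + h, x) = rV_cons (a, x) + h *: delta_mx 0 ord0.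
Proof.
apply/rowP => i; rewrite addr_delta_rVE.
by case: (unliftP ord0 i) => [j|] ->; rewrite ?rV_consS ?rV_cons0//= ?mulr0 ?addr0 ?mulr1.
Qed.

Lemma rV_cons_shiftS n (a h : R) (x : 'rV[R]_n) j :
  rV_cons (a, x + h *: delta_mx 0 j) =
  rV_cons (a, x) + h *: delta_mx 0 (lift ord0 j).
Proof.
apply/rowP => i; rewrite addr_delta_rVE.
case: (unliftP ord0 i) => [k|] ->; rewrite ?rV_consS ?rV_cons0//= ?mulr0 ?addr0//.
by rewrite addr_delta_rVE (inj_eq (@lift_inj _ ord0)).
Qed.

Lemma continuous_rV_consl n (x : 'rV[R]_n) : continuous (fun a : R => rV_cons (a, x) : 'rV[R]_n.+1).
Proof.
apply: continuous_rV => i.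
case: (unliftP ord0 i) => [j|] ->.
  by under eq_fun do rewrite rV_consS/=; exact: cst_continuous.
by under eq_fun do rewrite rV_cons0/=; move=> ?; exact: cvg_id.
Qed.

Lemma continuous_rV_consr n (a : R) : continuous (fun x : 'rV[R]_n => rV_cons (a, x) : 'rV[R]_n.+1).
Proof.
apply: continuous_rV => i.
case: (unliftP ord0 i) => [j|] ->.
  by under eq_fun do rewrite rV_consS/=; exact: coord_continuous.
by under eq_fun do rewrite rV_cons0/=; exact: cst_continuous.
Qed.

Lemma derive_rV_consl n (psi : 'rV[R]_n.+1 -> R) (a : R) (x : 'rV[R]_n) :
  (derivable (fun a : R => psi (rV_cons (a, x))) a 1 <->
   derivable psi (rV_cons (a, x)) (delta_mx 0 ord0)) /\
  'D_1 (fun a : R => psi (rV_cons (a, x))) a = 'D_(delta_mx 0 ord0) psi (rV_cons (a, x)).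
Proof.
rewrite /derivable /derive.
suff -> : (fun h => h^-1 *: (((fun a : R => psi (rV_cons (a, x))) \o shift a) (h *: 1) -
      psi (rV_cons (a, x)))) = (fun h => h^-1 *: ((psi \o shift (rV_cons (a, x)))
      (h *: delta_mx 0 ord0) - psi (rV_cons (a, x)))) by [].
apply/funext => h /=; rewrite [_ + a]addrC rV_cons_shift0.
by rewrite [h%:A]mulr1 (addrC (h *: _)).
Qed.

Lemma derive_rV_consr n (psi : 'rV[R]_n.+1 -> R) (a : R) (x : 'rV[R]_n) j :
  (derivable (fun x => psi (rV_cons (a, x))) x (delta_mx 0 j) <->
   derivable psi (rV_cons (a, x)) (delta_mx 0 (lift ord0 j))) /\
  'D_(delta_mx 0 j) (fun x => psi (rV_cons (a, x))) x =
  'D_(delta_mx 0 (lift ord0 j)) psi (rV_cons (a, x)).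
Proof.
rewrite /derivable /derive.
suff -> : (fun h => h^-1 *: (((fun x => psi (rV_cons (a, x))) \o shift x) (h *: delta_mx 0 j) -
      psi (rV_cons (a, x)))) = (fun h => h^-1 *: ((psi \o shift (rV_cons (a, x)))
      (h *: delta_mx 0 (lift ord0 j)) - psi (rV_cons (a, x)))) by [].
apply/funext => h /=; rewrite (addrC (h *: delta_mx 0 j)) rV_cons_shiftS.
by rewrite (addrC (h *: _)).
Qed.

Lemma integral_derive_support (F : R -> R) (M : R) :
  (forall a, derivable F a 1) -> continuous ('D_1 F) ->
  (forall a, ~ `[- M, M]%classic a -> F a = 0) ->
  (\int[lebesgue_measure]_a ('D_1 F a)%:E = 0)%E.
Proof.
move=> dF cF F0.
(* Strictly beyond the support, so that [F] vanishes at both endpoints; the absolute value allows a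
   negative [M]. *)
pose K := `|M| + 1.
have MK : M < K by rewrite /K (le_lt_trans (ler_norm M))// ltrDl.
have F0' a : ~ `[- M, M]%classic a -> 'D_1 F a = 0.
  move=> /= Ma; rewrite -(derive_cst (0 : R) a (1 : R)); apply: near_eq_derive.
  have : nbhs a (~` `[- M, M]%classic).
    by apply: open_nbhs_nbhs; split => //; apply: closed_openC; exact: interval_closed.
  by apply: filterS => y /F0 ->.
have -> : (fun a => ('D_1 F a)%:E) = (fun a => ('D_1 F a)%:E) \_ (`[- K, K]%classic).
  apply/funext => a; rewrite patchE; case: ifPn => // /negP.
  rewrite inE /= => aK; rewrite F0'// => /= aM; apply: aK; move: aM.
  by rewrite !in_itv/=; lra.
rewrite -integral_mkcond (@continuous_FTC2 _ _ F).
- have h1 : ~ `[- M, M]%classic K by rewrite /= in_itv/=; lra.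
  have h2 : ~ `[- M, M]%classic (- K) by rewrite /= in_itv/=; lra.
  by rewrite !F0// subee.
- by have := normr_ge0 M; rewrite /K; lra.
- exact: continuous_subspaceT.
- have cF' : continuous F.
    by move=> a; apply: differentiable_continuous; exact/derivable1_diffP.
  split => //; [exact: cvg_at_right_filter (cF' _)|exact: cvg_at_left_filter (cF' _)].
- by move=> a _; rewrite derive1E.
Qed.

(** Fubini, in the order that puts the differentiated coordinate in the inner integral: that
    integral vanishes by the induction hypothesis for a coordinate of the tail, and by the
    fundamental theorem of calculus for the first coordinate. *)
Lemma integral_partial0 n (psi : 'rV[R]_n -> R) (i : 'I_n) (M : R) :
  (forall x, derivable psi x (delta_mx 0 i)) ->
  continuous ('D_(delta_mx 0 i) psi) ->
  (forall x, ~ cube R n M x -> psi x = 0) ->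
  (\int[leb R n]_x ('D_(delta_mx 0 i) psi x)%:E = 0)%E.
Proof.
elim: n psi i => [psi [] //|n IHn] psi i dpsi cpsi psi0.
set g := 'D_(delta_mx 0 i) psi.
have g0 x : ~ cube R n.+1 M x -> g x = 0.
  by apply: derive_support0 => //; exact: closed_cube.
have [B gB] := continuous_bounded_support cpsi g0.
have mg : measurable_fun setT g by exact: continuous_measurable_rV.
have mgc : measurable_fun setT (g \o @rV_cons R n).
  by apply: measurableT_comp => //; exact: measurable_rV_cons.
have mC : measurable (@rV_cons R n @^-1` cube R _ M).
  by rewrite -[X in measurable X]setTI; apply: measurable_rV_cons => //; exact: measurable_cube.
have ig1 : (@lebesgue_measure R \x leb R n)%E.-integrable setT (EFin \o (g \o @rV_cons R n)).
  apply: (@integrable_bounded_support _ _ _ (@rV_cons R n @^-1` cube R _ M) _ B) => //.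
    have := @leb_cube_lty R n.+1 M; rewrite leb_recE//.
    exact: measurable_cube.
  - by move=> z; exact: gB.
  - by move=> z /g0.
have ig2 : (@lebesgue_measure R \x^ leb R n)%E.-integrable setT (EFin \o (g \o @rV_cons R n)).
  apply: (@integrable_bounded_support _ _ _ (@rV_cons R n @^-1` cube R _ M) _ B) => //.
    exact: (@leb_cube_lty R n.+1).
  - by move=> z; exact: gB.
  - by move=> z /g0.
have mcons := @measurable_rV_cons R n.
have -> : (\int[leb R n.+1]_x (g x)%:E =
    \int[(@lebesgue_measure R \x^ leb R n)%E]_z (g (rV_cons z))%:E)%E.
  have := @integral_pushforward _ _ _ _ R (@rV_cons R n) mcons
    (@lebesgue_measure R \x^ leb R n)%E setT (EFin \o g).
  move=> H; apply: etrans (H _ ig2 measurableT); last exact/measurable_EFinP.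
  by apply: eq_measure_integral.
case: (unliftP ord0 i) => [j|] ij.
  rewrite -integral12_prod_meas2//.
  apply: integral0_eq => a _.
  rewrite /= /fubini_F/=.
  have E x : g (rV_cons (a, x)) = 'D_(delta_mx 0 j) (fun x => psi (rV_cons (a, x))) x.
    by rewrite /g ij (derive_rV_consr psi a x j).2.
  under eq_integral do rewrite E.
  apply: IHn.
  - by move=> x; apply/(derive_rV_consr psi a x j).1; rewrite -ij.
  - rewrite -(funext E) => x; apply: (@continuous_comp _ _ _ (fun x => rV_cons (a, x))).
      exact: continuous_rV_consr.
    exact: cpsi.
  - move=> x Mx; apply: psi0 => H; apply: Mx => k.
    by have := H (lift ord0 k); rewrite rV_consS.
rewrite -integral21_prod_meas2//.
apply: integral0_eq => x _.
rewrite /= /fubini_G/=.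
have E a : g (rV_cons (a, x)) = 'D_1 (fun a : R => psi (rV_cons (a, x))) a.
  by rewrite /g ij (derive_rV_consl psi a x).2.
under eq_integral do rewrite E.
apply: (@integral_derive_support _ M).
- by move=> a; apply/(derive_rV_consl psi a x).1; rewrite -ij.
- rewrite -(funext E) => a; apply: (@continuous_comp _ _ _ (fun a : R => rV_cons (a, x))).
    exact: continuous_rV_consl.
  exact: cpsi.
- move=> a Ma; apply: psi0 => H; apply: Ma.
  by have := H ord0; rewrite rV_cons0.
Qed.

End divergence.

Lemma continuous_rV_coord (R : realType) (T : topologicalType) n (F : T -> 'rV[R]_n) i :
  continuous F -> continuous (fun t => F t 0 i).
Proof.
move=> cF t; apply: (@continuous_comp _ _ _ F (fun M : 'rV[R]_n => M 0 i)).
  exact: cF.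
exact: coord_continuous.
Qed.

Lemma continuous_sum (R : realType) (T : topologicalType) n (F : 'I_n -> T -> R) :
  (forall i, continuous (F i)) -> continuous (fun t => \sum_i F i t).
Proof.
move=> cF; rewrite (_ : (fun t => _) = \sum_i F i); last first.
  by apply/funext => t; rewrite fct_sumE.
elim/big_ind : _ => [|f g cf cg|i _]; [exact: cst_continuous| |exact: cF].
by move=> t; apply: cvgD; [exact: cf|exact: cg].
Qed.

Lemma continuous_mul (R : realType) (T : topologicalType) (f g : T -> R) :
  continuous f -> continuous g -> continuous (fun t => f t * g t).
Proof. by move=> cf cg t; apply: cvgM; [exact: cf|exact: cg]. Qed.

Lemma continuous_add (R : realType) (T : topologicalType) (f g : T -> R) :
  continuous f -> continuous g -> continuous (fun t => f t + g t).
Proof. by move=> cf cg t; apply: cvgD; [exact: cf|exact: cg]. Qed.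

Lemma continuous_opp (R : realType) (T : topologicalType) (f : T -> R) :
  continuous f -> continuous (fun t => - f t).
Proof. by move=> cf t; apply: cvgN; exact: cf. Qed.

(** * The Euclidean norm and functions of its square *)

Section euclidean_norm.
Context (R : realType) (N : nat).
Implicit Types x y : 'rV[R]_N.

(** Radial functions are written in the variable [|x|^2], which, unlike [|x|], is smooth at the
    origin. *)
Definition sqn x : R := \sum_i x 0 i ^+ 2.

Definition dotv x y : R := \sum_i x 0 i * y 0 i.

Lemma sqn_ge0 x : 0 <= sqn x.
Proof. by apply: sumr_ge0 => i _; rewrite sqr_ge0. Qed.

Lemma enorm_ge0 x : 0 <= enorm x. Proof. exact: sqrtr_ge0. Qed.

Lemma sqr_enorm x : enorm x ^+ 2 = sqn x.
Proof. by rewrite sqr_sqrtr// sqn_ge0. Qed.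

Lemma enormZ a x : enorm (a *: x) = `|a| * enorm x.
Proof.
rewrite /enorm (eq_bigr (fun i => a ^+ 2 * x 0 i ^+ 2)); last first.
  by move=> i _; rewrite mxE exprMn.
by rewrite -mulr_sumr sqrtrM ?sqr_ge0// sqrtr_sqr.
Qed.

Lemma coord_le_enorm x i : `|x 0 i| <= enorm x.
Proof.
rewrite -sqrtr_sqr ler_wsqrtr// (bigD1 i)//= lerDl.
by apply: sumr_ge0 => j _; rewrite sqr_ge0.
Qed.

Lemma dotv_le x y : `|dotv x y| <= enorm x * enorm y.
Proof.
have E z : inorm dotv z = enorm z.
  by rewrite /inorm /enorm; congr Num.sqrt; apply: eq_bigr => i _; rewrite expr2.
rewrite -!E; apply: normr_ip_le.
- by move=> u v; apply: eq_bigr => i _; rewrite mulrC.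
- by move=> u v w; rewrite -big_split; apply: eq_bigr => i _; rewrite !mxE mulrDl.
- by move=> a u v; rewrite mulr_sumr; apply: eq_bigr => i _; rewrite !mxE mulrA.
- by move=> u; apply: sumr_ge0 => i _; rewrite -expr2 sqr_ge0.
Qed.

Lemma enorm_lt_sqn x (c : R) : 0 <= c -> (enorm x < c) = (sqn x < c ^+ 2).
Proof. by move=> c0; rewrite -sqr_enorm ltr_sqr ?nnegrE ?enorm_ge0. Qed.

Lemma eball_sub_cube (r : R) : eball (N := N) r `<=` cube R N r.
Proof.
move=> x xr i /=; rewrite in_itv/= -ler_norml.
exact: le_trans (coord_le_enorm _ _) (ltW xr).
Qed.

Lemma differentiable_coord_rV x i : differentiable (fun y : 'rV[R]_N => y 0 i) x.
Proof. exact: differentiable_coord. Qed.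

Lemma derive_coord_rV x v i : 'D_v (fun y : 'rV[R]_N => y 0 i) x = v 0 i.
Proof.
have := @derive_mx R _ 1 N (fun y : 'rV[R]_N => y) x v (@derivable_id _ _ _ _).
by rewrite derive_id => /matrixP/(_ 0 i); rewrite mxE.
Qed.

Let sqnE : sqn = \sum_i (fun x => x 0 i) ^+ 2.
Proof.
apply/funext => x; rewrite /sqn fct_sumE; apply: eq_bigr => i _.
by rewrite -[RHS]/((fun x : 'rV[R]_N => x 0 i) x ^+ 2).
Qed.

Lemma differentiable_sqn x : differentiable sqn x.
Proof.
rewrite sqnE; apply: differentiable_sum => i.
by apply: differentiableX; exact: differentiable_coord_rV.
Qed.

Lemma derive_sqn x i : 'D_(delta_mx 0 i) sqn x = 2 * x 0 i.
Proof.
have dc j : derivable (fun x : 'rV[R]_N => x 0 j) x (delta_mx 0 i).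
  exact/diff_derivable/differentiable_coord_rV.
rewrite sqnE derive_sum => [|j]; last exact: derivableX.
rewrite (bigD1 i)//= big1 ?addr0 => [|j ji]; last first.
  by rewrite deriveX// derive_coord_rV mxE (negbTE ji) andbF scaler0.
rewrite deriveX// derive_coord_rV mxE !eqxx/=.
by rewrite -[LHS]/(_ * _) mulr1 expr1 -mulr_natl.
Qed.

Lemma continuous_sqn : continuous sqn.
Proof. by move=> x; apply: differentiable_continuous; exact: differentiable_sqn. Qed.

Section radial_functions.
Variables (f f' : R -> R).
Hypothesis df : forall s : R, 0 <= s -> is_derive s (1 : R) f (f' s).

Lemma differentiable_radial x : differentiable (f \o sqn) x.
Proof.
apply: differentiable_comp; first exact: differentiable_sqn.
by apply/derivable1_diffP; have [] := df (sqn_ge0 x).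
Qed.

Lemma derive_radial x i :
  'D_(delta_mx 0 i) (f \o sqn) x = 2 * x 0 i * f' (sqn x).
Proof.
have ds := @differentiable_sqn x.
have dfx : differentiable f (sqn x).
  by apply/derivable1_diffP; have [] := df (sqn_ge0 x).
rewrite deriveE; last exact: differentiable_radial.
rewrite diff_comp//= diff1E//= -deriveE// derive_sqn derive1E.
by have -> := @derive_val _ _ _ _ _ _ _ (df (sqn_ge0 x)).
Qed.

End radial_functions.

Lemma delta_rV_sum x : x = \sum_i x 0 i *: delta_mx 0 i.
Proof. exact: row_sum_delta. Qed.

End euclidean_norm.

(** * One-sided averages on the half-line *)

Section steklov.
Context (R : realType).
Implicit Types (g : R -> R) (a b s : R).

(* Starting at -1 makes [prim g] differentiable on both sides of [s = 0]. *)
Definition prim g s : R := \int[lebesgue_measure]_(t in `[-1, s]) g t.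

Lemma is_derive_prim g s : continuous g -> -1 < s -> is_derive s 1 (prim g) (g s).
Proof.
move=> cg s1.
have [||||h1 h2] := @continuous_FTC1_closed R g (-1) s (s + 1).
- by rewrite ltrDl.
- apply: continuous_compact_integrable; first exact: segment_compact.
  exact: continuous_subspaceT.
- exact: s1.
- exact: cg.
by rewrite derive1E in h2; exact: (DeriveDef h1 h2).
Qed.

(** The mean of [g] over [[s + a, s + b]]. Looking only to the right preserves vanishing beyond a
    threshold and never leaves the half-line of squared norms. *)
Definition steklov g a b s := (b - a)^-1 * (prim g (s + b) - prim g (s + a)).

Lemma is_derive_steklov g a b s : continuous g -> 0 <= a -> 0 <= b -> 0 <= s ->
  is_derive s 1 (steklov g a b) ((b - a)^-1 * (g (s + b) - g (s + a))).
Proof.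
move=> cg a0 b0 s0.
have H c : 0 <= c -> is_derive s 1 (fun s => prim g (s + c)) (g (s + c)).
  move=> c0; have sc : -1 < s + c by lra.
  have := is_derive_prim cg sc => -[h1 h2].
  have E : (fun s => prim g (s + c)) = prim g \o shift c by [].
  have dsh : is_derive s 1 (shift c : R -> R) 1 by exact: is_derive_shift.
  rewrite E -[X in is_derive _ _ _ X]mulr1.
  by apply: is_derive1_comp; exact: is_derive_prim.
have h1 := H a a0; have h2 := H b b0.
exact: (@is_deriveZ _ _ _ _ (b - a)^-1 s 1 _ (is_deriveB h2 h1)).
Qed.

(** Through this intermediate value, pointwise bounds on [g] and its vanishing pass to the averages
    without any integral estimate. *)
Lemma steklov_mean g a b s : continuous g -> 0 <= a -> a < b -> 0 <= s ->
  exists2 t, s + a < t < s + b & steklov g a b s = g t.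
Proof.
move=> cg a0 ab s0.
have [|||t tab E] := @MVT R (prim g) g (s + a) (s + b).
- by rewrite ltrD2l.
- move=> t; rewrite in_itv/= => /andP[st _]; apply: is_derive_prim => //.
  by lra.
- apply: derivable_within_continuous => t; rewrite in_itv/= => /andP[st _].
  have : -1 < t by lra.
  by move=> /(is_derive_prim cg)[].
exists t; first by move: tab; rewrite in_itv.
rewrite /steklov E (_ : s + b - (s + a) = b - a); last by ring.
by rewrite mulrCA mulVf ?mulr1// subr_eq0 gt_eqF.
Qed.

End steklov.

(** * Volumes of balls *)

Section ball_measure.
Context (R : realType) (N : nat).

Lemma leb_eball_lty (r : R) : (leb R N (eball r) < +oo)%E.
Proof.
apply: le_lt_trans (@leb_cube_lty R N r); apply: le_measure; rewrite ?inE.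
- exact: measurable_eball.
- exact: measurable_cube.
- exact: eball_sub_cube.
Qed.

Definition omega : R := fine (leb R N (eball 1)).

Lemma omegaE : leb R N (eball 1) = omega%:E.
Proof. by rewrite fineK// ge0_fin_numE//; exact: leb_eball_lty. Qed.

Lemma omega_gt0 : 0 < omega.
Proof.
rewrite -lte_fin -omegaE.
(* [N e^2 <= N e < 1], so the cube of half-side [e] lies in the unit ball. *)
pose e : R := (N.+1%:R)^-1.
have e0 : 0 < e by rewrite invr_gt0.
have ce : cube R N e `<=` eball 1.
  move=> x xe; rewrite /eball/= enorm_lt_sqn// expr1n.
  apply: (@le_lt_trans _ _ (\sum_(i < N) e)).
    apply: ler_sum => i _; have := xe i; rewrite /= in_itv/= -ler_norml => xi.
    rewrite -real_normK ?num_real//.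
    apply: (@le_trans _ _ (e ^+ 2)); first by rewrite lerXn2r ?nnegrE// ltW.
    rewrite expr2 -[leRHS]mulr1 ler_pM2l// /e invf_le1// ler1n//.
  rewrite sumr_const card_ord -mulr_natr /e mulrC.
  by rewrite ltr_pdivrMr// mul1r ltr_nat.
apply: (@lt_le_trans _ _ (leb R N (cube R N e))); last first.
  apply: le_measure; rewrite ?inE//; first exact: measurable_cube.
  exact: measurable_eball.
rewrite /leb [ltRHS](@lebesgue_rV_box R N (fun=> `[- e, e]%classic)); last first.
  by move=> i; exact: measurable_itv.
rewrite (eq_bigr (fun=> (e + e)%:E)); last first.
  move=> i _; rewrite lebesgue_measure_itv/= lte_fin -EFinB opprK ifT//.
  by rewrite -subr_gt0 opprK addr_gt0.
by rewrite prodEFin lte_fin prodr_gt0// => i _; rewrite addr_gt0.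
Qed.

Lemma leb_eball (r : R) : (0 < N)%N -> 0 <= r -> leb R N (eball r) = (omega * r ^+ N)%:E.
Proof.
move=> N0; rewrite le_eqVlt => /predU1P[<-|r0].
  rewrite expr0n gtn_eqF//= mulr0 (_ : eball 0 = set0) ?measure0//.
  by apply/seteqP; split => x //=; rewrite /eball /= ltNge enorm_ge0.
have -> : eball r = (fun x : 'rV[R]_N => r^-1 *: x) @^-1` eball 1.
  apply/seteqP; split => x; rewrite /= /eball/= enormZ gtr0_norm ?invr_gt0//.
    by rewrite ltr_pdivrMl// mulr1.
  by rewrite ltr_pdivrMl// mulr1.
rewrite leb_scale ?invr_gt0//; last exact: measurable_eball.
by rewrite omegaE -EFinM mulrC exprVn invrK.
Qed.

End ball_measure.

(** * Integration on a ball and test fields *)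

Section on_ball.
Context (R : realType) (N : nat) (r : R).
Hypothesis (N_gt0 : (0 < N)%N) (r_gt0 : 0 < r).
Local Notation Omega := (@eball R N r).
Local Notation mO := (measurable_eball R N r).
Local Notation mu := (lebesgue_on mO).
Local Notation L2 := (L2 mO).

Lemma lebesgue_onE A : mu A = leb R N (A `&` Omega).
Proof. by []. Qed.

Lemma lebesgue_on_lty : (mu setT < +oo)%E.
Proof. by rewrite lebesgue_onE setTI leb_eball_lty. Qed.

Lemma integral_lebesgue_on (f : 'rV[R]_N -> \bar R) : (forall x, ~ Omega x -> f x = 0%E) ->
  (\int[mu]_x f x = \int[leb R N]_x f x)%E.
Proof.
move=> f0; have E : f = f \_ Omega.
  by apply/funext => x; rewrite patchE; case: ifPn => // /negP; rewrite inE => /f0.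
rewrite E -!integral_mkcond; apply: eq_measure_integral => A mA AO.
by rewrite lebesgue_onE setIidl.
Qed.

Lemma bounded_integrable (f : 'rV[R]_N -> R) (B : R) : measurable_fun setT f ->
  (forall x, `|f x| <= B) -> mu.-integrable setT (EFin \o f).
Proof.
move=> mf fB.
by apply: (integrable_bounded_support measurableT lebesgue_on_lty mf fB) => x /(_ I).
Qed.

Lemma bounded_L2 (f : 'rV[R]_N -> R) (B : R) : measurable_fun setT f ->
  (forall x, `|f x| <= B) -> f \in Lfun mu 2%:E.
Proof.
move=> mf fB; rewrite inE; apply/andP; split; first by rewrite inE.
rewrite inE/= /finite_norm unlock; apply: poweR_lty.
apply: (@le_lt_trans _ _ (\int[mu]_x (B ^+ 2)%:E)%E).
  apply: ge0_le_integral => //.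
  - by move=> x _; exact: poweR_ge0.
  - apply/measurable_EFinP => /=.
    apply: (@measurableT_comp _ _ _ _ _ _ (fun x : R => x `^ 2)%R) => //.
    exact: measurableT_comp.
  - move=> x _ /=; rewrite lee_fin powR_mulrn//.
    by rewrite lerXn2r// nnegrE (le_trans _ (fB x)).
rewrite integral_cst// lte_mul_pinfty// ?lee_fin ?sqr_ge0//.
exact: lebesgue_on_lty.
Qed.

Lemma L2_integrable (f : L2) : mu.-integrable setT (EFin \o f).
Proof.
have h1 : (cst 1 : 'rV[R]_N -> R) \in Lfun mu 2%:E.
  by apply: (@bounded_L2 _ 1) => // x; rewrite normr1.
have := L2_integrable_mul f (Lfun_Sub (lee1n 2) h1).
by under eq_fun do rewrite /= mulr1.
Qed.

(** Dominated convergence: [|v * B|] is integrable because the ball has finite measure. Every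
    regularization below passes to the limit through this lemma. *)
Lemma bounded_cvg_L2inner (v : L2) (g_ : nat -> 'rV[R]_N -> R) (g : 'rV[R]_N -> R) B :
  (forall k, measurable_fun setT (g_ k)) -> measurable_fun setT g ->
  (forall k x, Omega x -> `|g_ k x| <= B) ->
  {ae mu, forall x, g_ k x @[k --> \oo] --> g x} ->
  L2inner mO v (g_ k) @[k --> \oo] --> L2inner mO v g.
Proof.
move=> mg_ mg gB cg.
have mO' : mu (~` Omega) = 0%E by rewrite lebesgue_onE setICl measure0.
have [] := @dominated_convergence _ _ _ mu setT measurableT
  (fun k x => (v x * g_ k x)%:E) (fun x => (v x * g x)%:E) (fun x => `|v x * B|%:E).
- by move=> k; apply/measurable_EFinP; apply: measurable_funM.
- by apply/measurable_EFinP; apply: measurable_funM.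
- case: cg => A [mA A0 sA]; exists A; split => // x nx; apply: sA => H; apply: nx => _.
  by apply: cvg_EFin; [exact: nearW|apply: cvgM => //; exact: cvg_cst].
- apply: (integrable_abse (f := fun x => (v x * B)%:E)) => //.
  have := integrableZr measurableT B (L2_integrable v).
  by apply: eq_integrable => // x _; rewrite EFinM.
- exists (~` Omega); split => //; first by apply: measurableC; exact: mO.
  move=> x nx Ox; apply: nx => k _; rewrite lee_fin !normrM ler_wpM2l//.
  by rewrite (le_trans (gB k x Ox))// ler_norm.
move=> iv _; rewrite /L2inner /Rintegral => H; apply: fine_cvg.
rewrite fineK; last exact: integrable_fin_num.
exact: H.
Qed.

Section test_field.
Variable phi : 'rV[R]_N -> 'rV[R]_N.
Hypothesis tphi : test_field Omega phi.
Local Notation S := (closure [set x | phi x != 0]).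

Lemma test_field0 x : ~ S x -> phi x = 0.
Proof.
by move=> Sx; apply/eqP/negPn/negP => H; apply: Sx; apply: subset_closure.
Qed.

Lemma test_field_derivable x i v : derivable (fun y => phi y 0 i) x v.
Proof.
have [[dphi _] _ _ _] := tphi.
have dv : derivable phi x v by exact: diff_derivable.
exact: ((derivable_mxP phi x v).1 dv 0 i).
Qed.

Lemma test_field_continuous i : continuous (fun y => phi y 0 i).
Proof.
have [[dphi _] _ _ _] := tphi.
by apply: continuous_rV_coord => x; exact: differentiable_continuous (dphi x).
Qed.

Lemma test_field_derive_continuous i :
  continuous (fun x => 'D_(delta_mx 0 i) (fun y => phi y 0 i) x).
Proof.
have [[dphi cphi] _ _ _] := tphi.
have E x : 'D_(delta_mx 0 i) (fun y => phi y 0 i) x = ('D_(delta_mx 0 i) phi x) 0 i.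
  by rewrite derive_mx ?mxE//; exact: diff_derivable.
under eq_fun do rewrite E.
exact: continuous_rV_coord (cphi i).
Qed.

Lemma divergence_continuous : continuous (divergence phi).
Proof.
rewrite (_ : divergence phi = fun x => \sum_i 'D_(delta_mx 0 i) (fun y => phi y 0 i) x)//.
by apply: continuous_sum => i; exact: test_field_derive_continuous.
Qed.

Lemma divergence0 x : ~ S x -> divergence phi x = 0.
Proof.
move=> Sx; apply: big1 => i _; apply: (derive_support0 _ (A := S)) Sx.
  exact: closed_closure.
by move=> y /test_field0 ->; rewrite mxE.
Qed.

Lemma test_field_cube x : ~ cube R N r x -> ~ S x.
Proof.
have [_ _ sub _] := tphi; move=> nx /sub Sx; apply: nx; exact: eball_sub_cube.
Qed.

Lemma test_field_Omega x : ~ Omega x -> ~ S x.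
Proof. by have [_ _ sub _] := tphi; move=> nx /sub. Qed.

Lemma divergence_bounded : exists B, forall x, `|divergence phi x| <= B.
Proof.
apply: (@continuous_bounded_support R N _ r divergence_continuous) => x xr.
by apply/divergence0/test_field_cube.
Qed.

Lemma divergence_L2 : divergence phi \in Lfun mu 2%:E.
Proof.
have [B HB] := divergence_bounded.
apply: (bounded_L2 _ HB).
by apply: continuous_measurable_rV; exact: divergence_continuous.
Qed.

(** Integration by parts: [g i] is the i-th partial derivative of the i-th component of
    [f (sqn x) *: phi x], which is supported in the ball, so its integral vanishes. *)
Lemma integral_divergence_radial (f f' : R -> R) :
  (forall s : R, 0 <= s -> is_derive s (1 : R) f (f' s)) -> continuous f' ->
  L2inner mO (divergence phi) (f \o @sqn R N) =
  - \int[mu]_x (2 * f' (sqn x) * dotv x (phi x)).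
Proof.
move=> df cf'.
pose g (i : 'I_N) (x : 'rV[R]_N) : R := 2 * x 0 i * f' (sqn x) * phi x 0 i +
  f (sqn x) * 'D_(delta_mx 0 i) (fun y => phi y 0 i) x.
have cphi := test_field_continuous; have cdphi := test_field_derive_continuous.
have cfs : continuous (f \o @sqn R N).
  by move=> x; apply: differentiable_continuous; exact: differentiable_radial.
have cf's : continuous (f' \o @sqn R N).
  by move=> x; apply: continuous_comp; [exact: continuous_sqn|exact: cf'].
have gE i : 'D_(delta_mx 0 i) ((f \o @sqn R N) * (fun y => phi y 0 i)) = g i.
  apply/funext => x; rewrite deriveM; [|exact/diff_derivable/differentiable_radial|exact: test_field_derivable].
  rewrite (derive_radial df) /g -[LHS]/(_ * _ + _ * _) addrC; congr (_ + _).
  by rewrite mulrC.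
have cg i : continuous (g i).
  apply: continuous_add; last by apply: continuous_mul; [exact: cfs|exact: cdphi].
  apply: continuous_mul; last exact: cphi.
  apply: continuous_mul; last exact: cf's.
  by apply: continuous_mul; [exact: cst_continuous|exact: coord_continuous].
have g0 i x : ~ S x -> g i x = 0.
  move=> Sx; rewrite -gE; apply: derive_support0 Sx; first exact: closed_closure.
  by move=> y /test_field0 py; rewrite -[LHS]/(_ * _) py mxE mulr0.
have ig i : (leb R N).-integrable setT (EFin \o g i).
  by apply: (@integrable_continuous_support R N _ r) => // x /test_field_cube; exact: g0.
have Ig i : (\int[leb R N]_x (g i x)%:E = 0)%E.
  under eq_integral do rewrite -gE.
  apply: (@integral_partial0 R N _ i r).
  - move=> x; apply: derivableM; last exact: test_field_derivable.
    exact/diff_derivable/differentiable_radial.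
  - by rewrite gE.
  - move=> x /test_field_cube/test_field0 px.
    by rewrite -[LHS]/(_ * _) px mxE mulr0.
have cd : continuous (fun x => 2 * f' (sqn x) * dotv x (phi x)).
  apply: continuous_mul.
    by apply: continuous_mul; [exact: cst_continuous|exact: cf's].
  apply: (@continuous_sum R _ _ (fun i (x : 'rV[R]_N) => x 0 i * phi x 0 i)) => i.
  by apply: continuous_mul; [exact: coord_continuous|exact: cphi].
have d0 x : ~ S x -> 2 * f' (sqn x) * dotv x (phi x) = 0.
  by move=> /test_field0 ->; rewrite /dotv big1 ?mulr0// => i _; rewrite mxE mulr0.
have c1 : continuous (fun x => divergence phi x * f (sqn x)).
  by apply: continuous_mul; [exact: divergence_continuous|exact: cfs].
have d1 x : ~ S x -> divergence phi x * f (sqn x) = 0.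
  by move=> /divergence0 ->; rewrite mul0r.
have i1 : (leb R N).-integrable setT (EFin \o (fun x => divergence phi x * f (sqn x))).
  by apply: (@integrable_continuous_support R N _ r) => // x /test_field_cube; exact: d1.
have i2 : (leb R N).-integrable setT (EFin \o (fun x => 2 * f' (sqn x) * dotv x (phi x))).
  by apply: (@integrable_continuous_support R N _ r) => // x /test_field_cube; exact: d0.
have gsum x : \sum_i g i x = divergence phi x * f (sqn x) + 2 * f' (sqn x) * dotv x (phi x).
  rewrite big_split/= addrC; congr (_ + _).
    by rewrite /divergence mulr_suml; apply: eq_bigr => i _; rewrite mulrC.
  by rewrite /dotv mulr_sumr; apply: eq_bigr => i _; ring.
have : (\int[leb R N]_x (\sum_i g i x)%:E = 0)%E.
  under eq_integral do rewrite -sumEFin.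
  by rewrite integral_sum// big1// => i _; exact: Ig.
under eq_integral do rewrite gsum EFinD.
rewrite integralD// => /eqP; rewrite -[X in (X + _)%E]fineK ?integrable_fin_num//.
rewrite -[X in (_ + X)%E]fineK ?integrable_fin_num// -EFinD eqe.
move=> /eqP H; rewrite /L2inner /Rintegral.
rewrite !integral_lebesgue_on; [lra|..].
- by move=> x /test_field_Omega/d0 ->.
- by move=> x /test_field_Omega/d1 /= ->.
Qed.

End test_field.

End on_ball.

(** Young's inequality, equivalently the tangent inequality for the power [n.+1] at [b]. The
    induction multiplies the hypothesis by [a] and adds [(n + 1) b^n (a - b)^2 >= 0]. *)
Lemma young_expn (R : realType) (n : nat) (a b : R) : 0 <= a -> 0 <= b ->
  n.+1%:R * a * b ^+ n <= a ^+ n.+1 + n%:R * b ^+ n.+1.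
Proof.
move=> a0 b0; elim: n => [|n IH]; first by rewrite mul1r expr0 mulr1 expr1 mul0r addr0.
have := ler_wpM2l a0 IH.
have : 0 <= n.+1%:R * b ^+ n * ((a - b) * (a - b)).
  by rewrite -expr2; apply: mulr_ge0 (sqr_ge0 _); apply: mulr_ge0 => //; exact: exprn_ge0.
rewrite !exprS -(natr1 n.+1) -(natr1 n).
move: (b ^+ n) (a ^+ n) (n%:R : R) => B A c; lra.
Qed.

(** * The total variation of balls and of radial functions *)

Section ball_perimeter.
Context (R : realType) (N : nat) (r : R).
Hypothesis (N_gt0 : (0 < N)%N) (r_gt0 : 0 < r).
Local Notation Omega := (@eball R N r).
Local Notation mO := (measurable_eball R N r).
Local Notation mu := (lebesgue_on mO).

(** The area of the sphere of radius [rho], taken as the derivative of the ball volume. *)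
Definition per (rho : R) : R := N%:R * omega R N * rho ^+ N.-1.

Lemma young_predn (a b : R) : 0 <= a -> 0 <= b ->
  N%:R * a * b ^+ N.-1 <= a ^+ N + N.-1%:R * b ^+ N.
Proof. by move=> a0 b0; have := young_expn N.-1 a0 b0; rewrite prednK. Qed.

Section ramp.
Variables (c e d : R).
Hypotheses (e0 : 0 < e) (d0 : 0 < d).

Definition ramp (s : R) : R := Num.min 1 (Num.max 0 ((c - s) / e)).

Lemma continuous_ramp : continuous ramp.
Proof.
have -> : ramp = cst 1 \min (cst 0 \max (fun s => (c - s) / e)) by [].
apply: min_fun_continuous; first exact: cst_continuous.
apply: max_fun_continuous; first exact: cst_continuous.
by move=> s; apply: cvgM; [apply: cvgB; [exact: cvg_cst|exact: cvg_id]|exact: cvg_cst].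
Qed.

Lemma ramp_ge0 (s : R) : 0 <= ramp s.
Proof. by rewrite /ramp le_min ler01 le_max lexx. Qed.

Lemma ramp_le1 (s : R) : ramp s <= 1.
Proof. by rewrite /ramp ge_min lexx. Qed.

Lemma ramp0 (s : R) : c <= s -> ramp s = 0.
Proof.
move=> cs; rewrite /ramp max_l ?min_r//.
by rewrite pmulr_lle0 ?invr_gt0// subr_le0.
Qed.

Lemma ramp1 (s : R) : s <= c - e -> ramp s = 1.
Proof.
move=> cs; have h : 1 <= (c - s) / e by rewrite ler_pdivlMr// mul1r; lra.
by rewrite /ramp max_r ?min_l// (le_trans _ h).
Qed.

Lemma ramp_lip (s t : R) : s <= t -> 0 <= ramp s - ramp t <= (t - s) / e.
Proof.
move=> st; have : (c - t) / e <= (c - s) / e by rewrite ler_pM2r ?invr_gt0//; lra.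
have -> : (t - s) / e = (c - s) / e - (c - t) / e by rewrite -mulrBl; congr (_ / _); ring.
rewrite /ramp; move: ((c - s) / e) ((c - t) / e) => p q pq.
rewrite /Num.max /Num.min; do ![case: ifPn => //]; rewrite -?leNgt; lra.
Qed.

(** Averaging over [[s, s + d]] makes the ramp C^1; the transition widens only inwards, to
    [[c - e - d, c]]. *)
Definition cutoff : R -> R := steklov ramp 0 d.
Definition cutoff' (s : R) : R := (d - 0)^-1 * (ramp (s + d) - ramp (s + 0)).

Lemma is_derive_cutoff (s : R) : 0 <= s -> is_derive s (1 : R) cutoff (cutoff' s).
Proof. by move=> s0; apply: is_derive_steklov => //; [exact: continuous_ramp|exact: ltW]. Qed.

Lemma continuous_cutoff' : continuous cutoff'.
Proof.
apply: continuous_mul; first exact: cst_continuous.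
have cs (b : R) : continuous (fun s : R => ramp (s + b)).
  move=> s; apply: (@continuous_comp _ _ _ (fun s : R => s + b) ramp); last exact: continuous_ramp.
  by apply: cvgD; [exact: cvg_id|exact: cvg_cst].
by move=> s; apply: cvgB; exact: cs.
Qed.

Lemma cutoff_bounded (s : R) : 0 <= s -> `|cutoff s| <= 1.
Proof.
move=> s0; rewrite /cutoff; have [t _ ->] := steklov_mean continuous_ramp (lexx 0) d0 s0.
by rewrite ger0_norm ?ramp_ge0// ramp_le1.
Qed.

Lemma cutoff0 (s : R) : 0 <= s -> c <= s -> cutoff s = 0.
Proof.
move=> s0 cs; rewrite /cutoff; have [t ts ->] := steklov_mean continuous_ramp (lexx 0) d0 s0.
by apply: ramp0; lra.
Qed.

Lemma cutoff1 (s : R) : 0 <= s -> s <= c - e - d -> cutoff s = 1.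
Proof.
move=> s0 cs; rewrite /cutoff; have [t ts ->] := steklov_mean continuous_ramp (lexx 0) d0 s0.
by apply: ramp1; lra.
Qed.

Lemma cutoff'_le (s : R) : `|cutoff' s| <= e^-1 * \1_[set t | c - e - d <= t < c] s.
Proof.
rewrite indicE /cutoff' subr0 addr0.
have rhs0 : 0 <= e^-1 * (s \in [set t | c - e - d <= t < c])%:R.
  by rewrite mulr_ge0 ?invr_ge0// ltW.
have [cs|sc] := leP c s.
  have cs' : c <= s + d by rewrite (le_trans cs)// lerDl ltW.
  by rewrite (ramp0 cs) (ramp0 cs') subrr mulr0 normr0.
have [cs|cs] := ltP s (c - e - d).
  have cs1 : s + d <= c - e by rewrite -lerBrDr ltW.
  have cs2 : s <= c - e by rewrite (le_trans _ cs1)// lerDl ltW.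
  by rewrite (ramp1 cs1) (ramp1 cs2) subrr mulr0 normr0.
rewrite mem_set ?mulr1; last by rewrite /= cs sc.
have : s <= s + d by rewrite lerDl ltW.
move=> /ramp_lip /andP[]; rewrite (addrC s) addrK => h1 h2.
rewrite normrM gtr0_norm ?invr_gt0// distrC ger0_norm//.
by rewrite ler_pdivrMl.
Qed.

End ramp.

(** A divergence theorem on a thin shell. After integration by parts the integrand lives on
    [(1 - eta) rho <= |x| < rho], where the cutoff has slope at most [1 / e] and [|x . phi| <= rho];
    the shell has volume at most [per rho * eta * rho]. The product is
    [per rho * 2 (1 + eta) / (2 - eta)], and [1 + 3 eta] bounds this last factor for [eta < 1]. *)
Lemma div_cutoff_le (rho eta e : R) phi : 0 < rho -> 0 < eta -> eta < 1 ->
  e * (1 + eta) = rho ^+ 2 * (2 * eta - eta ^+ 2) -> test_field Omega phi ->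
  `|L2inner mO (divergence phi) (cutoff (rho ^+ 2) e (eta * e) \o @sqn R N)|
    <= per rho * (1 + 3 * eta).
Proof.
move=> rho0 eta0 eta1 eE tphi.
have rr : 0 < rho ^+ 2 by rewrite exprn_gt0.
have e0 : 0 < e.
  have : 0 < e * (1 + eta).
    rewrite eE mulr_gt0//; have : 0 < eta * (2 - eta) by rewrite mulr_gt0//; lra.
    by rewrite expr2; lra.
  by rewrite pmulr_lgt0//; lra.
have d0 : 0 < eta * e by rewrite mulr_gt0.
(* The relation imposed on [e] serves this identity: the inner edge of the transition is the sphere
   of radius [(1 - eta) rho]. *)
have ced : rho ^+ 2 - e - eta * e = rho ^+ 2 * (1 - eta) ^+ 2 by lra.
pose cutoff' := cutoff' (rho ^+ 2) e (eta * e).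
have -> : L2inner mO (divergence phi) (cutoff (rho ^+ 2) e (eta * e) \o @sqn R N) =
    - \int[mu]_x (2 * cutoff' (sqn x) * dotv x (phi x)).
  apply: integral_divergence_radial => //; last exact: continuous_cutoff'.
  by move=> s s0; exact: is_derive_cutoff.
rewrite normrN.
pose A : set 'rV[R]_N := eball rho `\` eball ((1 - eta) * rho).
have mA : measurable A by apply: measurableD; exact: measurable_eball.
have r'0 : 0 <= (1 - eta) * rho by rewrite mulr_ge0//; lra.
pose C : R := 2 * (e^-1 * rho).
have C0 : 0 <= C by rewrite !mulr_ge0 ?invr_ge0// ltW.
have AE x : \1_[set t | rho ^+ 2 - e - eta * e <= t < rho ^+ 2] (sqn x) = \1_A x :> R.
  rewrite ced !indicE; congr (_%:R); congr (nat_of_bool _); apply/idP/idP; rewrite !inE /=.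
    move=> /andP[h1 h2]; split; first by rewrite /eball/= enorm_lt_sqn// ltW.
    by rewrite /eball/= enorm_lt_sqn// exprMn mulrC; apply/negP; rewrite -leNgt.
  rewrite /A/eball/= !enorm_lt_sqn//; last exact: ltW.
  by rewrite exprMn (mulrC _ (rho ^+ 2)) => -[-> /negP]; rewrite -leNgt andbT.
have bound x : `|2 * cutoff' (sqn x) * dotv x (phi x)| <= C * \1_A x.
  rewrite (normrM _ (dotv x (phi x))) (normrM 2) [`|2|]ger0_norm//.
  apply: (@le_trans _ _ (2 * (e^-1 * \1_A x) * rho)); last by rewrite /C; lra.
  have [Ax|Ax] := boolP (x \in A); last first.
    have : cutoff' (sqn x) = 0.
      apply/eqP; rewrite -normr_le0 (le_trans (cutoff'_le _ e0 d0 _))// AE indicE (negbTE Ax).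
      by rewrite mulr0.
    by move=> ->; rewrite indicE (negbTE Ax) normr0 !mulr0 !mul0r.
  rewrite ler_pM ?mulr_ge0//.
    by rewrite ler_pM2l// -AE; exact: cutoff'_le.
  rewrite (le_trans (dotv_le _ _))// (le_trans (_ : _ <= enorm x * 1))//.
    by rewrite ler_wpM2l ?enorm_ge0//; have [_ _ _] := tphi; exact.
  by rewrite mulr1 ltW//; move: Ax; rewrite inE => -[].
have mg : measurable_fun setT (fun x => 2 * cutoff' (sqn x) * dotv x (phi x)).
  apply: continuous_measurable_rV; apply: continuous_mul.
    apply: continuous_mul; first exact: cst_continuous.
    move=> x; apply: (@continuous_comp _ _ _ (@sqn R N)); first exact: continuous_sqn.
    exact: continuous_cutoff'.
  apply: (@continuous_sum R _ _ (fun i (x : 'rV[R]_N) => x 0 i * phi x 0 i)) => i.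
  apply: continuous_mul; first exact: coord_continuous.
  exact: (test_field_continuous tphi).
have ig : mu.-integrable setT (EFin \o (fun x => 2 * cutoff' (sqn x) * dotv x (phi x))).
  apply: (@bounded_integrable R N r _ C mg) => x; rewrite (le_trans (bound x))// indicE.
  by case: (x \in A); rewrite ?mulr1 ?mulr0.
have i1 : mu.-integrable setT (EFin \o \1_A).
  apply: (@bounded_integrable R N r _ 1); first exact: measurable_indic.
  by move=> x; rewrite indicE; case: (x \in A); rewrite ?normr1 ?normr0.
apply: le_trans (le_normr_Rintegral measurableT ig) _.
apply: (@le_trans _ _ (\int[mu]_x (C * \1_A x))).
  apply: le_Rintegral => //; first exact: integrable_norm.
  have := integrableZl measurableT C i1.
  by apply: eq_integrable => // x _; rewrite EFinM.
rewrite RintegralZl// /Rintegral integral_indic// setIT.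
have muA : (mu A <= (omega R N * rho ^+ N - omega R N * ((1 - eta) * rho) ^+ N)%:E)%E.
  rewrite lebesgue_onE EFinB -!leb_eball//; last exact: ltW.
  apply: (@le_trans _ _ (leb R N A)).
    apply: le_measure; rewrite ?inE//; apply: measurableI => //; exact: measurable_eball.
  rewrite /A measureD//; [|exact: measurable_eball|exact: measurable_eball|exact: leb_eball_lty].
  rewrite (_ : _ `&` _ = eball ((1 - eta) * rho))//.
  apply/setIidr => x; rewrite /eball/= => h; apply: lt_trans h _.
  by rewrite gtr_pMl//; lra.
have muA' : fine (mu A) <= omega R N * rho ^+ N - omega R N * ((1 - eta) * rho) ^+ N.
  rewrite -lee_fin fineK// ge0_fin_numE//; apply: le_lt_trans muA _; exact: ltry.
apply: le_trans (ler_wpM2l C0 muA') _.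
(* The tangent inequality at [rho] bounds the volume of the shell by its width times [per rho]. *)
have := young_predn r'0 (ltW rho0).
have rN : rho ^+ N = rho * rho ^+ N.-1 by rewrite -exprS prednK.
have NN : N.-1%:R = N%:R - 1 :> R by rewrite -{2}(prednK N_gt0) -natr1 addrK.
have om := omega_gt0 R N.
rewrite rN NN /per; set X := _ ^+ N => H.
have H2 : rho * rho ^+ N.-1 - X <= N%:R * rho ^+ N.-1 * (eta * rho).
  have : N%:R * ((1 - eta) * rho) * rho ^+ N.-1 =
    N%:R * rho * rho ^+ N.-1 - N%:R * rho ^+ N.-1 * (eta * rho) by ring.
  lra.
rewrite -mulrBr; apply: (@le_trans _ _ (C * (omega R N * (N%:R * rho ^+ N.-1 * (eta * rho))))).
  by rewrite ler_wpM2l// ler_wpM2l// ltW.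
have -> : C * (omega R N * (N%:R * rho ^+ N.-1 * (eta * rho))) =
    N%:R * omega R N * rho ^+ N.-1 * (C * (eta * rho)) by ring.
apply: ler_wpM2l; first by rewrite !mulr_ge0// ?exprn_ge0// ltW.
have -> : C * (eta * rho) = 2 * (1 + eta) / (2 - eta).
  rewrite /C; have -> : e = rho ^+ 2 * (2 * eta - eta ^+ 2) / (1 + eta).
    by rewrite -eE mulfK// gt_eqF//; lra.
  rewrite (_ : 2 * eta - eta ^+ 2 = eta * (2 - eta)); last by ring.
  by field; rewrite !gt_eqF//; lra.
rewrite ler_pdivrMr; last lra.
have := mulr_gt0 eta0 eta0; have : 0 < eta * (1 - eta) by rewrite mulr_gt0//; lra.
lra.
Qed.

(** The cutoffs increase their plateau to the open ball as [eta] tends to 0, boundedly and at every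
    point, so the shell estimate passes to the indicator. *)
Lemma ball_divergence_le phi rho : 0 < rho -> test_field Omega phi ->
  `|L2inner mO (divergence phi) (\1_(eball rho))| <= per rho.
Proof.
move=> rho0 tphi.
(* The factor one half keeps [eta k < 1] at [k = 0] too. *)
pose eta k : R := harmonic k / 2.
have hk0 k : 0 < @harmonic R k by rewrite /harmonic/= invr_gt0.
have hk1 k : @harmonic R k <= 1 by rewrite /harmonic/= invf_le1// ler1n.
have eta0 k : 0 < eta k by rewrite divr_gt0.
have eta1 k : eta k < 1 by have := hk1 k; rewrite /eta; lra.
have etac : eta k @[k --> \oo] --> (0 : R).
  rewrite -(mul0r (2^-1 : R)); apply: cvgM; [exact: cvg_harmonic|exact: cvg_cst].
have dphi := divergence_L2 tphi.
pose e k := rho ^+ 2 * (2 * eta k - eta k ^+ 2) / (1 + eta k).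
have c0 : 0 < rho ^+ 2 by rewrite exprn_gt0.
have eE k : e k * (1 + eta k) = rho ^+ 2 * (2 * eta k - eta k ^+ 2).
  by rewrite divfK// gt_eqF//; have := eta0 k; lra.
have e0 k : 0 < e k.
  rewrite divr_gt0//; last by have := eta0 k; lra.
  rewrite mulr_gt0//.
  have : 0 < eta k * (2 - eta k) by rewrite mulr_gt0//; have := eta1 k; lra.
  by rewrite expr2; lra.
have d0 k : 0 < eta k * e k by rewrite mulr_gt0.
have cvgI : L2inner mO (divergence phi) (cutoff (rho ^+ 2) (e k) (eta k * e k) \o @sqn R N) @[k --> \oo]
    --> L2inner mO (divergence phi) (\1_(eball rho)).
  apply: (@bounded_cvg_L2inner R N r (Lfun_Sub (lee1n 2) dphi) _ _ 1).
  - move=> k; apply: continuous_measurable_rV => x; apply: differentiable_continuous.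
    apply: (@differentiable_radial _ _ _ (cutoff' (rho ^+ 2) (e k) (eta k * e k))) => s.
    exact: is_derive_cutoff.
  - by apply: measurable_indic; exact: measurable_eball.
  - by move=> k x _; apply: cutoff_bounded => //; exact: sqn_ge0.
  - apply: aeW => x; have sx := sqn_ge0 x.
    rewrite indicE; case: (boolP (x \in eball rho)) => /=; last first.
      rewrite notin_setE /eball/= enorm_lt_sqn ?(ltW rho0)// => /negP; rewrite -leNgt => cs.
      rewrite (_ : (fun k => _) = cst 0); first exact: cvg_cst.
      by apply/funext => k /=; rewrite cutoff0.
    rewrite inE /eball/= enorm_lt_sqn ?(ltW rho0)// => sc.
    (* For [eta] below this threshold, [rho^2 (1 - eta)^2 >= rho^2 - 2 eta rho^2 > |x|^2], and the
       point lies on the plateau. *)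
    have g0 : 0 < (rho ^+ 2 - sqn x) / (2 * rho ^+ 2).
      by rewrite divr_gt0 ?mulr_gt0// subr_gt0.
    apply: cvg_near_cst.
    move/cvgrPdist_lt: etac => /(_ _ g0); apply: filterS => k.
    rewrite sub0r normrN gtr0_norm// ltr_pdivlMr ?mulr_gt0// => ek.
    rewrite cutoff1//; have := eE k.
    have : 0 <= rho ^+ 2 * eta k ^+ 2 by rewrite mulr_ge0 ?sqr_ge0// ltW.
    by lra.
have cn : `|L2inner mO (divergence phi) (cutoff (rho ^+ 2) (e k) (eta k * e k) \o @sqn R N)| @[k --> \oo]
    --> `|L2inner mO (divergence phi) (\1_(eball rho))|.
  exact: cvg_norm.
have cp : per rho * (1 + 3 * eta k) @[k --> \oo] --> per rho.
  have := cvgM (cvg_cst (per rho)) (cvgD (cvg_cst (1 : R)) (cvgM (cvg_cst (3 : R)) etac)).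
  by rewrite mulr0 addr0 mulr1; exact.
rewrite -(cvg_lim _ cn)// -(cvg_lim _ cp)//.
apply: ler_lim; [by apply/cvg_ex; eexists; exact: cn|by apply/cvg_ex; eexists; exact: cp|].
by apply: nearW => k; apply: div_cutoff_le.
Qed.

End ball_perimeter.

(** * Radial vector fields as competitors in the total variation *)

Section radial_field.
Context (R : realType) (N : nat) (r : R).
Hypothesis (N_gt0 : (0 < N)%N) (r_gt0 : 0 < r).
Local Notation Omega := (@eball R N r).
Local Notation mO := (measurable_eball R N r).
Local Notation mu := (lebesgue_on mO).
Local Notation L2 := (L2 mO).

Lemma integral_divergenceE (v : L2) phi : test_field Omega phi ->
  (\int[mu]_x (v x * divergence phi x)%:E)%E = (L2inner mO v (divergence phi))%:E.
Proof.
move=> /divergence_L2 dphi; rewrite /L2inner /Rintegral fineK//.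
apply: integrable_fin_num => //.
exact: (L2_integrable_mul v (Lfun_Sub (lee1n 2) dphi)).
Qed.

Lemma TV_ge (v : L2) phi : test_field Omega phi ->
  ((L2inner mO v (divergence phi))%:E <= TV mO v)%E.
Proof.
move=> tphi; apply: ereal_sup_ubound; exists phi => //.
exact: integral_divergenceE.
Qed.

Lemma TV_le (v : L2) (c : \bar R) :
  (forall phi, test_field Omega phi ->
    ((L2inner mO v (divergence phi))%:E <= c)%E) -> (TV mO v <= c)%E.
Proof.
move=> H; apply: ge_ereal_sup => _ [phi tphi <-].
by rewrite integral_divergenceE//; exact: H.
Qed.

Section smooth_field.
Variables (z z' : R -> R).
Hypothesis dz : forall s : R, 0 <= s -> is_derive s (1 : R) z (z' s).
Hypothesis cz' : continuous z'.
Let phi (x : 'rV[R]_N) : 'rV[R]_N := z (sqn x) *: x.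

Let czs : continuous (z \o @sqn R N).
Proof. by move=> x; apply: differentiable_continuous; exact: differentiable_radial. Qed.

Let cz's : continuous (z' \o @sqn R N).
Proof. by move=> x; apply: continuous_comp; [exact: continuous_sqn|exact: cz']. Qed.

Let phiE i : (fun y => phi y 0 i) = (z \o @sqn R N) * (fun y : 'rV[R]_N => y 0 i).
Proof. by apply/funext => x; rewrite /phi mxE. Qed.

Let derive_phi i j x : 'D_(delta_mx 0 j) (fun y => phi y 0 i) x =
  z (sqn x) * (i == j)%:R + x 0 i * (2 * x 0 j * z' (sqn x)).
Proof.
rewrite phiE deriveM; [|exact/diff_derivable/differentiable_radial
  |exact/diff_derivable/differentiable_coord_rV].
by rewrite (derive_radial dz) derive_coord_rV mxE eqxx.
Qed.

Let differentiable_phi x : differentiable phi x.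
Proof.
have -> : phi = \sum_i (fun x : 'rV[R]_N => (z (sqn x) * x 0 i) *: (delta_mx 0 i : 'rV[R]_N)).
  apply/funext => y; rewrite fct_sumE /phi [X in _ *: X]delta_rV_sum scaler_sumr.
  by apply: eq_bigr => i _; rewrite scalerA.
apply: differentiable_sum => i; apply: differentiableZl.
apply: (@differentiableM _ _ (z \o @sqn R N)); first exact: differentiable_radial.
exact: differentiable_coord_rV.
Qed.

Lemma radial_C1_field : C1_field phi.
Proof.
split; first exact: differentiable_phi.
move=> j; have -> : 'D_(delta_mx 0 j) phi = fun x => \matrix_(k, i)
    (z (sqn x) * (i == j)%:R + x 0 i * (2 * x 0 j * z' (sqn x))).
  apply/funext => x; rewrite derive_mx; last exact: diff_derivable.
  by apply/matrixP => k i; rewrite !mxE (ord1 k) derive_phi.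
apply: continuous_rV => i; under [X in continuous X]eq_fun do rewrite mxE.
apply: continuous_add; first by apply: continuous_mul; [exact: czs|exact: cst_continuous].
apply: continuous_mul; first exact: coord_continuous.
apply: continuous_mul; last exact: cz's.
by apply: continuous_mul; [exact: cst_continuous|exact: coord_continuous].
Qed.

Lemma radial_divergence x : divergence phi x = N%:R * z (sqn x) + 2 * sqn x * z' (sqn x).
Proof.
rewrite /divergence (eq_bigr (fun i => z (sqn x) + 2 * z' (sqn x) * x 0 i ^+ 2)).
  rewrite big_split/= sumr_const card_ord -mulr_sumr -/(sqn x).
  by rewrite -mulr_natl; ring.
by move=> i _; rewrite derive_phi eqxx mulr1; ring.
Qed.

(** The margin [e] confines the closure of the support to [|x|^2 <= r^2 - e], a closed subset of the
    open ball; the last hypothesis is [|phi| <= 1] squared. *)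
Lemma radial_test_field (e : R) : 0 < e ->
  (forall s, r ^+ 2 - e <= s -> 0 <= s -> z s = 0) ->
  (forall s, 0 <= s -> s * z s ^+ 2 <= 1) -> test_field Omega phi.
Proof.
move=> e0 z0 z1.
pose A : set 'rV[R]_N := [set x | sqn x <= r ^+ 2 - e].
have cA : closed A.
  rewrite (_ : A = @sqn R N @^-1` [set s | s <= r ^+ 2 - e])//.
  apply: preimage_closed; last exact: closed_le.
  by move=> x _; exact: continuous_sqn.
have SA : closure [set x | phi x != 0] `<=` A.
  rewrite closureE; apply: smallest_sub => // x /= px; rewrite /A/= leNgt.
  apply: contra px => sx; rewrite /phi z0 ?scale0r//; [exact: ltW|exact: sqn_ge0].
have AO : A `<=` Omega.
  by move=> x; rewrite /A/eball/= enorm_lt_sqn ?(ltW r_gt0)//; lra.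
split.
- exact: radial_C1_field.
- apply: (@subclosed_compact _ _ (cube R N r)); [exact: closed_closure|exact: compact_cube|].
  by move=> x /SA /AO; exact: eball_sub_cube.
- by move=> x /SA /AO.
- move=> x; rewrite enormZ -[leRHS]ger0_norm// -ler_sqr ?nnegrE ?mulr_ge0 ?enorm_ge0//.
  rewrite normr1 expr1n exprMn real_normK ?num_real// sqr_enorm mulrC.
  by apply: z1; exact: sqn_ge0.
Qed.

End smooth_field.

(** The field [zeta (sqn x) *: x] is only Lipschitz and may be nonzero up to the boundary. Its
    averages are test fields whose divergences are bounded uniformly, by the Lipschitz constant, and
    converge almost everywhere to [G]. *)
Lemma radial_flux_le_TV (zeta : R -> R) (K : R) (G : 'rV[R]_N -> R) (v : L2) :
  continuous zeta -> (forall s, r ^+ 2 <= s -> zeta s = 0) ->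
  (forall s, 0 <= s -> s * zeta s ^+ 2 <= 1) ->
  0 <= K ->
  (forall s t, 0 <= s -> 0 <= t -> `|zeta s - zeta t| <= K * `|s - t|) ->
  measurable_fun setT G ->
  {ae mu, forall x, exists2 dz, is_derive (sqn x) (1 : R) zeta dz &
     G x = N%:R * zeta (sqn x) + 2 * sqn x * dz} ->
  ((L2inner mO v G)%:E <= TV mO v)%E.
Proof.
move=> cz z0 z1 K0 zlip mG aeG.
pose h k : R := @harmonic R k.
have h0 k : 0 < h k by rewrite /h /harmonic/= invr_gt0.
have h1 k : h k <= 1 by rewrite /h /harmonic/= invf_le1// ler1n.
have hcvg : h k @[k --> \oo] --> (0 : R) by exact: cvg_harmonic.
(* Averaging over [s + h, s + 2 h] makes [zeta] C^1 and keeps its support inside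
   the ball. *)
pose z_ k := steklov zeta (h k) (2 * h k).
pose z'_ k (s : R) := (2 * h k - h k)^-1 * (zeta (s + 2 * h k) - zeta (s + h k)).
have hh k : h k < 2 * h k by have := h0 k; lra.
have dz_ k (s : R) : 0 <= s -> is_derive s (1 : R) (z_ k) (z'_ k s).
  move=> s0; apply: is_derive_steklov => //; first exact: ltW.
  by rewrite mulr_ge0// ltW.
have cs (b : R) : continuous (fun s : R => zeta (s + b)).
  move=> s; apply: (@continuous_comp _ _ _ (fun s : R => s + b) zeta); last exact: cz.
  by apply: cvgD; [exact: cvg_id|exact: cvg_cst].
have cz'_ k : continuous (z'_ k).
  apply: continuous_mul; first exact: cst_continuous.
  by move=> s; apply: cvgB; exact: cs.
have zmean k (s : R) : 0 <= s -> exists2 t, s + h k < t < s + 2 * h k & z_ k s = zeta t.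
  by move=> s0; apply: steklov_mean => //; exact: ltW.
pose phi k (x : 'rV[R]_N) : 'rV[R]_N := z_ k (sqn x) *: x.
have tphi k : test_field Omega (phi k).
  apply: (radial_test_field (dz_ k) (cz'_ k) (h0 k)).
    move=> s sr s0; have [t ts ->] := zmean k s s0; apply: z0; lra.
  move=> s s0; have [t ts ->] := zmean k s s0.
  have := h0 k => hk; have t0 : 0 <= t by lra.
  apply: le_trans (z1 t t0); rewrite ler_wpM2r ?sqr_ge0//; lra.
have zB (s : R) : 0 <= s -> `|zeta s| <= K * r ^+ 2.
  move=> s0; have [rs|sr] := leP (r ^+ 2) s.
    by rewrite z0// normr0 mulr_ge0// sqr_ge0.
  have -> : zeta s = zeta s - zeta (r ^+ 2) by rewrite (z0 (r ^+ 2))// subr0.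
  rewrite (le_trans (zlip _ _ _ _))// ?sqr_ge0// ler_wpM2l//.
  by rewrite distrC gtr0_norm ?subr_gt0//; lra.
have cvgI : L2inner mO v (divergence (phi k)) @[k --> \oo] --> L2inner mO v G.
  apply: (@bounded_cvg_L2inner R N r v _ _ (N%:R * (K * r ^+ 2) + 2 * r ^+ 2 * K)).
  - by move=> k; apply: continuous_measurable_rV; exact: divergence_continuous (tphi k).
  - exact: mG.
  - move=> k x; rewrite /eball/= enorm_lt_sqn ?(ltW r_gt0)// => xr.
    rewrite radial_divergence//.
    have s0 := sqn_ge0 x; have [t ts zt] := zmean k (sqn x) s0.
    rewrite (le_trans (ler_normD _ _))// lerD//.
      rewrite normrM ger0_norm// ler_wpM2l// zt zB//.
      by have := h0 k; lra.
    have z'B : `|z'_ k (sqn x)| <= K.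
      have e : 2 * h k - h k = h k by ring.
      rewrite /z'_ e normrM gtr0_norm ?invr_gt0// ler_pdivrMl//.
      have h0k := h0 k.
      rewrite (le_trans (zlip _ _ _ _))//; [lra|lra|].
      rewrite (_ : sqn x + 2 * h k - (sqn x + h k) = h k); last by ring.
      by rewrite gtr0_norm// mulrC.
    rewrite (normrM (2 * sqn x)) (normrM 2) [`|2|]ger0_norm// [`|sqn x|]ger0_norm//.
    apply: ler_pM => //; first by rewrite mulr_ge0.
    by rewrite ler_pM2l// ltW.
  case: aeG => A [mA A0 sA]; exists A; split => // x nx; apply: sA => -[d dd Gx].
  apply: nx => /=; rewrite Gx.
  have s0 := sqn_ge0 x; set s := sqn x in s0 dd Gx *.
  have -> : (fun k => divergence (phi k) x) = fun k => N%:R * z_ k s + 2 * s * z'_ k s.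
    by apply/funext => k; rewrite radial_divergence.
  have c1 : z_ k s @[k --> \oo] --> zeta s.
    apply/cvgrPdist_le => e e0.
    have ek : 0 < e / (2 * K + 1) by rewrite divr_gt0//; lra.
    move/cvgrPdist_lt: hcvg => /(_ _ ek); apply: filterS => k.
    rewrite sub0r normrN gtr0_norm// => he.
    have [t ts ->] := zmean k s s0.
    have h0k := h0 k; have t0 : 0 <= t by lra.
    rewrite (le_trans (zlip _ _ s0 t0))//.
    rewrite distrC gtr0_norm; last lra.
    apply: (@le_trans _ _ (K * (2 * h k))); first by rewrite ler_wpM2l//; lra.
    have : (2 * K + 1) * h k <= e by rewrite -ler_pdivlMl ?(mulrC _ e) ?ltW//; lra.
    lra.
  have c2 : z'_ k s @[k --> \oo] --> d.
    have [dv] := dd; rewrite /derive => dE.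
    have lim0 : h^-1 *: ((zeta \o shift s) (h *: (1 : R)) - zeta s) @[h --> (0 : R)^'] --> d.
      by rewrite -dE; exact: dv.
    have hd (c : R) : 0 < c -> (c * h k)^-1 * (zeta (s + c * h k) - zeta s) @[k --> \oo] --> d.
      move=> c0; have : c * h k @[k --> \oo] --> (0 : R)^'.
        have c3 : c * h k @[k --> \oo] --> (0 : R).
          by rewrite -(mulr0 c); apply: cvgM => //; exact: cvg_cst.
        move=> P [e /= e0 He]; move/cvgrPdist_lt : c3 => /(_ _ e0); apply: filterS => k hk.
        by apply: He => //=; rewrite mulf_neq0// gt_eqF.
      move=> c4; have := cvg_comp _ _ c4 lim0; apply: cvg_trans; apply: near_eq_cvg; apply: nearW => k /=.
      by rewrite [(c * h k)%:A]mulr1 (addrC _ s).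
    (* The slope over [[s + h, s + 2 h]] is twice the difference quotient with step [2 h] minus the
       one with step [h], so differentiability at [s] suffices. *)
    have -> : (fun k => z'_ k s) = fun k => 2 * ((2 * h k)^-1 * (zeta (s + 2 * h k) - zeta s)) -
        (1 * h k)^-1 * (zeta (s + 1 * h k) - zeta s).
      apply/funext => k; rewrite /z'_ mul1r.
      have h0k := h0 k; field; rewrite !gt_eqF//; lra.
    rewrite (_ : d = 2 * d - d); last by ring.
    apply: cvgB; last exact: hd.
    by apply: cvgM; [exact: cvg_cst|exact: hd].
  by apply: cvgD; apply: cvgM => //; exact: cvg_cst.
case tv : (TV mO v) => [c| |]; last 2 first.
- exact: leey.
- by have := TV_ge v (tphi 0%N); rewrite tv leeNy_eq.
rewrite lee_fin; apply: (cvgr_to_le cvgI); apply: nearW => k.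
by rewrite -lee_fin -tv; exact: TV_ge.
Qed.

End radial_field.

(** * The total variation flow of step functions *)

Section discrete_prox.
Context (R : realType) (n : nat) (m P : nat -> R).
Hypothesis m_gt0 : forall j, (j < n.+1)%N -> 0 < m j.
Hypothesis P_ge0 : forall i, 0 <= P i.
Hypothesis P_concave : forall i, (i < n)%N ->
  (P i.+2 - P i.+1) / m i.+1 <= (P i.+1 - P i) / m i.
Implicit Types (Q w g : nat -> R) (t : R).

(** The divergence, constant on cell [j], of a field whose flux is affine in the volume there. *)
Definition slope Q j : R := (Q j.+1 - Q j) / m j.

(** [Q 0 = 0] excludes a source at the centre, [Q n.+1 = 0] is the Neumann condition, and the bound
    expresses a field of norm at most one. *)
Definition admissible Q :=
  [/\ Q 0%N = 0, Q n.+1 = 0 & forall i, (i <= n.+1)%N -> `|Q i| <= P i].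

(** Subgradients are taken as [+ div], so an outward drop of [w] carries a positive flux. *)
Definition calibrates Q w := forall i, (i < n)%N ->
  (w i.+1 < w i -> Q i.+1 = P i.+1) /\ (w i < w i.+1 -> Q i.+1 = - P i.+1).

(** The Euler inclusion: [(g - w) / t] is the divergence of a calibrating flux. *)
Definition discrete_prox t g w Q := [/\ admissible Q, calibrates Q w &
  forall j, (j < n.+1)%N -> w j = g j - t * slope Q j].

Definition flux_pairing Q w : R := \sum_(j < n.+1) (Q j.+1 - Q j) * w j.

Definition discrete_TV w : R := \sum_(i < n) P i.+1 * `|w i - w i.+1|.

Lemma flux_pairingE Q w : Q 0%N = 0 -> Q n.+1 = 0 ->
  flux_pairing Q w = \sum_(i < n) Q i.+1 * (w i - w i.+1).
Proof.
move=> Q0 Qn.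
have H k : \sum_(j < k.+1) (Q j.+1 - Q j) * w j =
    Q k.+1 * w k + \sum_(i < k) Q i.+1 * (w i - w i.+1).
  elim: k => [|k IH]; first by rewrite big_ord_recl !big_ord0 Q0 subr0.
  by rewrite big_ord_recr/= IH [in RHS]big_ord_recr/=; ring.
by rewrite /flux_pairing H Qn mul0r add0r.
Qed.

Lemma flux_pairing_le Q w : admissible Q -> flux_pairing Q w <= discrete_TV w.
Proof.
move=> [Q0 Qn QP]; rewrite flux_pairingE//; apply: ler_sum => i _.
rewrite (le_trans (ler_norm _))// normrM ler_wpM2r//.
by apply: QP; rewrite ltnS ltnW.
Qed.

Lemma flux_pairing_calibrates Q w : admissible Q -> calibrates Q w ->
  flux_pairing Q w = discrete_TV w.
Proof.
move=> [Q0 Qn QP] cQ; rewrite flux_pairingE//; apply: eq_bigr => i _.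
have [h1 h2] := cQ i (ltn_ord i).
have [h|h|->] := ltgtP (w i) (w i.+1).
- by rewrite h2// mulNr -mulrN opprB distrC ger0_norm// subr_ge0 ltW.
- by rewrite h1// ger0_norm// subr_ge0 ltW.
- by rewrite subrr normr0 !mulr0.
Qed.

Lemma flux_pairingB Q Q' w w' : flux_pairing (fun i => Q i - Q' i) (fun j => w j - w' j) =
  flux_pairing Q w - flux_pairing Q w' - flux_pairing Q' w + flux_pairing Q' w'.
Proof.
rewrite /flux_pairing -!sumrN -!big_split/=.
by apply: eq_bigr => j _; ring.
Qed.

(** Calibration makes the pairing of [Q - Q'] with [w - w'] nonnegative, whereas the two equations
    make it [- 1 / t] times the weighted squared distance. *)
Lemma discrete_prox_unique t g w w' Q Q' : 0 < t ->
  discrete_prox t g w Q -> discrete_prox t g w' Q' ->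
  forall j, (j < n.+1)%N -> w j = w' j.
Proof.
move=> t0 [aQ cQ wE] [aQ' cQ' wE'].
have mono : 0 <= flux_pairing (fun i => Q i - Q' i) (fun j => w j - w' j).
  rewrite flux_pairingB (flux_pairing_calibrates aQ cQ) (flux_pairing_calibrates aQ' cQ').
  by have := flux_pairing_le w' aQ; have := flux_pairing_le w aQ'; lra.
have E : flux_pairing (fun i => Q i - Q' i) (fun j => w j - w' j) =
    - (t^-1 * \sum_(j < n.+1) m j * (w j - w' j) ^+ 2).
  rewrite mulr_sumr -sumrN; apply: eq_bigr => j _.
  have mj := m_gt0 (ltn_ord j).
  have : w j - w' j = - t * (slope Q j - slope Q' j).
    by rewrite wE// wE'//; ring.
  have -> : Q j.+1 - Q' j.+1 - (Q j - Q' j) = m j * (slope Q j - slope Q' j).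
    by rewrite /slope; field; rewrite gt_eqF.
  by move=> ->; field; rewrite gt_eqF.
have S0 : \sum_(j < n.+1) m j * (w j - w' j) ^+ 2 = 0.
  apply/eqP; rewrite eq_le; apply/andP; split; last first.
    by apply: sumr_ge0 => j _; rewrite mulr_ge0 ?sqr_ge0// ltW// m_gt0.
  by move: mono; rewrite E oppr_ge0 pmulr_rle0// invr_gt0.
move=> j jn; have /eqP := S0; rewrite psumr_eq0 => [/allP/(_ (Ordinal jn))|i _].
  rewrite mem_index_enum => /(_ isT) /=; rewrite mulf_eq0 gt_eqF ?m_gt0//=.
  by rewrite sqrf_eq0 subr_eq0 => /eqP.
by rewrite mulr_ge0 ?sqr_ge0// ltW// m_gt0.
Qed.

(** Contact with a concave obstacle: if [Q] meets [P] at [i.+1] and stays below it at both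
    neighbours, then [slope Q i.+1 <= slope P i.+1 <= slope P i <= slope Q i]. *)
Lemma slope_monotone Q i : (i < n)%N -> admissible Q ->
  (Q i.+1 = P i.+1 -> slope Q i.+1 <= slope Q i) /\
  (Q i.+1 = - P i.+1 -> slope Q i <= slope Q i.+1).
Proof.
move=> iN [Q0 Qn QP].
have := QP i (leqW (ltnW iN)); have := QP i.+2 iN; rewrite !ler_norml.
move=> /andP[h1 h2] /andP[h3 h4].
have m1 := m_gt0 (ltnW iN : (i < n.+1)%N); have m2 := m_gt0 (iN : (i.+1 < n.+1)%N).
have C := P_concave iN; rewrite /slope; split => ->.
  apply: le_trans (le_trans _ C) _; rewrite ler_pM2r ?invr_gt0//; lra.
rewrite -lerN2; apply: le_trans (le_trans _ C) _; rewrite -mulNr ler_pM2r ?invr_gt0//; lra.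
Qed.

(* The jumps of [v] survive in [w] only with their sign, so the flux of the
   first step also calibrates the outcome of the second one. *)
Lemma discrete_prox_semigroup s t g v w Q Q' : 0 < s -> 0 < t ->
  discrete_prox s g v Q -> discrete_prox t v w Q' ->
  exists Q'', discrete_prox (s + t) g w Q''.
Proof.
move=> s0 t0 [aQ cQ vE] [aQ' cQ' wE].
have st0 : 0 < s + t by rewrite addr_gt0.
have cQw : calibrates Q w.
  move=> i iN; have [h1 h2] := cQ i iN; have [h3 h4] := cQ' i iN.
  have [h5 h6] := slope_monotone iN aQ'.
  have wi := wE i (ltnW iN); have wi1 := wE i.+1 iN.
  split=> wlt.
    apply: h1; have : t * slope Q' i.+1 <= t * slope Q' i by rewrite ler_pM2l// h5// h3.
    lra.
  apply: h2; have : t * slope Q' i <= t * slope Q' i.+1 by rewrite ler_pM2l// h6// h4.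
  lra.
(* Weights proportional to the durations, so that [s + t] times the new slope is the total change
   from [g] to [w]. *)
exists (fun i => (s * Q i + t * Q' i) / (s + t)); split.
- case: aQ aQ' => [a1 a2 a3] [b1 b2 b3]; split.
  + by rewrite a1 b1 !mulr0 addr0 mul0r.
  + by rewrite a2 b2 !mulr0 addr0 mul0r.
  move=> i iN; rewrite normrM [`|_^-1|]gtr0_norm ?invr_gt0// ler_pdivrMr//.
  rewrite (le_trans (ler_normD _ _))// !normrM (gtr0_norm s0) (gtr0_norm t0).
  by rewrite mulrDr !(mulrC (P i)) lerD// ler_pM2l// ?a3// b3.
- move=> i iN; have [h1 h2] := cQw i iN; have [h3 h4] := cQ' i iN; split=> wlt.
    by rewrite h1// h3//; field; rewrite gt_eqF.
  by rewrite h2// h4//; field; rewrite gt_eqF.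
- move=> j jn; rewrite wE// vE//.
  have -> : slope (fun i => (s * Q i + t * Q' i) / (s + t)) j =
      (s * slope Q j + t * slope Q' j) / (s + t).
    by rewrite /slope; field; rewrite !gt_eqF// m_gt0.
  by field; rewrite gt_eqF.
Qed.

(* [Q] minimizes t/2 sum_j slope_j^2 m_j - sum_j g_j (Q_{j+1} - Q_j) over the box
   |Q_i| <= P_i; optimality in each coordinate is the calibration condition. *)
Lemma discrete_prox_exists t g : 0 < t -> exists w Q, discrete_prox t g w Q.
Proof.
move=> t0.
(* The box degenerates to a point at the two end indices, which encodes the boundary conditions. *)
pose b (i : 'I_n.+2) : R := if (0 < i < n.+1)%N then P i else 0.
pose q (y : 'rV[R]_n.+2) i : R := y 0 (inord i).
pose term (j : nat) (x : R) : R := t / 2 * x ^+ 2 / m j - g j * x.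
pose E y : R := \sum_(j < n.+1) term j (q y j.+1 - q y j).
pose A : set 'rV[R]_n.+2 := [set y | forall i, `[- b i, b i]%classic (y 0 i)].
have cA : compact A.
  by have := @rV_compact R n.+2 (fun i => `[- b i, b i]%classic); apply => i; exact: segment_compact.
have b0 i : 0 <= b i by rewrite /b; case: ifP.
have A0 : A !=set0 by exists 0 => i /=; rewrite mxE in_itv/= oppr_le0 b0.
have cq i : continuous ((fun y => q y i) : 'rV[R]_n.+2 -> R).
  exact: coord_continuous.
have cE : continuous E.
  have cF (j : 'I_n.+1) : continuous (fun y => term j (q y j.+1 - q y j)).
    have cd : continuous (fun y => q y j.+1 - q y j).
      apply: continuous_add; first exact: (cq j.+1).
      by apply: continuous_opp; exact: (cq j).
    apply: continuous_add; last first.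
      by apply: continuous_opp; apply: continuous_mul; [exact: cst_continuous|exact: cd].
    apply: continuous_mul; last exact: cst_continuous.
    apply: continuous_mul; first exact: cst_continuous.
    by apply: continuous_mul; exact: cd.
  exact: continuous_sum.
have [|y yA ymin] := @EVT_min_rV R _ E A A0 cA; first exact: continuous_subspaceT.
have {}yA : A y by move: yA; rewrite inE.
have yb (i : 'I_n.+2) : `|y 0 i| <= b i by have := yA i; rewrite /= in_itv/= -ler_norml.
pose Q i := q y i.
pose w j := g j - t * slope Q j.
have qI (i : 'I_n.+2) : Q i = y 0 i by rewrite /Q /q inord_val.
have aQ : admissible Q.
  split.
  - have := yb ord0; rewrite /b/= normr_le0 => /eqP.
    by rewrite -qI.
  - have := yb ord_max; rewrite /b/= ltnn normr_le0 => /eqP.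
    by rewrite -qI.
  - move=> i iN; rewrite -[i]/(nat_of_ord (Ordinal (iN : (i < n.+2)%N))) qI.
    by apply: le_trans (yb _) _; rewrite /b; case: ifP.
(* Changing the flux at [i.+1] affects only cells [i] and [i.+1]; as the energy is quadratic, its
   expansion in [h] is exact. *)
have var i (h : R) : (i < n)%N -> `|Q i.+1 + h| <= P i.+1 ->
    0 <= h * (w i.+1 - w i) + h ^+ 2 * (t / 2 * ((m i)^-1 + (m i.+1)^-1)).
  move=> iN Qh.
  have i1 : (i.+1 < n.+2)%N by rewrite ltnS ltnW.
  pose o : 'I_n.+2 := Ordinal i1.
  pose y' : 'rV[R]_n.+2 := y + h *: delta_mx 0 o.
  have q' (k : nat) : (k < n.+2)%N -> q y' k = Q k + h * (k == i.+1)%:R.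
    by move=> kn; rewrite /q /y' !mxE eqxx/= -val_eqE/= inordK.
  have y'A : y' \in A.
    rewrite inE => k; rewrite /= in_itv/= -ler_norml /y' !mxE eqxx/=.
    have [->|ko] := eqVneq k o; last by rewrite mulr0 addr0.
    rewrite mulr1 -qI/= /b/= ifT//.
  have := ymin _ y'A; rewrite -subr_ge0 -sumrB.
  have i0n : (i < n.+1)%N by rewrite ltnW.
  rewrite (bigD1 (Ordinal i0n))//= (bigD1 (Ordinal (iN : (i.+1 < n.+1)%N)))/=; last first.
    by rewrite -val_eqE/= gtn_eqF.
  rewrite big1 => [|j /andP[j1 j2]]; last first.
    have jn1 : (j.+1 < n.+2)%N by rewrite ltnS ltn_ord.
    rewrite (q' _ jn1) (q' _ (ltnW jn1)).
    have -> : (nat_of_ord j).+1 == i.+1 = false.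
      by apply/negbTE; rewrite eqSS; move: j1; rewrite -val_eqE.
    have -> : nat_of_ord j == i.+1 = false by apply/negbTE; move: j2; rewrite -val_eqE.
    by rewrite !mulr0 !addr0 subrr.
  have mi := m_gt0 i0n; have mi1 := m_gt0 (iN : (i.+1 < n.+1)%N).
  have i2 : (i.+2 < n.+2)%N by rewrite !ltnS.
  rewrite (q' _ i1) (q' _ (ltnW i1)) (q' _ i2).
  rewrite eqxx (gtn_eqF (ltnSn i.+1)) (ltn_eqF (ltnSn i)) !mulr0 !addr0 mulr1.
  rewrite -/(Q i.+1) -/(Q i) -/(Q i.+2).
  set X := (X in 0 <= X -> _); set Y := (Y in _ -> 0 <= Y).
  suff -> : X = Y by [].
  by rewrite /X /Y /term /w /slope; field; rewrite !gt_eqF.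
exists w, Q; split=> //.
move=> i iN; have [_ _ QP] := aQ; have Qi : `|Q i.+1| <= P i.+1 by apply: QP; rewrite ltnS ltnW.
have i0n : (i < n.+1)%N by rewrite ltnW.
have mi := m_gt0 i0n; have mi1 := m_gt0 (iN : (i.+1 < n.+1)%N).
set K := t / 2 * ((m i)^-1 + (m i.+1)^-1) in var *.
have {}var h := var i h iN; rewrite -/K in var.
have K0 : 0 < K by rewrite mulr_gt0 ?divr_gt0// addr_gt0 ?invr_gt0.
clearbody K.
have step (h : R) : `|Q i.+1 + h| <= P i.+1 -> h != 0 ->
    h * (w i - w i.+1) <= 0 \/ `|w i - w i.+1| < 2 * K * `|h|.
  move=> /var H hn0; case: (leP (h * (w i - w i.+1)) 0) => [|hw]; first by left.
  right; rewrite -(ltr_pM2l (_ : 0 < `|h|)) ?normr_gt0// -normrM gtr0_norm//.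
  have -> : `|h| * (2 * K * `|h|) = 2 * (h ^+ 2 * K).
    by rewrite -[in RHS](real_normK (num_real h)); ring.
  have : 0 < h ^+ 2 * K by rewrite mulr_gt0// exprn_even_gt0.
  lra.
move: Qi; rewrite ler_norml => /andP[Q1 Q2].
split=> wlt; apply/eqP; rewrite eq_le; apply/andP; split; rewrite ?Q1 ?Q2// leNgt; apply/negP => Qlt.
  (* Small enough to remain in the box and for the quadratic term [K h^2] to be at most half of the
     linear gain [h (w i - w i.+1)]. *)
  pose h := Num.min (P i.+1 - Q i.+1) ((w i - w i.+1) / (2 * K)).
  have h1 : h <= P i.+1 - Q i.+1 by rewrite ge_min lexx.
  have h2 : h <= (w i - w i.+1) / (2 * K) by rewrite ge_min lexx orbT.
  have h0 : 0 < h by rewrite lt_min subr_gt0 Qlt divr_gt0 ?subr_gt0// mulr_gt0.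
  have Qh : `|Q i.+1 + h| <= P i.+1 by rewrite ler_norml; apply/andP; split; lra.
  have [|] := step h Qh (lt0r_neq0 h0).
    by rewrite pmulr_rle0// subr_le0 leNgt wlt.
  rewrite !gtr0_norm ?subr_gt0//; move: h2; rewrite ler_pdivlMr ?mulr_gt0//.
  rewrite (mulrC h); move: (2 * K * h) (w i - w i.+1) => a b'; lra.
pose h := Num.min (P i.+1 + Q i.+1) ((w i.+1 - w i) / (2 * K)).
have h1 : h <= P i.+1 + Q i.+1 by rewrite ge_min lexx.
have h2 : h <= (w i.+1 - w i) / (2 * K) by rewrite ge_min lexx orbT.
have h0 : 0 < h by rewrite lt_min divr_gt0 ?subr_gt0 ?mulr_gt0//; lra.
have Qh : `|Q i.+1 - h| <= P i.+1 by rewrite ler_norml; apply/andP; split; lra.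
have hn0 : - h != 0 by rewrite oppr_eq0 gt_eqF.
have [|] := step (- h) Qh hn0.
  by rewrite mulNr -mulrN opprB pmulr_rle0// subr_le0 leNgt wlt.
rewrite normrN distrC !gtr0_norm ?subr_gt0//; move: h2; rewrite ler_pdivlMr ?mulr_gt0//.
rewrite (mulrC h); move: (2 * K * h) (w i.+1 - w i) => a b'; lra.
Qed.

(** Each [v t] is obtained from [g] in a single step. Going through [v s] leads to the same point,
    by the semigroup property and uniqueness, so the second flux of the detour also serves the step
    from [s] to [t]. *)
Lemma discrete_prox_path g : exists v : R -> nat -> R, v 0 = g /\
  forall s t, 0 <= s -> s < t -> exists Q, discrete_prox (t - s) (v s) (v t) Q.
Proof.
have /choice[v0 Hv0] : forall t : R, exists w, 0 < t -> exists Q, discrete_prox t g w Q.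
  move=> t; have [t0|t0] := ltP 0 t; last by exists g.
  by have [w [Q HQ]] := discrete_prox_exists g t0; exists w => _; exists Q.
pose v t := if t == 0 then g else v0 t.
exists v; split; first by rewrite /v eqxx.
have Hv t : 0 < t -> exists Q, discrete_prox t g (v t) Q.
  by move=> t0; rewrite /v gt_eqF//; exact: Hv0.
move=> s t; rewrite le_eqVlt => /predU1P[<- t0|s0 st].
  by rewrite subr0 {1}/v eqxx; exact: Hv.
have [Q HQ] := Hv s s0; have ts0 : 0 < t - s by rewrite subr_gt0.
have [w [Q' HQ']] := discrete_prox_exists (v s) ts0.
have [Q'' HQ''] := discrete_prox_semigroup s0 ts0 HQ HQ'.
have t0 : 0 < t by rewrite (lt_trans s0).
have [Q3 HQ3] := Hv t t0.
rewrite (addrC s) subrK in HQ''.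
have E := discrete_prox_unique t0 HQ3 HQ''.
exists Q'; case: HQ' => aQ' cQ' wE; split=> //.
  by move=> i iN; rewrite !E ?ltnS ?(ltnW iN)//; exact: cQ'.
by move=> j jn; rewrite E// wE.
Qed.

End discrete_prox.

(** * Step functions on shells *)

Section flux_profile.
Context (R : realType) (N : nat).
Hypothesis N_gt0 : (0 < N)%N.

(* [N^-1 *: psi a (|x|^2) *: x] has divergence the indicator of the ball of
   radius [a]. *)
Definition psi (a s : R) : R := (a / Num.sqrt (Num.max s (a ^+ 2))) ^+ N.

Let invsqrt (a u : R) : R := (a / Num.sqrt u) ^+ N.

Lemma psi0 s : psi 0 s = 0.
Proof. by rewrite /psi mul0r expr0n gtn_eqF. Qed.

Lemma psi_le (a s : R) : 0 < a -> s <= a ^+ 2 -> psi a s = 1.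
Proof.
by move=> a0 sa; rewrite /psi max_r// sqrtr_sqr gtr0_norm// divff ?expr1n// gt_eqF.
Qed.

Lemma psi_ge (a s : R) : a ^+ 2 <= s -> psi a s = (a / Num.sqrt s) ^+ N.
Proof. by move=> sa; rewrite /psi max_l. Qed.

(** Up to the factor [omega], the flux through the sphere of radius [t] of the field attached to
    [psi a]: the volume of the ball of radius [min t a]. *)
Lemma psi_min (a t : R) : 0 <= a -> 0 < t -> psi a (t ^+ 2) * t ^+ N = Num.min t a ^+ N.
Proof.
move=> a0 t0; have [ta|at'] := leP t a.
  have a1 : 0 < a by apply: lt_le_trans ta.
  by rewrite psi_le ?mul1r// ler_sqr ?nnegrE// ltW.
rewrite psi_ge; last by rewrite ler_sqr ?nnegrE// ltW.
by rewrite sqrtr_sqr gtr0_norm// -exprMn divfK// gt_eqF.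
Qed.

Lemma is_derive_invsqrt (a u : R) : 0 < u ->
  is_derive u (1 : R) (invsqrt a) (- (N%:R / (2 * u)) * invsqrt a u).
Proof.
move=> u0; have su0 : 0 < Num.sqrt u by rewrite sqrtr_gt0.
have d1 := is_derive1_sqrt u0.
have d2 := is_deriveV (lt0r_neq0 su0) d1.
have d3 := is_deriveZ a d2.
have d4 := is_deriveX N d3.
have uE : u = Num.sqrt u * Num.sqrt u by rewrite -expr2 sqr_sqrtr// ltW.
have fE : (a \*: (fun x : R => (Num.sqrt x)^-1)) ^+ N = invsqrt a.
  by apply/funext => x; rewrite exprfctE.
rewrite fE in d4; apply: (is_derive_eq d4).
rewrite /invsqrt; set S := Num.sqrt u in uE su0 *.
have -> : (a \*: (fun x : R => (Num.sqrt x)^-1)) u = a / S by [].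
have -> : (a / S) ^+ N = a / S * (a / S) ^+ N.-1 by rewrite -exprS prednK.
rewrite uE; move: ((a / S) ^+ N.-1) => X; rewrite -![_ *: _]/(_ * _).
by field; rewrite gt_eqF.
Qed.

Lemma is_derive_psi_gt (a s : R) : 0 <= a -> a ^+ 2 < s ->
  is_derive s (1 : R) (psi a) (- (N%:R / (2 * s)) * psi a s).
Proof.
move=> a0 sa; have s0 : 0 < s by apply: le_lt_trans sa; rewrite sqr_ge0.
rewrite {2}/psi max_l ?(ltW sa)//.
apply: near_eq_is_derive (is_derive_invsqrt a s0) => //.
near=> u; rewrite /psi max_l//; near: u.
by apply: filterS (lt_nbhsr sa) => u /ltW.
Unshelve. all: by end_near. Qed.

Lemma is_derive_psi_lt (a s : R) : 0 < a -> s < a ^+ 2 ->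
  is_derive s (1 : R) (psi a) 0.
Proof.
move=> a0 sa; apply: near_eq_is_derive (is_derive_cst (1 : R) s 1) => //.
near=> u; rewrite psi_le//; near: u.
by apply: filterS (lt_nbhsl sa) => u /ltW.
Unshelve. all: by end_near. Qed.

(** The left side of the identity is the divergence of [psi a (sqn x) *: x] at [sqn x = s]. The
    excluded value is the kink, a null sphere. *)
Lemma derive_psi (a s : R) : 0 <= a -> s != a ^+ 2 -> 0 <= s -> exists2 d,
  is_derive s (1 : R) (psi a) d & N%:R * psi a s + 2 * s * d = N%:R * (s < a ^+ 2)%R%:R.
Proof.
move=> a0 sa s0; have [slt|sgt|E] := ltgtP s (a ^+ 2).
- have a1 : 0 < a.
    by move: a0 slt; rewrite le_eqVlt => /predU1P[<-|//]; rewrite expr0n/=; lra.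
  exists 0; first exact: is_derive_psi_lt.
  by rewrite mulr0 addr0 psi_le// ltW.
- have s1 : 0 < s by apply: le_lt_trans sgt; rewrite sqr_ge0.
  exists (- (N%:R / (2 * s)) * psi a s); first exact: is_derive_psi_gt.
  by rewrite mulr0; field; rewrite gt_eqF.
- by rewrite E eqxx in sa.
Qed.

Lemma psi_lipschitz (a : R) : 0 <= a -> exists2 K, 0 <= K &
  forall s t, `|psi a s - psi a t| <= K * `|s - t|.
Proof.
rewrite le_eqVlt => /predU1P[<-|a0].
  by exists 0 => // s t; rewrite !psi0 subrr normr0 mul0r.
have a20 : 0 < a ^+ 2 by rewrite exprn_gt0.
(* The bound for the derivative [N / (2 u) (a / sqrt u)^N] on [u >= a^2]; below [a^2] the profile is
   constant. *)
pose K := N%:R / (2 * a ^+ 2).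
have K0 : 0 <= K by rewrite divr_ge0// mulr_ge0// ltW.
exists K => // s t; wlog st : s t / s <= t.
  move=> W; have [|/ltW] := leP s t; first exact: W.
  by rewrite distrC (distrC s); exact: W.
pose u := Num.max s (a ^+ 2); pose v := Num.max t (a ^+ 2).
have ua : a ^+ 2 <= u by rewrite le_max lexx orbT.
have uv : u <= v by rewrite /u /v ge_max !le_max st lexx orbT.
have vu : v - u <= t - s by rewrite /u /v; case: (leP t) => h1; case: (leP s) => h2; lra.
change (`|invsqrt a u - invsqrt a v| <= K * `|s - t|).
apply: (@le_trans _ _ (K * (v - u))); last first.
  by rewrite ler_wpM2l// distrC ger0_norm ?subr_ge0.
move: uv; rewrite le_eqVlt => /predU1P[->|uv]; first by rewrite !subrr normr0 mulr0.
have [||w] := @MVT R (invsqrt a) (fun u => - (N%:R / (2 * u)) * invsqrt a u) u v uv.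
- move=> x; rewrite in_itv/= => /andP[ux _]; apply: is_derive_invsqrt.
  exact: lt_le_trans a20 (ltW (le_lt_trans ua ux)).
- apply: derivable_within_continuous => x; rewrite in_itv/= => /andP[ux _].
  have x0 : 0 < x by apply: lt_le_trans a20 (le_trans ua ux).
  by have [] := is_derive_invsqrt a x0.
rewrite in_itv/= => /andP[uw _]; rewrite distrC => ->.
have w0 : a ^+ 2 < w := le_lt_trans ua uw.
have w1 : 0 < w := lt_trans a20 w0.
rewrite normrM [`|v - u|]gtr0_norm ?subr_gt0// ler_pM2r ?subr_gt0//.
rewrite normrM normrN [`|N%:R / _|]ger0_norm; last by rewrite divr_ge0// mulr_ge0// ltW.
rewrite -[leRHS]mulr1; apply: ler_pM => //.
- by rewrite divr_ge0// mulr_ge0// ltW.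
- by rewrite /K ler_wpM2l// lef_pV2 ?posrE ?mulr_gt0// ler_pM2l// ltW.
- rewrite ger0_norm; last by rewrite exprn_ge0// divr_ge0// ?ltW// sqrtr_ge0.
  rewrite exprn_ile1//; first by rewrite divr_ge0 ?sqrtr_ge0// ltW.
  rewrite ler_pdivrMr ?sqrtr_gt0// mul1r -[leLHS]gtr0_norm// -sqrtr_sqr.
  by rewrite ler_wsqrtr// ltW.
Qed.

End flux_profile.

(** * The perimeter as a concave function of the enclosed volume *)

Section perimeter_concave.
Context (R : realType) (N : nat).
Hypothesis N_gt0 : (0 < N)%N.
Local Notation om := (omega R N).

Lemma predn_natr : N.-1%:R = N%:R - 1 :> R.
Proof. by rewrite -{2}(prednK N_gt0) -natr1 addrK. Qed.

Lemma expr_predn (x : R) : x ^+ N = x * x ^+ N.-1.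
Proof. by rewrite -exprS prednK. Qed.

(** The tangent at radius [y] of the perimeter as a function of volume, whose slope is
    [(N - 1) / y], multiplied by [y] to allow [y = 0]. *)
Lemma per_tangent (x y : R) : 0 <= x -> 0 <= y ->
  y * (per N x - per N y) <= N.-1%:R * (om * x ^+ N - om * y ^+ N).
Proof.
move=> x0 y0; have H := young_predn N_gt0 y0 x0.
have om0 := omega_gt0 R N.
have := ler_wpM2l (ltW om0) H; rewrite /per predn_natr (expr_predn y); lra.
Qed.

Lemma expr_sub_le (x y : R) : 0 <= x -> 0 <= y ->
  y ^+ N - x ^+ N <= N%:R * y ^+ N.-1 * (y - x).
Proof.
move=> x0 y0; have := young_predn N_gt0 x0 y0.
rewrite predn_natr (expr_predn y); lra.
Qed.

(** The sphere lies in the shells between [a] and [a + d], of volume at most [C d] for [d <= 1]. *)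
Lemma leb_sphere (a : R) : 0 <= a -> leb R N [set x | sqn x = a ^+ 2] = 0%E.
Proof.
move=> a0; set S := [set x | _].
have mS : measurable S.
  rewrite (_ : S = @sqn R N @^-1` [set a ^+ 2])//.
  have ms : measurable_fun setT (@sqn R N) by apply: continuous_measurable_rV; exact: continuous_sqn.
  by rewrite -[X in measurable X]setTI; apply: ms.
apply/eqP; rewrite eq_le measure_ge0 andbT; apply/lee_addgt0Pr => e e0; rewrite add0e.
have om0 := omega_gt0 R N.
pose C := om * (N%:R * (a + 1) ^+ N.-1) + 1.
have C0 : 0 < C.
  by rewrite /C ltr_wpDl// mulr_ge0 ?(ltW om0)// mulr_ge0// exprn_ge0//; lra.
pose d := Num.min 1 (e / C).
have d1 : d <= 1 by rewrite ge_min lexx.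
have d2 : d <= e / C by rewrite ge_min lexx orbT.
have d0 : 0 < d by rewrite lt_min ltr01 divr_gt0.
apply: (@le_trans _ _ (leb R N (eball (a + d) `\` eball a))).
  apply: le_measure; rewrite ?inE//.
    by apply: measurableD; exact: measurable_eball.
  move=> x; rewrite /S/= => sx; split.
    by rewrite /eball/= enorm_lt_sqn ?sx ?ltr_sqr ?nnegrE//; lra.
  by rewrite /eball/= enorm_lt_sqn// sx ltxx.
rewrite measureD//; [|exact: measurable_eball|exact: measurable_eball|exact: leb_eball_lty].
rewrite (_ : _ `&` _ = eball a); last first.
  by apply/setIidr => x; rewrite /eball/= => h; apply: lt_trans h _; rewrite ltrDl.
have ad0 : 0 <= a + d by lra.
rewrite [X in (X - _)%E](leb_eball N_gt0 ad0) [X in (_ - X)%E](leb_eball N_gt0 a0).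
rewrite -EFinB lee_fin -mulrBr.
apply: (@le_trans _ _ (om * (N%:R * (a + d) ^+ N.-1 * d))).
  rewrite ler_wpM2l ?(ltW om0)//; apply: le_trans (expr_sub_le a0 ad0) _.
  by rewrite addrAC subrr add0r.
apply: (@le_trans _ _ (C * d)); last by rewrite mulrC -ler_pdivlMr.
have -> : om * (N%:R * (a + d) ^+ N.-1 * d) = om * (N%:R * (a + d) ^+ N.-1) * d by ring.
rewrite ler_pM2r// /C ler_wpDr// ler_wpM2l ?(ltW om0)// ler_wpM2l//.
by rewrite lerXn2r ?nnegrE//; lra.
Qed.

End perimeter_concave.

Section steps.
Context (R : realType) (N : nat) (r : R) (n : nat).
Hypothesis (N_gt0 : (0 < N)%N) (r_gt0 : 0 < r).
Local Notation mO := (measurable_eball R N r).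
Local Notation mu := (lebesgue_on mO).
Local Notation L2 := (L2 mO).
Local Notation om := (omega R N).

Definition node (i : nat) : R := r * i%:R / n.+1%:R.

Lemma node0 : node 0 = 0. Proof. by rewrite /node mulr0 mul0r. Qed.

Lemma nodeS : node n.+1 = r. Proof. by rewrite /node mulfK. Qed.

Lemma node_lt i j : (i < j)%N -> node i < node j.
Proof. by move=> ij; rewrite ltr_pM2r ?invr_gt0// ltr_pM2l// ltr_nat. Qed.

Lemma node_le i j : (i <= j)%N -> node i <= node j.
Proof. by rewrite leq_eqVlt => /predU1P[->//|/node_lt/ltW]. Qed.

Lemma node_ge0 i : 0 <= node i.
Proof. by rewrite -node0 node_le. Qed.

Definition shell_vol (j : nat) : R := om * node j.+1 ^+ N - om * node j ^+ N.

Definition node_per (i : nat) : R := per N (node i).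

Lemma shell_vol_gt0 j : 0 < shell_vol j.
Proof.
rewrite /shell_vol subr_gt0 ltr_pM2l ?omega_gt0// ltrXn2r ?nnegrE ?node_ge0//.
  by rewrite -lt0n.
exact: node_lt.
Qed.

Lemma node_per_ge0 i : 0 <= node_per i.
Proof. by rewrite /node_per /per !mulr_ge0 ?exprn_ge0 ?node_ge0// ltW// omega_gt0. Qed.

(** Both chord slopes are compared with the tangent slope [(N - 1) / node i.+1] at the common
    node. *)
Lemma node_per_concave i :
  (node_per i.+2 - node_per i.+1) / shell_vol i.+1 <=
  (node_per i.+1 - node_per i) / shell_vol i.
Proof.
have y0 : 0 < node i.+1 by rewrite -node0 node_lt.
have v0 := shell_vol_gt0 i; have v1 := shell_vol_gt0 i.+1.
apply: (@le_trans _ _ (N.-1%:R / node i.+1)).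
  rewrite ler_pdivrMr// mulrAC ler_pdivlMr// mulrC.
  by have := per_tangent N_gt0 (node_ge0 i.+2) (ltW y0); rewrite -/(shell_vol _).
rewrite ler_pdivlMr// mulrAC ler_pdivrMr// (mulrC _ (node _)).
have := per_tangent N_gt0 (node_ge0 i) (ltW y0); rewrite /shell_vol /node_per; lra.
Qed.

Definition shell (j : nat) : set 'rV[R]_N := eball (node j.+1) `\` eball (node j).

Lemma measurable_shell j : measurable (shell j).
Proof. by apply: measurableD; exact: measurable_eball. Qed.

Lemma shell_L2 j : \1_(shell j) \in Lfun mu 2%:E.
Proof.
apply: (@bounded_L2 R N r _ 1); first by apply: measurable_indic; exact: measurable_shell.
by move=> x; rewrite indicE; case: (_ \in _); rewrite ?normr1 ?normr0.
Qed.

Definition shellL j : L2 := Lfun_Sub (lee1n 2) (shell_L2 j).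

Definition step (w : nat -> R) : L2 := \sum_(j < n.+1) w j *: shellL j.

Lemma L2_sumE k (f : 'I_k -> L2) x : (\sum_i f i : L2) x = \sum_i f i x.
Proof. by apply: (big_morph (fun f : L2 => f x)). Qed.

Lemma L2inner_suml k (f : 'I_k -> L2) (g : L2) :
  L2inner mO (\sum_i f i : L2) g = \sum_i L2inner mO (f i) g.
Proof.
apply: (big_morph (fun f : L2 => L2inner mO f g)); first by move=> x y; exact: L2innerDl.
by have := L2innerZl 0 (0 : L2) g; rewrite scale0r mul0r.
Qed.

Lemma stepE w x : step w x = \sum_(j < n.+1) w j * \1_(shell j) x.
Proof. by rewrite L2_sumE. Qed.

Lemma L2inner_step w (g : L2) : L2inner mO (step w) g = \sum_(j < n.+1) w j * L2inner mO (shellL j) g.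
Proof. by rewrite L2inner_suml; apply: eq_bigr => j _; rewrite L2innerZl. Qed.

Lemma shell_disjoint i j x : shell i x -> shell j x -> i = j.
Proof.
have H k l : (k < l)%N -> shell k x -> shell l x -> False.
  move=> kl [h1 _] [_]; apply; apply: lt_le_trans h1 _; exact: node_le.
by move=> si sj; case: (ltngtP i j) => // ij; exfalso; [apply: (H i j)|apply: (H j i)].
Qed.

Lemma L2inner_shell i j : (i < n.+1)%N ->
  L2inner mO (shellL i) (shellL j) = (i == j)%:R * shell_vol i.
Proof.
move=> iN; rewrite /L2inner.
have [<-|ij] := eqVneq i j; last first.
  rewrite mul0r (_ : (fun x => _) = cst 0) ?Rintegral_cst ?mul0r//.
  apply/funext => x /=; rewrite !indicE.
  have [/set_mem xi|] := boolP (x \in shell i); last by rewrite mul0r.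
  have [/set_mem xj|] := boolP (x \in shell j); last by rewrite mulr0.
  by rewrite (shell_disjoint xi xj) eqxx in ij.
rewrite mul1r (_ : (fun x => _) = \1_(shell i)); last first.
  by apply/funext => x /=; rewrite !indicE; case: (_ \in _); rewrite ?mulr1 ?mulr0.
rewrite /Rintegral integral_indic//; last exact: measurable_shell.
rewrite setIT lebesgue_onE setIidl; last first.
  by move=> x [h _]; apply: lt_le_trans h _; rewrite -[leRHS]nodeS; exact: node_le.
have sub : eball (node i) `<=` eball (N := N) (node i.+1).
  by move=> x h; apply: lt_trans h _; exact: node_lt.
rewrite /shell measureD//; [|exact: measurable_eball|exact: measurable_eball|exact: leb_eball_lty].
rewrite (setIidr sub) [X in (X - _)%E](leb_eball N_gt0 (node_ge0 _)).
by rewrite [X in (_ - X)%E](leb_eball N_gt0 (node_ge0 _)).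
Qed.

Lemma L2inner_step_step w w' :
  L2inner mO (step w) (step w') = \sum_(j < n.+1) w j * (w' j * shell_vol j).
Proof.
rewrite L2inner_step; apply: eq_bigr => j _; congr (_ * _).
rewrite L2innerC L2inner_step (bigD1 j)//= big1 ?addr0 => [|i ij].
  by rewrite L2inner_shell// eqxx mul1r.
by rewrite L2inner_shell// val_eqE (negbTE ij) mul0r mulr0.
Qed.

Local Notation shell_slope := (slope shell_vol).
Local Notation admissible := (admissible n node_per).
Local Notation calibrates := (calibrates n node_per).

Lemma L2inner_slope Q w : L2inner mO (step (shell_slope Q)) (step w) = flux_pairing n Q w.
Proof.
rewrite L2inner_step_step; apply: eq_bigr => j _; rewrite /slope.
by field; rewrite gt_eqF// shell_vol_gt0.
Qed.

Lemma indicD (A B : set 'rV[R]_N) : A `<=` B ->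
  \1_(B `\` A) = (fun x => \1_B x - \1_A x) :> ('rV[R]_N -> R).
Proof.
move=> AB; apply/funext => x; rewrite !indicE.
have [xA|xA] := boolP (x \in A).
  have -> : x \in B by rewrite inE; apply: AB; exact: set_mem.
  rewrite subrr (_ : (x \in _) = false)//; apply/negbTE; rewrite notin_setE => -[_].
  by apply; exact: set_mem.
rewrite subr0; congr (nat_of_bool _)%:R; apply/idP/idP; rewrite !inE.
  by case.
by move=> xB; split => //; rewrite notin_setE in xA.
Qed.

Lemma shellE j : \1_(shell j) = (fun x => \1_(eball (node j.+1)) x - \1_(eball (node j)) x)
  :> ('rV[R]_N -> R).
Proof. by apply: indicD => x h; apply: lt_trans h _; exact: node_lt. Qed.

(** For any test field, the integrals of its divergence over the balls [eball (node i)] form an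
    admissible flux; the bound is then the discrete one. *)
Lemma TV_step_le w : (TV mO (step w) <= (discrete_TV n node_per w)%:E)%E.
Proof.
apply: TV_le => phi tphi; rewrite lee_fin.
have dphi := divergence_L2 tphi; pose d : L2 := Lfun_Sub (lee1n 2) dphi.
pose D i : R := if i is _.+1 then L2inner mO (divergence phi) (\1_(eball (node i))) else 0.
have iB (a : R) : mu.-integrable setT (fun x => (divergence phi x * \1_(eball a) x)%:E).
  have hB : \1_(eball a) \in Lfun mu 2%:E.
    apply: (@bounded_L2 R N r _ 1); first by apply: measurable_indic; exact: measurable_eball.
    by move=> x; rewrite indicE; case: (_ \in _); rewrite ?normr1 ?normr0.
  exact: (L2_integrable_mul d (Lfun_Sub (lee1n 2) hB)).
have DE i : D i = L2inner mO (divergence phi) (\1_(eball (node i))).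
  case: i => //=; rewrite node0 /L2inner (_ : (fun x => _) = cst 0) ?Rintegral_cst ?mul0r//.
  apply/funext => x /=; rewrite indicE (_ : (x \in _) = false) ?mulr0//.
  by apply/negbTE; rewrite notin_setE /eball/= ltNge enorm_ge0.
have shD j : L2inner mO (shellL j) d = D j.+1 - D j.
  rewrite !DE L2innerC /L2inner -RintegralB//; [|exact: iB|exact: iB].
  by apply: eq_Rintegral => x _ /=; rewrite shellE mulrBr.
have aD : admissible D.
  split=> //.
    (* With a constant radial factor the formula says that the divergence has integral zero over the
       whole ball, that is [D n.+1 = 0]. *)
    have := @integral_divergence_radial R N r phi tphi (cst 1) (cst 0).
    rewrite DE nodeS => H; rewrite (_ : L2inner _ _ _ = L2inner mO (divergence phi) (cst 1 \o @sqn R N)).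
      rewrite (H (fun s _ => is_derive_cst _ _ _) (fun s => @cst_continuous _ _ _ _)).
      rewrite (_ : (fun x => 2 * _ * _) = cst 0) ?Rintegral_cst ?mul0r ?oppr0//.
      by apply/funext => x /=; rewrite mulr0 mul0r.
    apply: eq_Rintegral => x _ /=; rewrite indicE.
    have [//|xO] := boolP (x \in _); rewrite (divergence0 (phi := phi)) ?mul0r//.
    by apply: (test_field_Omega tphi); rewrite notin_setE in xO.
  case=> [|i] _; first by rewrite normr0 node_per_ge0.
  by apply: ball_divergence_le => //; rewrite -node0 node_lt.
have -> : L2inner mO (step w) (divergence phi) = flux_pairing n D w.
  by rewrite (L2inner_step w d); apply: eq_bigr => j _; rewrite shD mulrC.
exact: flux_pairing_le.
Qed.

(* The field [zeta (|x|^2) *: x] below carries the flux [Q i] through the sphere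
   of radius [node i]. *)
Lemma step_slope_le_TV Q (v : L2) : admissible Q ->
  ((L2inner mO v (step (shell_slope Q)))%:E <= TV mO v)%E.
Proof.
move=> [Q0 Qn QP].
pose q := shell_slope Q.
have qE j : q j * (om * node j.+1 ^+ N - om * node j ^+ N) = Q j.+1 - Q j.
  by rewrite -/(shell_vol j) /q /slope divfK// gt_eqF// shell_vol_gt0.
have om0 := omega_gt0 R N.
have N0 : (0 : R) < N%:R by rewrite ltr0n.
pose zeta (s : R) : R := N%:R^-1 * \sum_(j < n.+1) q j * (psi N (node j.+1) s - psi N (node j) s).
have /choice[K HK] : forall i, exists K, 0 <= K /\
    forall s t, `|psi N (node i) s - psi N (node i) t| <= K * `|s - t|.
  by move=> i; have [K K0 HK] := psi_lipschitz N_gt0 (node_ge0 i); exists K.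
pose L := N%:R^-1 * \sum_(j < n.+1) `|q j| * (K j.+1 + K j).
have L0 : 0 <= L.
  rewrite mulr_ge0// sumr_ge0// => j _; rewrite mulr_ge0// addr_ge0//.
    by have [] := HK j.+1.
  by have [] := HK j.
have zlip s t : `|zeta s - zeta t| <= L * `|s - t|.
  rewrite /zeta -mulrBr normrM ger0_norm// /L -mulrA ler_wpM2l// -sumrB mulr_suml.
  apply: le_trans (ler_norm_sum _ _ _) _; apply: ler_sum => j _.
  rewrite -mulrBr normrM -mulrA ler_wpM2l// mulrDl.
  set A := psi _ _ s; set B := psi _ _ s; set C := psi _ _ t; set D := psi _ _ t.
  rewrite (_ : A - B - (C - D) = (A - C) - (B - D)); last by ring.
  rewrite (le_trans (ler_normB _ _))// lerD//.
    by have [_] := HK j.+1; exact.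
  by have [_] := HK j; exact.
have zc : continuous zeta.
  move=> s; apply/cvgrPdist_le => e e0.
  have eL : 0 < e / (L + 1) by rewrite divr_gt0//; lra.
  have := @cvg_id R (nbhs s); move/cvgrPdist_lt => /(_ _ eL).
  apply: filterS => t st; rewrite (le_trans (zlip _ _))//.
  have : L * `|s - t| <= L * (e / (L + 1)) by rewrite ler_wpM2l// ltW.
  have : (L + 1) * (e / (L + 1)) = e by rewrite mulrC divfK// gt_eqF//; lra.
  have : 0 <= e / (L + 1) by rewrite ltW.
  rewrite mulrDl mul1r; lra.
(* [F t n.+1] is the flux through the sphere of radius [t]: the interpolation of [Q] that is affine
   in the volume. *)
pose F t k : R := \sum_(0 <= j < k) q j * (om * Num.min t (node j.+1) ^+ N - om * Num.min t (node j) ^+ N).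
have Fge t k : node k <= t -> F t k = Q k.
  elim: k => [|k IH] kt; first by rewrite /F big_geq.
  have kt' : node k <= t by rewrite (le_trans _ kt)// node_le.
  rewrite /F big_nat_recr//= -/(F t k) IH//.
  by rewrite !min_r// qE; ring.
have Fle t k : t <= node k -> (k <= n.+1)%N -> F t n.+1 = F t k.
  move=> tk kn; rewrite /F (big_cat_nat (n := k))//= [X in _ + X](_ : _ = 0) ?addr0//.
  rewrite big_nat; apply: big1 => j /andP[kj _].
  by rewrite !min_l ?subrr ?mulr0// (le_trans tk)// node_le// leqW.
have zF t : 0 < t -> zeta (t ^+ 2) * (N%:R * om * t ^+ N) = F t n.+1.
  move=> t0; rewrite /zeta /F big_mkord.
  rewrite (_ : _ * _ = om * \sum_(j < n.+1) q j * (psi N (node j.+1) (t ^+ 2) - psi N (node j) (t ^+ 2)) * t ^+ N); last first.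
    by rewrite -mulr_suml; field; rewrite gt_eqF.
  rewrite mulr_sumr; apply: eq_bigr => j _.
  rewrite -(psi_min N (node_ge0 j) t0) -(psi_min N (node_ge0 j.+1) t0); ring.
have Fper t : 0 < t -> `|F t n.+1| <= per N t.
  move=> t0; have perN (x : R) : 0 <= x -> 0 <= per N x.
    by move=> x0; rewrite /per; apply: mulr_ge0; [rewrite mulr_ge0// ltW|exact: exprn_ge0].
  have [rt|tr] := leP r t.
    by rewrite Fge ?nodeS// Qn normr0 perN// ltW.
  have [k [kn kt tk]] : exists k, [/\ (k < n.+1)%N, node k <= t & t < node k.+1].
    move: tr; rewrite -{1}nodeS; move: (n.+1) => M; elim: M => [|M IH].
      by rewrite node0 ltNge ltW.
    move=> tM; have [Mt|/IH[k [kM kt tk]]] := leP (node M) t; first by exists M.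
    by exists k; split=> //; exact: ltnW.
  rewrite (Fle t k.+1 (ltW tk) kn) /F big_nat_recr//= -/(F t k) Fge//.
  rewrite (min_r kt) (min_l (ltW tk)).
  have v0 := shell_vol_gt0 k.
  (* The fraction of the volume of shell [k] inside radius [t]. *)
  pose th := (om * t ^+ N - om * node k ^+ N) / shell_vol k.
  have tN : node k ^+ N <= t ^+ N by rewrite lerXn2r ?nnegrE ?node_ge0// ltW.
  have tN' : t ^+ N <= node k.+1 ^+ N by rewrite lerXn2r ?nnegrE ?node_ge0// ltW.
  have th0 : 0 <= th by rewrite divr_ge0 ?(ltW v0)// subr_ge0 ler_pM2l.
  have th1 : th <= 1 by rewrite ler_pdivrMr// mul1r /shell_vol lerD2r ler_pM2l.
  have thE : th * (om * node k.+1 ^+ N - om * node k ^+ N) = om * t ^+ N - om * node k ^+ N.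
    by rewrite /th divfK// gt_eqF.
  have -> : Q k + q k * (om * t ^+ N - om * node k ^+ N) = (1 - th) * Q k + th * Q k.+1.
    by rewrite -thE mulrCA qE; ring.
  have h1 : (1 - th) * `|Q k| <= (1 - th) * node_per k.
    by rewrite ler_wpM2l ?subr_ge0// QP// ltnW// ltnW.
  have h2 : th * `|Q k.+1| <= th * node_per k.+1 by rewrite ler_wpM2l// QP.
  apply: (@le_trans _ _ ((1 - th) * node_per k + th * node_per k.+1)).
    apply: le_trans (ler_normD _ _) _; rewrite 2!normrM (ger0_norm th0).
    by rewrite (ger0_norm (_ : 0 <= 1 - th)) ?subr_ge0// lerD.
  (* The two tangent inequalities at [t] are added with weights [1 - th] and [th]; the volume terms
     cancel by the choice of [th]. *)
  have t1 := per_tangent N_gt0 (node_ge0 k) (ltW t0).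
  have t2 := per_tangent N_gt0 (node_ge0 k.+1) (ltW t0).
  rewrite -subr_le0 -(pmulr_rle0 _ t0).
  have e1 := ler_wpM2l th0 t2.
  have nth : 0 <= 1 - th by rewrite subr_ge0.
  have e2 := ler_wpM2l nth t1.
  have E3 : N.-1%:R * (om * t ^+ N - om * node k ^+ N) =
      N.-1%:R * (th * (om * node k.+1 ^+ N - om * node k ^+ N)) by rewrite thE.
  rewrite /node_per.
  move: E3 e1 e2; move: (per N (node k)) (per N (node k.+1)) (per N t) (om * t ^+ N)
    (om * node k ^+ N) (om * node k.+1 ^+ N) (N.-1%:R : R) => a b c d e f p E3 e1 e2.
  lra.
apply: (@radial_flux_le_TV R N r r_gt0 zeta L (step (shell_slope Q)) v zc) => //.
- move=> s rs; have s0 : 0 < s by apply: lt_le_trans rs; rewrite exprn_gt0.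
  have t0 : 0 < Num.sqrt s by rewrite sqrtr_gt0.
  have rt : r <= Num.sqrt s by rewrite -[leLHS]gtr0_norm// -sqrtr_sqr ler_wsqrtr.
  have := zF _ t0; rewrite Fge ?nodeS// Qn sqr_sqrtr ?(ltW s0)// => /eqP.
  rewrite mulf_eq0 => /orP[/eqP//|]; rewrite gt_eqF// mulr_gt0 ?exprn_gt0//.
  by rewrite mulr_gt0.
- move=> s; rewrite le_eqVlt => /predU1P[<-|s0]; first by rewrite mul0r.
  have t0 : 0 < Num.sqrt s by rewrite sqrtr_gt0.
  have := Fper _ t0; rewrite -zF// sqr_sqrtr ?(ltW s0)// /per.
  set t := Num.sqrt s in t0 *; rewrite (expr_predn N_gt0 t).
  have c0 : 0 < N%:R * om * t ^+ N.-1 by rewrite !mulr_gt0// exprn_gt0.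
  have -> : zeta s * (N%:R * om * (t * t ^+ N.-1)) = (zeta s * t) * (N%:R * om * t ^+ N.-1) by ring.
  rewrite normrM (gtr0_norm c0) -[leRHS]mul1r ler_pM2r// => zt.
  have -> : s * zeta s ^+ 2 = `|zeta s * t| ^+ 2.
    have ts : t ^+ 2 = s by exact: sqr_sqrtr (ltW s0).
    have zE : (zeta s * t) ^+ 2 = s * zeta s ^+ 2 by rewrite -{2}ts; ring.
    by rewrite -normrX zE ger0_norm// mulr_ge0 ?sqr_ge0 ?(ltW s0).
  by rewrite expr_le1.
- have : {ae mu, forall x (i : nat), sqn x != node i ^+ 2}.
    apply: ae_foralln => i; exists [set x | sqn x = node i ^+ 2]; split.
    + have ms : measurable_fun setT (@sqn R N) by apply: continuous_measurable_rV; exact: continuous_sqn.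
      by rewrite -[X in measurable X]setTI; apply: (ms measurableT [set node i ^+ 2]).
    + apply/eqP; rewrite eq_le measure_ge0 andbT -(leb_sphere N_gt0 (node_ge0 i)).
      rewrite lebesgue_onE le_measure ?inE//.
      * apply: measurableI; last exact: measurable_eball.
        have ms : measurable_fun setT (@sqn R N) by apply: continuous_measurable_rV; exact: continuous_sqn.
        by rewrite -[X in measurable X]setTI; apply: (ms measurableT [set node i ^+ 2]).
      * have ms : measurable_fun setT (@sqn R N) by apply: continuous_measurable_rV; exact: continuous_sqn.
        by rewrite -[X in measurable X]setTI; apply: (ms measurableT [set node i ^+ 2]).
    + by move=> x /= /negP; rewrite negbK => /eqP.
  case=> A [mA A0 sA]; exists A; split=> // x nx; apply: sA => /= xn; apply: nx.
  have s0 := sqn_ge0 x.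
  have /choice[d Hd] : forall i, exists d, is_derive (sqn x) (1 : R) (psi N (node i)) d /\
      N%:R * psi N (node i) (sqn x) + 2 * sqn x * d = N%:R * (sqn x < node i ^+ 2)%R%:R.
    by move=> i; have [d d1 d2] := derive_psi N_gt0 (node_ge0 i) (xn i) s0; exists d.
  exists (N%:R^-1 * \sum_(j < n.+1) q j * (d j.+1 - d j)).
    have E : zeta = N%:R^-1 \*: \sum_(j < n.+1) (q j \*: (psi N (node j.+1) - psi N (node j))).
      by apply/funext => s; rewrite /zeta /= fct_sumE.
    rewrite E; apply: is_deriveZ; apply: is_derive_sum => j.
    by apply: is_deriveZ; apply: is_deriveB; [have [] := Hd j.+1|have [] := Hd j].
  rewrite stepE /zeta.
  have -> : N%:R * (N%:R^-1 * \sum_(j < n.+1) q j * (psi N (node j.+1) (sqn x) - psi N (node j) (sqn x))) +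
     2 * sqn x * (N%:R^-1 * \sum_(j < n.+1) q j * (d j.+1 - d j)) =
     N%:R^-1 * \sum_(j < n.+1) q j * ((N%:R * psi N (node j.+1) (sqn x) + 2 * sqn x * d j.+1) -
       (N%:R * psi N (node j) (sqn x) + 2 * sqn x * d j)).
    rewrite !mulr_sumr -big_split/=; apply: eq_bigr => j _; ring.
  rewrite mulr_sumr; apply: eq_bigr => j _.
  rewrite (Hd j.+1).2 (Hd j).2 -/q shellE !indicE.
  have H i : (x \in eball (node i)) = (sqn x < node i ^+ 2).
    by rewrite -enorm_lt_sqn ?node_ge0//; apply/idP/idP; rewrite inE.
  by rewrite !H; field; rewrite gt_eqF.
Qed.

(** The pairing with any [v] is at most [TV v], and the pairing with [step w] is the discrete total
    variation, which dominates [TV (step w)]. *)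
Lemma step_subdifferential Q w : admissible Q -> calibrates Q w ->
  subdifferential (fun v : L2 => TV mO v) (step w) (step (shell_slope Q)).
Proof.
move=> aQ cQ v.
have -> : L2inner mO (step (shell_slope Q)) (v - step w : L2) =
    L2inner mO v (step (shell_slope Q)) - discrete_TV n node_per w.
  rewrite L2innerC L2innerDl L2innerC; congr (_ + _); last first.
    have := L2innerZl (-1) (step w) (step (shell_slope Q)); rewrite scaleN1r => ->.
    by rewrite L2innerC L2inner_slope (flux_pairing_calibrates aQ cQ) mulN1r.
apply: le_trans (step_slope_le_TV v aQ).
apply: le_trans (leeD2r _ (TV_step_le w)) _.
by rewrite -EFinD lee_fin addrCA subrr addr0.
Qed.

End steps.

(** * Density of step functions among radial functions *)

Section rays.
Context (R : realType) (N : nat).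
Local Notation leb := (leb R N).
Local Notation lam := (@lebesgue_measure R).

Definition ray (Z : set 'rV[R]_N) (x : 'rV[R]_N) : set R :=
  [set l : R | 0 < l /\ Z (l *: x)].

(** Its sections at fixed [l] are dilates of [Z], those at fixed [x] are rays; Fubini on this set
    takes the place of polar coordinates. *)
Let cone (Z : set 'rV[R]_N) : set (measurableTypeR R * 'rV[R]_N) :=
  [set p | 0 < (p.1 : R) /\ Z ((p.1 : R) *: p.2)].

Let measurable_cone Z : measurable Z -> measurable (cone Z).
Proof.
move=> mZ; rewrite (_ : cone Z = (fst @^-1` `]0, +oo[%classic) `&`
   ((fun p : measurableTypeR R * 'rV[R]_N => (p.1 : R) *: p.2) @^-1` Z)); last first.
  by apply/seteqP; split => p /=; rewrite /cone/= in_itv/= andbT.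
apply: measurableI.
  by rewrite -[X in measurable X]setTI; exact: measurable_fst.
rewrite -[X in measurable X]setTI.
suff: measurable_fun setT (fun p : measurableTypeR R * 'rV[R]_N => (p.1 : R) *: p.2).
  by move=> /(_ measurableT); exact.
apply: measurable_fun_coordP => i.
under eq_fun do rewrite mxE.
apply: measurable_funM; first exact: measurable_fst.
exact: (measurableT_comp (measurable_coord i) measurable_snd).
Qed.

Lemma measurable_ray Z x : measurable Z -> measurable (ray Z x).
Proof.
move=> /measurable_cone mC; rewrite (_ : ray Z x = ysection (cone Z) x).
  exact: measurable_ysection.
by apply/seteqP; split => l; rewrite /ysection/ray/cone/= inE.
Qed.

Let cone_sections Z : measurable Z ->
  (\int[lam]_l leb (xsection (cone Z) l) = \int[leb]_x lam (ray Z x))%E.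
Proof.
move=> mZ; have mC := measurable_cone mZ.
transitivity ((lam \x leb)%E (cone Z)) => //.
rewrite (@product_measure_unique _ _ _ _ _ lam leb (lam \x^ leb)%E)//.
  transitivity (\int[leb]_x (lam \o ysection (cone Z)) x)%E => //; apply: eq_integral => x _ /=.
  by congr (lam _); apply/seteqP; split => l; rewrite /ysection/ray/cone/= inE.
by move=> A B mA mB /=; rewrite product_measure2E.
Qed.

Let xsection_cone Z l : 0 < l -> xsection (cone Z) l = (fun x => l *: x) @^-1` Z.
Proof.
move=> l0; apply/seteqP; split => x; rewrite /xsection/cone/= inE/=; first by case.
by move=> Zx; split.
Qed.

(** All dilates of [Z] are null, hence so is the cone, hence so are almost all of its rays. *)
Lemma null_ray Z : measurable Z -> leb Z = 0%E ->
  {ae leb, forall x, lam (ray Z x) = 0%E}.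
Proof.
move=> mZ Z0; have mC := measurable_cone mZ.
have : (\int[leb]_x `|lam (ray Z x)| = 0)%E.
  under eq_integral do rewrite gee0_abs//.
  rewrite -cone_sections// integral0_eq// => l _.
  have [l0|l0] := ltP 0 l; first by rewrite xsection_cone// leb_scale// Z0 mule0.
  rewrite (_ : xsection _ _ = set0) ?measure0// -subset0 => x.
  by rewrite /xsection/cone/= inE/= ltNge l0 => -[].
have mf : measurable_fun setT (fun x => lam (ray Z x)).
  rewrite (_ : (fun x => _) = lam \o ysection (cone Z)); first exact: measurable_fun_ysection.
  apply/funext => x /=; congr (lam _).
  by apply/seteqP; split => l; rewrite /ysection/ray/cone/= inE.
move/(ae_eq_integral_abs leb measurableT mf).1.
by apply: filterS => x /(_ I).
Qed.

(** Conversely the cone is null, so almost every dilate of [Z] is null; one with [l > 0] is enough,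
    by scaling. *)
Lemma ray_null Z : measurable Z -> {ae leb, forall x, lam (ray Z x) = 0%E} ->
  leb Z = 0%E.
Proof.
move=> mZ Z0; have mC := measurable_cone mZ.
have : (\int[lam]_l `|leb (xsection (cone Z) l)| = 0)%E.
  under eq_integral do rewrite gee0_abs//.
  rewrite cone_sections//.
  have mf : measurable_fun setT (fun x => lam (ray Z x)).
    rewrite (_ : (fun x => _) = lam \o ysection (cone Z)); first exact: measurable_fun_ysection.
    apply/funext => x /=; congr (lam _).
    by apply/seteqP; split => l; rewrite /ysection/ray/cone/= inE.
  rewrite (ae_eq_integral (cst 0%E))//; first by rewrite integral0.
  by apply: filterS Z0 => x + _.
move/(ae_eq_integral_abs _ measurableT (measurable_fun_xsection leb mC)).1.
move=> [A [mA A0 sA]].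
have [l l0 Al] : exists2 l : R, 0 < l & ~ A l.
  apply: contrapT => H; have sub : `]0, 1[%classic `<=` A.
    move=> l /=; rewrite in_itv/= => /andP[l0 _]; apply: contrapT => nA.
    by apply: H; exists l.
  have : (lam `]0%R, 1%R[%classic <= lam A)%E by rewrite le_measure ?inE.
  by rewrite A0 lebesgue_measure_itv/= lte_fin ltr01 EFinN oppe0 adde0 lee_fin ler10.
have : leb (xsection (cone Z) l) = 0%E.
  by apply: contrapT => H; apply: Al; apply: sA => /= /(_ I).
rewrite xsection_cone// leb_scale// => /eqP.
rewrite mule_eq0 eqe => /orP[|/eqP//].
by rewrite gt_eqF// invr_gt0 exprn_gt0.
Qed.

Lemma enorm_eq0 (x : 'rV[R]_N) : (enorm x == 0) = (x == 0).
Proof.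
apply/eqP/eqP => [x0|->]; last first.
  by apply/eqP; rewrite /enorm big1 ?sqrtr0// => i _; rewrite mxE expr0n.
apply/rowP => i; rewrite mxE; apply/eqP; rewrite -normr_le0 -x0.
exact: coord_le_enorm.
Qed.

Hypothesis N_gt0 : (0 < N)%N.

Lemma leb_enorm_eq0 : leb [set x | enorm x = 0] = 0%E.
Proof.
have := leb_sphere N_gt0 (lexx (0 : R)); rewrite expr0n/= => <-; congr (leb _).
apply/seteqP; split => x /=; first by rewrite -sqr_enorm => ->; rewrite expr0n.
by rewrite -sqr_enorm => /eqP; rewrite sqrf_eq0 => /eqP.
Qed.

Lemma measurable_enorm_preimage (M : set R) : measurable M ->
  measurable [set x : 'rV[R]_N | M (enorm x)].
Proof.
by move=> mM; have := @measurable_enorm R N measurableT M mM; rewrite setTI.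
Qed.

(** The ray of this set through [x != 0] is contained in a dilate of [M]. *)
Lemma null_radial (M : set R) : measurable M -> lam M = 0%E ->
  leb [set x | M (enorm x)] = 0%E.
Proof.
move=> mM M0; apply: ray_null; first exact: measurable_enorm_preimage.
exists [set x | enorm x = 0]; split; last 1 first.
- move=> x /= nx; apply: contrapT => /eqP x0; apply: nx.
  have e0 : 0 < enorm x by rewrite lt_neqAle eq_sym x0 enorm_ge0.
  apply/eqP; rewrite eq_le measure_ge0 andbT.
  have sM : measurable ((fun l => enorm x * l) @^-1` M).
    by rewrite -[X in measurable X]setTI; exact: (@mulrl_measurable R setT).
  rewrite (le_trans (le_measure lam (_ : _ \in _) (_ : _ \in _)
     (_ : _ `<=` (fun l => enorm x * l) @^-1` M))) ?inE//.
  + by apply: measurable_ray; exact: measurable_enorm_preimage.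
  + by move=> l [l0] /=; rewrite enormZ gtr0_norm// mulrC.
  + by have := lebesgue_measure_scale e0 mM; rewrite M0 mule0 => h; rewrite [X in (X <= _)%E]h.
- exact: (measurable_enorm_preimage (measurable_set1 0)).
- exact: leb_enorm_eq0.
Qed.

End rays.

(** * A measurable profile for radial functions *)

Section radial_profile.
Context (R : realType) (N : nat) (r : R).
Hypothesis (N_gt0 : (0 < N)%N) (r_gt0 : 0 < r).
Local Notation Omega := (@eball R N r).
Local Notation mO := (measurable_eball R N r).
Local Notation mu := (lebesgue_on mO).
Local Notation L2 := (L2 mO).
Local Notation lam := (@lebesgue_measure R).
Local Notation l2norm := (inorm (fun f g : L2 => L2inner mO f g)).

Lemma ae_lebesgue_on (Z : set 'rV[R]_N) (P : 'rV[R]_N -> Prop) :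
  measurable Z -> leb R N Z = 0%E -> (forall x, Omega x -> ~ Z x -> P x) ->
  {ae mu, forall x, P x}.
Proof.
move=> mZ Z0 ZP; exists (Z `|` ~` Omega); split.
- by apply: measurableU => //; apply: measurableC; exact: measurable_eball.
- apply/eqP; rewrite eq_le measure_ge0 andbT -Z0 lebesgue_onE le_measure ?inE//.
    apply: measurableI; last exact: measurable_eball.
    by apply: measurableU => //; apply: measurableC; exact: measurable_eball.
  by move=> x [[]].
- move=> x /= nP; have [Ox|nO] := pselect (Omega x); last by right.
  by left; apply: contrapT => /(ZP x Ox).
Qed.

(* The profile given by [radial] need not be measurable, so [k] is read off on a
   ray that meets the exceptional null set in a null set. *)
Lemma radial_profile (g : L2) : radial mO g ->
  exists k : R -> R, measurable_fun setT k /\ {ae mu, forall x, g x = k (enorm x)}.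
Proof.
move=> [h [A [mA A0 sA]]]; pose Z := A `&` Omega.
have mZ : measurable Z by apply: measurableI => //; exact: measurable_eball.
have Z0 : leb R N Z = 0%E by rewrite -A0 lebesgue_onE.
have gh x : Omega x -> ~ Z x -> g x = h (enorm x).
  by move=> Ox nZ; apply: contrapT => ne; apply: nZ; split => //; apply: sA => /(_ I).
have [B [mB B0 sB]] := null_ray mZ Z0.
have [x0 [Ox0 nB x00]] : exists x, [/\ Omega x, ~ B x & enorm x != 0].
  apply: contrapT => H.
  have sub : Omega `<=` B `|` [set x | enorm x = 0].
    move=> x Ox; have [xB|xB] := pselect (B x); first by left.
    by right; apply: contrapT => /eqP x0; apply: H; exists x.
  have : (leb R N Omega <= leb R N B + leb R N [set x | enorm x = 0%R])%E.
    apply: (le_trans (le_measure (leb R N) (_ : _ \in _) (_ : _ \in _) sub)); rewrite ?inE.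
    - exact: measurable_eball.
    - by apply: measurableU => //; exact: (measurable_enorm_preimage (measurable_set1 0)).
    - by apply: measureU2 => //; exact: (measurable_enorm_preimage (measurable_set1 0)).
  rewrite B0 leb_enorm_eq0// adde0 (leb_eball N_gt0 (ltW r_gt0)) lee_fin leNgt.
  by rewrite mulr_gt0 ?omega_gt0 ?exprn_gt0.
pose e := enorm x0; have e0 : 0 < e by rewrite lt_neqAle eq_sym x00 enorm_ge0.
have ray0 : lam (ray Z x0) = 0%E by apply: contrapT => H; apply: nB; exact: sB.
exists (fun s => g ((e^-1 * s) *: x0)); split.
  apply: (@measurableT_comp _ _ _ _ _ _ (g : 'rV[R]_N -> R)) => //.
  apply: (@measurable_fun_coordP _ _ _ R) => i.
  under eq_fun do rewrite mxE.
  by apply: measurable_funM => //; exact: (@mulrl_measurable R setT).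
(* The radii at which the chosen ray meets the exceptional set. *)
pose M : set R := (fun s => e^-1 * s) @^-1` (ray Z x0).
have mM : measurable M.
  rewrite -[X in measurable X]setTI; apply: (@mulrl_measurable R setT) => //.
  exact: measurable_ray.
have M0 : lam M = 0%E.
  have ei : 0 < e^-1 by rewrite invr_gt0.
  have := lebesgue_measure_scale ei (measurable_ray x0 mZ).
  by rewrite ray0 mule0.
apply: (@ae_lebesgue_on (Z `|` [set x | M (enorm x)] `|` [set x | enorm x = 0])).
- apply: measurableU; last exact: (measurable_enorm_preimage (measurable_set1 0)).
  by apply: measurableU => //; exact: measurable_enorm_preimage.
- have m0 : measurable [set x : 'rV[R]_N | enorm x = 0].
    exact: (measurable_enorm_preimage (measurable_set1 0)).
  have mMe : measurable [set x : 'rV[R]_N | M (enorm x)] by exact: measurable_enorm_preimage.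
  apply: null_set_setU => //; first exact: measurableU.
    by apply: null_set_setU => //; exact: null_radial.
  exact: leb_enorm_eq0.
- move=> x Ox nZ; rewrite gh//; last by move=> Zx; apply: nZ; left; left.
  have x_neq0 : enorm x != 0 by apply/eqP => x_0; apply: nZ; right.
  have l0 : 0 < e^-1 * enorm x.
    by rewrite mulr_gt0 ?invr_gt0// lt_neqAle eq_sym x_neq0 enorm_ge0.
  have ne : enorm ((e^-1 * enorm x) *: x0) = enorm x.
    by rewrite enormZ gtr0_norm// mulrAC -/e mulVf ?mul1r// gt_eqF.
  rewrite gh ?ne//; first by rewrite /eball/= ne.
  by move=> Zx; apply: nZ; left; right.
Qed.

Lemma dominated_inorm (f : nat -> L2) (F : L2) :
  (forall n, {ae mu, forall x, `|f n x| <= `|F x|}) ->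
  {ae mu, forall x, f n x @[n --> \oo] --> (0 : R)} ->
  forall e, 0 < e -> exists n, l2norm (f n) <= e.
Proof.
move=> /ae_foralln fF f0 e e0.
have [] := @dominated_convergence _ _ _ mu setT measurableT
  (fun k x => (f k x * f k x)%:E) (cst 0%E) (fun x => (F x * F x)%:E).
- by move=> k; apply/measurable_EFinP; apply: measurable_funM.
- exact: measurable_cst.
- apply: filterS f0 => x f0 _; rewrite -[cst 0%E x]/((0 : R)%:E) -(mulr0 0).
  by apply: cvg_EFin; [exact: nearW|apply: cvgM].
- exact: (L2_integrable_mul F F).
- apply: filterS fF => x fF n _; rewrite lee_fin normrM.
  by rewrite -!expr2 -(real_normK (num_real (F x))) lerXn2r ?nnegrE.
move=> _ _; rewrite integral0 => H.
have /cvgrPdist_lt H2 : L2inner mO (f k) (f k) @[k --> \oo] --> (0 : R) by exact: fine_cvg.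
have e20 : 0 < e ^+ 2 by rewrite exprn_gt0.
have [n _ /(_ n (leqnn n))/=] := H2 _ e20.
rewrite sub0r normrN => He; exists n.
rewrite /inorm -[leRHS]gtr0_norm// -sqrtr_sqr ler_wsqrtr//.
by rewrite (le_trans (ler_norm _))// ltW.
Qed.

End radial_profile.

(** * Means over grid cells *)

Section cell_means.
Context (R : realType).
Local Notation lam := (@lebesgue_measure R).

Definition mesh (r : R) (n : nat) : R := r / n.+1%:R.

(** The grid cell containing [x], defined on the whole line as the differentiation theorem requires;
    for [x >= 0] it is an interval between consecutive nodes. *)
Definition cell (r : R) (x : R) (n : nat) : set R :=
  `[mesh r n * (Num.floor (x / mesh r n))%:~R,
    mesh r n * (Num.floor (x / mesh r n) + 1)%:~R[%classic.

Variable (r : R).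
Hypothesis r_gt0 : 0 < r.

Lemma mesh_gt0 n : 0 < mesh r n. Proof. by rewrite divr_gt0. Qed.

Lemma cvg_mesh : mesh r n @[n --> \oo] --> 0.
Proof.
rewrite -(mulr0 r); apply: cvgM; first exact: cvg_cst.
exact: cvg_harmonic.
Qed.

Lemma lebesgue_measure_cell x n : lam (cell r x n) = (mesh r n)%:E.
Proof.
have m0 := mesh_gt0 n.
rewrite lebesgue_measure_itv/= lte_fin ltr_pM2l// ltr_int.
by rewrite ltrDl ltr01 -EFinB -mulrBr -intrB addrAC subrr add0r mulr1.
Qed.

(** The cell of [x] lies in the ball of radius [mesh r n] around [x], whose measure is twice that of
    the cell, whence the constant [2]. *)
Lemma nicely_shrinking_cell x : nicely_shrinking x (cell r x).
Proof.
split; first by move=> n; exact: measurable_itv.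
exists (2, fun n => PosNum (mesh_gt0 n)); split => //=.
- exact: cvg_mesh.
- move=> n y; have m0 := mesh_gt0 n; rewrite /cell /ball/= in_itv/= => /andP[y1 y2].
  have := floor_le (x / mesh r n); have := floorD1_gt (x / mesh r n).
  rewrite ler_pdivlMr// ltr_pdivrMr// => h1 h2.
  rewrite ltr_norml; move: y1 y2 h1 h2; rewrite intrD mulrDr mulrDl.
  rewrite mulr1 mul1r (mulrC (mesh r n)); lra.
- move=> n; rewrite lebesgue_measure_ball ?(ltW (mesh_gt0 n))// lebesgue_measure_cell.
  by rewrite -EFinM lee_fin mulr2n mulrDl mul1r.
Qed.

Definition cell_mean (k : R -> R) (n : nat) (j : nat) : R :=
  (mesh r n)^-1 * \int[lam]_(y in `[node r n j, node r n j.+1[%classic) k y.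

Lemma bounded_integrable_itv (k : R -> R) B (a b : R) : measurable_fun setT k ->
  (forall s, `|k s| <= B) -> lam.-integrable `[a, b[%classic (EFin \o k).
Proof.
move=> mk kB; apply: measurable_bounded_integrable => //.
- suff : (lam `[a, b[%classic < +oo)%E by [].
  by rewrite lebesgue_measure_itv/=; case: ifP => _; rewrite ?ltry// -EFinB ltry.
- exact: measurable_funTS.
- by exists B; split; [exact: num_real|move=> M BM x _ /=; rewrite (le_trans (kB x))// ltW].
Qed.

Lemma cell_mean_le (k : R -> R) B n j : measurable_fun setT k -> (forall s, `|k s| <= B) ->
  `|cell_mean k n j| <= B.
Proof.
move=> mk kB; have m0 := mesh_gt0 n.
have nd : node r n j.+1 - node r n j = mesh r n.
  by rewrite /node /mesh -[in LHS]natr1; field; rewrite gt_eqF.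
have ik := bounded_integrable_itv (node r n j) (node r n j.+1) mk kB.
rewrite /cell_mean normrM gtr0_norm ?invr_gt0// mulrC ler_pdivrMr//.
rewrite (le_trans (le_normr_Rintegral _ ik))//.
apply: (@le_trans _ _ (\int[lam]_(y in `[node r n j, node r n j.+1[) B)).
  apply: le_Rintegral => //; first exact: (integrable_norm ik).
  apply: (@bounded_integrable_itv (cst B) `|B|) => //.
have lE : lam `[node r n j, node r n j.+1[%classic = (mesh r n)%:E.
  by rewrite lebesgue_measure_itv/= lte_fin node_lt// -EFinB nd.
by rewrite Rintegral_cst// [X in fine X]lE.
Qed.

Lemma bounded_locally_integrable (k : R -> R) B : measurable_fun setT k ->
  (forall s, `|k s| <= B) -> locally_integrable setT k.
Proof.
move=> mk kB.
split => //; first exact: openT.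
move=> K _ cK; apply: (@le_lt_trans _ _ (\int[lam]_(x in K) B%:E)%E).
  apply: ge0_le_integral => //; first exact: compact_measurable.
  - by apply/measurable_EFinP; apply: measurableT_comp => //; exact: measurable_funTS.
  - by move=> x _; rewrite lee_fin.
rewrite integral_cst; last exact: compact_measurable.
rewrite lte_mul_pinfty ?lee_fin ?(le_trans _ (kB 0))//.
exact: compact_finite_measure.
Qed.

Lemma cell_mean_cvg (k : R -> R) B s : measurable_fun setT k -> (forall s, `|k s| <= B) ->
  0 <= s -> lebesgue_pt k s ->
  cell_mean k n (Num.truncn (s / mesh r n)) @[n --> \oo] --> k s.
Proof.
move=> mk kB s0 ks.
have lk := bounded_locally_integrable mk kB.
have := nice_lebesgue_differentiation nicely_shrinking_cell lk ks.
move=> /fine_cvg; apply: cvg_trans; apply: near_eq_cvg; apply: nearW => n /=.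
have m0 := mesh_gt0 n.
rewrite lebesgue_measure_cell inver gt_eqF// fineM//=; last first.
  have ik : lam.-integrable (cell r s n) (EFin \o k).
    exact: (bounded_integrable_itv _ _ mk kB).
  by move: ik => /integrable_fin_num; apply; exact: measurable_itv.
rewrite /cell_mean /Rintegral; congr (_ * fine _).
have -> : cell r s n = `[node r n (Num.truncn (s / mesh r n)), node r n (Num.truncn (s / mesh r n)).+1[%classic.
  have sm : 0 <= s / mesh r n by rewrite divr_ge0// ltW.
  have fl : Num.floor (s / mesh r n) = (Num.truncn (s / mesh r n))%:Z.
    by rewrite truncn_floor sm gez0_abs// floor_ge0.
  rewrite /cell fl; set j := Num.truncn _.
  have -> : mesh r n * (j%:Z + 1)%:~R = node r n j.+1.
    by rewrite /node /mesh intrD (_ : j.+1%:R = j%:R + 1) ?natr1// mulrAC.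
  by have -> : mesh r n * (j%:Z)%:~R = node r n j by rewrite /node /mesh mulrAC.
by [].
Qed.

End cell_means.

Section step_dense.
Context (R : realType) (N : nat) (r : R).
Hypothesis (N_gt0 : (0 < N)%N) (r_gt0 : 0 < r).
Local Notation Omega := (@eball R N r).
Local Notation mO := (measurable_eball R N r).
Local Notation mu := (lebesgue_on mO).
Local Notation L2 := (L2 mO).
Local Notation l2norm := (inorm (fun f g : L2 => L2inner mO f g)).
Local Notation step := (@step R N r).

Lemma L2_subE (f g : L2) x : (f - g : L2) x = f x - g x.
Proof. by []. Qed.

Lemma step_shell n w j x : (j < n.+1)%N -> shell r n j x -> step n w x = w j.
Proof.
move=> jn jx; rewrite stepE (bigD1 (Ordinal jn))//= big1 ?addr0 => [|i ij].
  by rewrite indicE mem_set// mulr1.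
rewrite indicE (_ : (x \in _) = false) ?mulr0//; apply/negbTE; rewrite notin_setE => ix.
by move/negP: ij; apply; apply/eqP/val_inj; exact: (shell_disjoint r_gt0 ix jx).
Qed.

Lemma shell_truncn n x : Omega x ->
  let j := Num.truncn (enorm x / mesh r n) in (j < n.+1)%N /\ shell r n j x.
Proof.
move=> xr j; have m0 := mesh_gt0 r_gt0 n.
have sm : 0 <= enorm x / mesh r n by rewrite divr_ge0 ?enorm_ge0// ltW.
have nd i : node r n i = mesh r n * i%:R by rewrite /node mulrAC.
have /andP[j1 j2] := truncn_itv sm.
have jx : node r n j <= enorm x by rewrite nd mulrC -ler_pdivlMr.
split; last first.
  split => /=; first by rewrite /eball/= nd mulrC -ltr_pdivrMr.
  by rewrite /eball/= => /lt_le_trans/(_ jx); rewrite ltxx.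
rewrite ltnNge; apply/negP => nj.
have := le_lt_trans (le_trans (node_le n r_gt0 nj) jx) xr.
by rewrite nodeS ltxx.
Qed.

Lemma clip_bound (k : R -> R) (B : R) s : 0 <= B -> `|Num.max (- B) (Num.min (k s) B)| <= B.
Proof. by move=> B0; rewrite ler_norml le_max lexx/= ge_max ge_min lexx orbT andbT; lra. Qed.

(** The steps take the one-dimensional means of the profile. They converge at its Lebesgue points,
    hence at almost every [x] by [null_radial], with differences bounded by [2 B]. *)
Lemma step_dense_bounded (f : L2) (k : R -> R) (B : R) : measurable_fun setT k ->
  (forall s, `|k s| <= B) -> {ae mu, forall x, f x = k (enorm x)} ->
  forall e, 0 < e -> exists n w, l2norm (f - step n w) <= e.
Proof.
move=> mk kB fk e e0.
have h2B : cst (B + B) \in Lfun mu 2%:E by apply: (@bounded_L2 R N r _ `|B + B|).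
have B0 : 0 <= B by rewrite (le_trans _ (kB 0)).
pose W n := step n (cell_mean r k n).
have WE n x : Omega x -> W n x = cell_mean r k n (Num.truncn (enorm x / mesh r n)).
  by move=> Ox; have [jn sj] := shell_truncn n Ox; exact: step_shell.
have aO : {ae mu, forall x, Omega x}.
  by apply: (@ae_lebesgue_on _ _ _ set0); [exact: measurable0|exact: measure0|].
have fW n : {ae mu, forall x, `|(f - W n : L2) x| <= `|(Lfun_Sub (lee1n 2) h2B : L2) x|}.
  apply: filterS2 fk aO => x fk Ox; rewrite L2_subE fk (WE _ _ Ox).
  rewrite [leRHS]ger0_norm ?addr_ge0// (le_trans (ler_normB _ _))// lerD//.
  exact: cell_mean_le.
have cW : {ae mu, forall x, (f - W n : L2) x @[n --> \oo] --> (0 : R)}.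
  have [A [mA A0 sA]] := lebesgue_differentiation (bounded_locally_integrable mk kB).
  have kA : {ae mu, forall x, lebesgue_pt k (enorm x)}.
    apply: (@ae_lebesgue_on _ _ _ [set x | A (enorm x)]).
    - exact: measurable_enorm_preimage.
    - exact: null_radial.
    - by move=> x Ox nA; apply: contrapT => nl; apply: nA; exact: sA.
  apply: filterS3 fk aO kA => x fk Ox kA; rewrite -(subrr (k (enorm x))).
  rewrite (_ : (fun n => _) = (fun n => k (enorm x) - cell_mean r k n (Num.truncn (enorm x / mesh r n)))).
    apply: cvgB; first exact: cvg_cst.
    exact: (cell_mean_cvg r_gt0 mk kB (enorm_ge0 x) kA).
  by apply/funext => n; rewrite L2_subE fk (WE _ _ Ox).
have [n fn] := dominated_inorm fW cW e0.
by exists n, (cell_mean r k n).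
Qed.

(** Truncating the profile at height [n] moves [g] by at most [|g|] pointwise, so dominated
    convergence reduces to bounded profiles. *)
Lemma step_dense (g : L2) : radial mO g ->
  forall e, 0 < e -> exists n w, l2norm (g - step n w) <= e.
Proof.
move=> /(radial_profile N_gt0 r_gt0)[k [mk gk]] e e0.
pose clip n s := Num.max (- n%:R) (Num.min (k s) n%:R) : R.
have mclip n : measurable_fun setT (clip n).
  by apply: measurable_maxr => //; apply: measurable_minr.
have clipB n s : `|clip n s| <= n%:R by exact: clip_bound.
have hL n : (fun x : 'rV[R]_N => clip n (enorm x)) \in Lfun mu 2%:E.
  apply: (@bounded_L2 R N r _ n%:R) => //.
  exact: (measurableT_comp (mclip n) (@measurable_enorm R N)).
pose G n : L2 := Lfun_Sub (lee1n 2) (hL n).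
have gG n : {ae mu, forall x, `|(g - G n : L2) x| <= `|g x|}.
  apply: filterS gk => x gk; rewrite L2_subE gk -[G n x]/(clip n (enorm x)) /clip; move: (k (enorm x)) => y.
  have n0 : 0 <= n%:R :> R by [].
  have [y1|y1] := leP y n%:R.
    have [y2|y2] := leP (- n%:R) y; first by rewrite subrr normr0.
    by rewrite !ler0_norm; lra.
  by rewrite max_r ?(le_trans _ n0) ?oppr_le0// !ger0_norm; lra.
have cG : {ae mu, forall x, (g - G n : L2) x @[n --> \oo] --> (0 : R)}.
  apply: filterS gk => x gk; apply/cvgrPdist_lt => d d0.
  near=> n; rewrite L2_subE gk -[G n x]/(clip n (enorm x)) /clip; move: gk => _.
  have : `|k (enorm x)| <= n%:R by near: n; exact: nbhs_infty_ger.
  by rewrite ler_norml => /andP[h1 h2]; rewrite min_l// max_r// !subrr normr0.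
have e20 : 0 < e / 2 by rewrite divr_gt0.
have [M gM] := dominated_inorm gG cG e20.
have [n [w Gn]] := @step_dense_bounded (G M) (clip M) M%:R (mclip M) (clipB M)
  (nearW _ (fun x => erefl)) _ e20.
exists n, w; rewrite -(subrKA (G M)) (splitr e).
apply: le_trans (inormD _ _ _ _ _ _) _; [exact: L2innerC|exact: L2innerDl|exact: L2innerZl|exact: L2inner_ge0|].
exact: lerD.
Unshelve. all: by end_near. Qed.

End step_dense.

(** * Passage to the limit *)

Section TV_subdifferential.
Context (R : realType) (N : nat) (r : R).
Hypothesis (N_gt0 : (0 < N)%N) (r_gt0 : 0 < r).
Local Notation Omega := (@eball R N r).
Local Notation mO := (measurable_eball R N r).
Local Notation L2 := (L2 mO).
Local Notation ip := (fun f g : L2 => L2inner mO f g).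
Local Notation l2norm := (inorm ip).
Local Notation TVL := (fun v : L2 => TV mO v).
Implicit Types f g h p q u v w : L2.

Let ipC : forall f g, ip f g = ip g f := @L2innerC R N _ mO.
Let ipDl : forall f g h, ip (f + g) h = ip f h + ip g h := @L2innerDl R N _ mO.
Let ipZl : forall a f g, ip (a *: f) g = a * ip f g := @L2innerZl R N _ mO.
Let ip_ge0 : forall f, 0 <= ip f f := @L2inner_ge0 R N _ mO.

Lemma L2innerBl f g h : L2inner mO (f - g : L2) h = L2inner mO f h - L2inner mO g h.
Proof. exact: (ipBl ipDl ipZl). Qed.

Lemma L2innerBr f g h : L2inner mO f (g - h : L2) = L2inner mO f g - L2inner mO f h.
Proof. exact: (ipBr ipC ipDl ipZl). Qed.

Lemma test_field_cst0 : test_field Omega (cst 0).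
Proof.
have e0 : [set x : 'rV[R]_N | cst (0 : 'rV[R]_N) x != 0] = set0.
  by rewrite -subset0 => x /=; rewrite eqxx.
split; rewrite ?e0 ?closure0//.
- split; first by move=> x; exact: differentiable_cst.
  move=> i; rewrite (_ : (fun x => _) = cst 0); first exact: cst_continuous.
  by apply/funext => x; rewrite derive_cst.
- exact: compact0.
- by move=> x; rewrite (eqP (_ : enorm _ == 0)) ?enorm_eq0.
Qed.

Lemma TV_ge0 (v : 'rV[R]_N -> R) : (0 <= TV mO v)%E.
Proof.
apply: ereal_sup_ubound; exists (cst 0); first exact: test_field_cst0.
rewrite integral0_eq// => x _; rewrite divergence0 ?mulr0//.
rewrite (_ : [set _ | _] = set0) ?closure0//.
by rewrite -subset0 => y /=; rewrite eqxx.
Qed.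

Lemma TV0 : TV mO (0 : L2) = 0%E.
Proof.
apply/eqP; rewrite eq_le TV_ge0 andbT; apply: TV_le => phi tphi.
rewrite /L2inner (_ : (fun x => _) = cst 0) ?Rintegral_cst ?mul0r//.
by apply/funext => x /=; rewrite mul0r.
Qed.

(** The subgradient inequality is tested against [0]. *)
Lemma subdifferential_TV_fin p u : subdifferential TVL u p ->
  TV mO u = (fine (TV mO u))%:E.
Proof.
move=> /(_ 0) /=; rewrite TV0 => H; rewrite fineK// ge0_fin_numE ?TV_ge0//.
by move: H; case: (TV mO u) => //= a; rewrite ?ltry.
Qed.

Lemma subdifferential_TV_monotone p q u v :
  subdifferential TVL u p -> subdifferential TVL v q ->
  0 <= L2inner mO (p - q : L2) (u - v : L2).
Proof.
move=> pu qv.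
have : (TV mO u + (L2inner mO p (v - u : L2))%:E <= TV mO v)%E := pu v.
have : (TV mO v + (L2inner mO q (u - v : L2))%:E <= TV mO u)%E := qv u.
rewrite (subdifferential_TV_fin pu) (subdifferential_TV_fin qv) -!EFinD !lee_fin.
rewrite L2innerBl !L2innerBr; lra.
Qed.

(** [TV] is a supremum of L^2-continuous linear functionals, so lower semicontinuity is checked one
    test field at a time. *)
Lemma subdifferential_TV_closed p u :
  (forall e, 0 < e -> exists q v,
     [/\ subdifferential TVL v q, l2norm (p - q) <= e & l2norm (u - v) <= e]) ->
  subdifferential TVL u p.
Proof.
move=> H w /=; have := TV_ge0 w; case TVw : (TV mO w) => [c| |]//= _; last by rewrite leey.
suff : (TV mO u <= (c - L2inner mO p (w - u : L2))%:E)%E.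
  by move=> /(leeD2r (L2inner mO p (w - u : L2))%:E)/le_trans; apply; rewrite -EFinD lee_fin subrK.
apply: TV_le => phi tphi; rewrite lee_fin.
pose d : L2 := Lfun_Sub (lee1n 2) (divergence_L2 tphi).
rewrite -[divergence phi]/(d : _ -> _).
have [nd np nw] : [/\ 0 <= l2norm d, 0 <= l2norm p & 0 <= l2norm (w - u)].
  by split; exact: inorm_ge0.
rewrite -subr_le0; set A := _ - _.
(* The restriction [e <= 1] bounds the approximating subgradients uniformly by [l2norm p + 1]. *)
have Ae e : 0 < e -> e <= 1 -> A <= e * (l2norm d + l2norm (w - u) + l2norm p + 1).
  move=> e0 e1; have [q [v [qv pq uv]]] := H _ e0.
  have := qv w; rewrite /= TVw => qw.
  have dv : L2inner mO v d + L2inner mO q (w - v : L2) <= c.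
    rewrite -lee_fin EFinD; apply: le_trans qw; apply: leeD2r.
    exact: (TV_ge v tphi).
  have h1 : L2inner mO (u - v : L2) d <= e * l2norm d.
    rewrite (le_trans (ip_le_inorm ipC ipDl ipZl ip_ge0 _ _))// ler_wpM2r//.
  have h2 : L2inner mO (p - q : L2) (w - u : L2) <= e * l2norm (w - u).
    by rewrite (le_trans (ip_le_inorm ipC ipDl ipZl ip_ge0 _ _))// ler_wpM2r.
  have nq : l2norm q <= l2norm p + 1.
    rewrite -[q](subKr p) (le_trans (inormB ipC ipDl ipZl ip_ge0 _ _))// lerD2l.
    exact: le_trans pq e1.
  have h3 : L2inner mO q (v - u : L2) <= e * (l2norm p + 1).
    rewrite (le_trans (ip_le_inorm ipC ipDl ipZl ip_ge0 _ _))// mulrC.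
    by rewrite ler_pM ?inorm_ge0// (inormBC ipC ipZl).
  move: h1 h2 h3 dv; rewrite /A !L2innerBl !L2innerBr; lra.
apply/ler_addgt0Pl => e e0; rewrite addr0.
set C := l2norm d + l2norm (w - u) + l2norm p + 1 in Ae.
have C0 : 0 < C by rewrite /C; lra.
have m0 : 0 < Num.min 1 (e / C) by rewrite lt_min ltr01 divr_gt0.
apply: (le_trans (Ae _ m0 _)); first by rewrite ge_min lexx.
by rewrite -ler_pdivlMr// ge_min lexx orbT.
Qed.

End TV_subdifferential.

Section step_path.
Context (R : realType) (N : nat) (r : R).
Hypothesis (N_gt0 : (0 < N)%N) (r_gt0 : 0 < r).
Local Notation mO := (measurable_eball R N r).
Local Notation L2 := (L2 mO).
Local Notation ip := (fun f g : L2 => L2inner mO f g).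
Local Notation l2norm := (inorm ip).
Local Notation TVL := (fun v : L2 => TV mO v).
Local Notation stepn := (@step R N r).

Lemma step_path n w : exists (V : R -> L2) (L : R),
  [/\ V 0 = stepn n w, 0 <= L,
    forall s t, 0 <= s -> 0 <= t -> l2norm (V t - V s) <= L * `|t - s| &
    forall s t, 0 <= s -> s < t -> subdifferential TVL (V t) ((t - s)^-1 *: (V s - V t))].
Proof.
have mg j : 0 < shell_vol N r n j by exact: shell_vol_gt0.
have Pg i : 0 <= node_per N r n i by exact: node_per_ge0.
have Pc i : (node_per N r n i.+2 - node_per N r n i.+1) / shell_vol N r n i.+1 <=
  (node_per N r n i.+1 - node_per N r n i) / shell_vol N r n i by exact: node_per_concave.
have [v [v0 Hv]] := discrete_prox_path (fun j (_ : (j < n.+1)%N) => mg j) Pg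
  (fun i (_ : (i < n)%N) => Pc i) w.
(* Since [|Q i|] is at most the perimeter, [L] bounds the norm of every [step (slope Q)], hence the
   speed of the path. *)
pose B j := ((node_per N r n j.+1 + node_per N r n j) / shell_vol N r n j) ^+ 2 * shell_vol N r n j.
pose L := Num.sqrt (\sum_(j < n.+1) B j).
have VE s t Q : 0 <= s -> s < t -> discrete_prox n (shell_vol N r n) (node_per N r n) (t - s) (v s) (v t) Q ->
    stepn n (v s) - stepn n (v t) = (t - s) *: stepn n (slope (shell_vol N r n) Q).
  move=> s0 st [_ _ wE]; rewrite /step -sumrB scaler_sumr; apply: eq_bigr => j _.
  by rewrite wE// scalerA -scalerBl opprB addrC subrK.
exists (fun t => stepn n (v t)), L; split; first by rewrite v0.
- exact: sqrtr_ge0.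
- suff HL s t : 0 <= s -> s < t -> l2norm (stepn n (v s) - stepn n (v t)) <= L * (t - s).
    move=> s t s0 t0; have [st|ts|->] := ltgtP s t.
    + rewrite (inormBC (@L2innerC _ _ _ mO) (@L2innerZl _ _ _ mO)) gtr0_norm ?subr_gt0//.
      exact: HL.
    + by rewrite ltr0_norm ?subr_lt0// opprB; exact: HL.
    + by rewrite !subrr normr0 mulr0 -[X in l2norm X](scale0r 0)
        (inormZ (@L2innerC _ _ _ mO) (@L2innerZl _ _ _ mO)) normr0 mul0r.
  move=> s0 st; have [Q HQ] := Hv _ _ s0 st; rewrite (VE _ _ Q)//.
  rewrite (inormZ (@L2innerC _ _ _ mO) (@L2innerZl _ _ _ mO)) gtr0_norm ?subr_gt0//.
  rewrite mulrC ler_wpM2r ?subr_ge0 ?(ltW st)// /inorm ler_wsqrtr//.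
  rewrite L2inner_step_step//; apply: ler_sum => j _.
  rewrite mulrA -expr2 ler_wpM2r ?(ltW (mg _))//.
  have [[_ _ QP] _ _] := HQ.
  rewrite /slope exprMn [leRHS]exprMn ler_wpM2r ?sqr_ge0//.
  rewrite -(real_normK (num_real (_ - _))) lerXn2r ?nnegrE ?addr_ge0//.
  by rewrite (le_trans (ler_normB _ _))// lerD// QP// ltnW.
- move=> s t s0 st; have [Q HQ] := Hv _ _ s0 st; rewrite (VE _ _ Q)//.
  rewrite scalerA mulVf ?scale1r; last by rewrite gt_eqF ?subr_gt0.
  by have [aQ cQ _] := HQ; exact: step_subdifferential.
Qed.

End step_path.

(** * From the Euler inclusion to the unique minimizer *)

Section rof.
Context (R : realType) (N : nat) (r : R).
Hypothesis (N_gt0 : (0 < N)%N) (r_gt0 : 0 < r).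
Local Notation mO := (measurable_eball R N r).
Local Notation mu := (lebesgue_on mO).
Local Notation L2 := (L2 mO).
Local Notation ip := (fun f g : L2 => L2inner mO f g).
Local Notation l2norm := (inorm ip).
Local Notation TVL := (fun v : L2 => TV mO v).

Lemma L2norm0_ae (f : L2) : l2norm f = 0 -> {ae mu, forall x, f x = 0}.
Proof.
move=> f0; have : L2norm mO f = 0%E by rewrite L2normE f0.
have mf : measurable_fun setT (EFin \o (f : 'rV[R]_N -> R)).
  exact/measurable_EFinP.
move=> /(Lnorm_eq0_eq0 mf) ; rewrite lte_fin => /(_ (ltr0n _ 2)).
by apply: filterS => x /(_ I) /= [].
Qed.

Lemma ROF_energyE t (g v : L2) : TV mO v = (fine (TV mO v))%:E ->
  ROF_energy mO t g v = (t * fine (TV mO v) + 2^-1 * l2norm (v - g) ^+ 2)%:E.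
Proof.
move=> TVv; rewrite /ROF_energy TVv [X in (_ * X ^+ 2)%E](_ : _ = L2norm mO (v - g : L2))//.
by rewrite L2normE.
Qed.

Lemma L2_subdifferential_BV (p x : L2) : subdifferential TVL x p -> BV mO x.
Proof.
move=> px; split; last by rewrite (subdifferential_TV_fin px) ltry.
apply: Lfun_subset12; last exact: LfunP.
by rewrite ge0_fin_numE//; exact: lebesgue_on_lty.
Qed.

(** A competitor in BV is only known to be integrable; finite energy puts [v - g], hence [v], in
    L^2, where the subgradient inequality applies. *)
Lemma ROF_energy_lty t (g : L2) (v : 'rV[R]_N -> R) : 0 < t -> BV mO v ->
  (ROF_energy mO t g v < +oo)%E -> exists w : L2, v = w.
Proof.
move=> t0 [v1 _] Ev.
have mv : measurable_fun setT v by move: v1; rewrite inE => /andP[]; rewrite inE.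
have vg2 : (v \- g) \in Lfun mu 2%:E.
  rewrite inE; apply/andP; split; first by rewrite inE; exact: measurable_funB.
  rewrite inE; have [//|] := ltP ('N[mu]_2%:E [EFin \o (v \- g)%R])%E +oo%E.
  rewrite leye_eq => /eqP Eoo; exfalso; move: Ev.
  rewrite /ROF_energy /L2norm [X in (X ^+ 2)%E]Eoo expe2 mulyy gt0_muley ?lte_fin ?invr_gt0//.
  rewrite addey ?ltxx// gt_eqF// (lt_le_trans (ltNyr 0))// mule_ge0 ?TV_ge0//.
  by rewrite lee_fin ltW.
exists (Lfun_Sub (lee1n 2) vg2 + g).
by apply/funext => x /=; rewrite subrK.
Qed.

(** The inclusion gives quadratic growth: the energy of [v] exceeds that of [x] by at least half the
    squared distance, which yields minimality and uniqueness together. *)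
Lemma ROF_unique_minimizer t (g x : L2) : 0 < t ->
  subdifferential TVL x (t^-1 *: (g - x)) ->
  is_unique_minimizer_on mO (BV mO) (ROF_energy mO t g) x.
Proof.
move=> t0 px; have BVx := L2_subdifferential_BV px.
have sqE (f : L2) : l2norm f ^+ 2 = L2inner mO f f.
  exact: (sqr_inorm (@L2innerC _ _ _ mO) (@L2inner_ge0 _ _ _ mO)).
have polar (a b : L2) :
    l2norm (a + b) ^+ 2 = l2norm a ^+ 2 + 2 * L2inner mO a b + l2norm b ^+ 2.
  by rewrite !sqE L2innerDl (L2innerC a) (L2innerC b) !L2innerDl (L2innerC b a); ring.
have Ex := ROF_energyE t g (subdifferential_TV_fin px).
have key (v : L2) : BV mO v ->
    (ROF_energy mO t g x + (2^-1 * l2norm (v - x) ^+ 2)%:E <= ROF_energy mO t g v)%E.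
  move=> [_ TVv]; have TVv' : TV mO v = (fine (TV mO v))%:E.
    by rewrite fineK// ge0_fin_numE// TV_ge0.
  rewrite Ex (ROF_energyE t g TVv') -EFinD lee_fin.
  have : (TV mO x + (L2inner mO (t^-1 *: (g - x) : L2) (v - x : L2))%:E <= TV mO v)%E := px v.
  rewrite (subdifferential_TV_fin px) TVv' -EFinD lee_fin L2innerZl -(ler_pM2l t0).
  rewrite mulrDr mulrA mulfV ?gt_eqF// mul1r.
  have -> : L2inner mO (g - x : L2) (v - x : L2) = - L2inner mO (x - g : L2) (v - x : L2).
    by rewrite -[g - x]opprB; exact: (ipNl (@L2innerZl _ _ _ mO)).
  have -> : v - g = (x - g) + (v - x) by rewrite [RHS]addrC subrKA.
  rewrite (polar (x - g) (v - x)); move: (L2inner mO (x - g : L2) (v - x : L2)) (l2norm (x - g)) (l2norm (v - x)).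
  by move=> A B C /=; lra.
have Exy : (ROF_energy mO t g x < +oo)%E by rewrite Ex ltry.
split; first split => // v BVv.
  have [Ev|] := ltP (ROF_energy mO t g v) +oo%E; last by rewrite leye_eq => /eqP ->; rewrite leey.
  have [w vw] := ROF_energy_lty t0 BVv Ev; rewrite vw in BVv *.
  by apply: le_trans (key w BVv); rewrite leeDl// lee_fin mulr_ge0 ?invr_ge0// sqr_ge0.
move=> v [BVv vmin]; have Ev := vmin _ BVx.
have [w vw] := ROF_energy_lty t0 BVv (le_lt_trans Ev Exy); rewrite vw in BVv Ev *.
have := le_trans (key w BVv) Ev; rewrite Ex -EFinD lee_fin gerDl.
rewrite pmulr_rle0 ?invr_gt0// => n0.
have /eqP : l2norm (w - x) ^+ 2 = 0 by apply/eqP; rewrite eq_le n0 sqr_ge0.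
rewrite sqrf_eq0 => /eqP /L2norm0_ae; apply: filterS => y wx _.
by apply/eqP; rewrite -subr_eq0; apply/eqP.
Qed.

End rof.

(** * The flow of radial data *)

Section flow.
Context (R : realType) (N : nat) (r : R).
Hypothesis (N_gt0 : (0 < N)%N) (r_gt0 : 0 < r).
Local Notation mO := (measurable_eball R N r).
Local Notation mu := (lebesgue_on mO).
Local Notation L2 := (L2 mO).
Local Notation ip := (fun f g : L2 => L2inner mO f g).
Local Notation l2norm := (inorm ip).
Local Notation TVL := (fun v : L2 => TV mO v).

Let ipC : forall f g : L2, ip f g = ip g f := @L2innerC R N _ mO.
Let ipDl : forall f g h : L2, ip (f + g) h = ip f h + ip g h := @L2innerDl R N _ mO.
Let ipZl : forall a (f g : L2), ip (a *: f) g = a * ip f g := @L2innerZl R N _ mO.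
Let ip_ge0 : forall f : L2, 0 <= ip f f := @L2inner_ge0 R N _ mO.

Lemma inorm_ae0 (f : L2) : {ae mu, forall x, f x = 0} -> l2norm f = 0.
Proof.
move=> f0; rewrite /inorm /L2inner /Rintegral (ae_eq_integral (cst 0%E))//.
- by rewrite integral0 sqrtr0.
- by apply/measurable_EFinP; exact: measurable_funM.
- by apply: filterS f0 => x f0 _ /=; rewrite f0 mulr0.
Qed.

Lemma L2norm_cvg0 (F : set_system R) {FF : Filter F} (f : R -> L2) :
  L2norm mO (f s) @[s --> F] --> 0%E ->
  forall e, 0 < e -> \forall s \near F, l2norm (f s) <= e.
Proof.
under eq_fun do rewrite L2normE.
move=> /fine_cvg /cvgrPdist_le H e e0; have := H _ e0.
by apply: filterS => s; rewrite /= sub0r normrN ger0_norm// inorm_ge0.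
Qed.

Lemma TV_flow_step_path_le T (g : L2) (u : R -> L2) (V : R -> L2) (L : R) :
  0 < T -> TV_flow T g u -> 0 <= L ->
  (forall s t, 0 <= s -> 0 <= t -> l2norm (V t - V s) <= L * `|t - s|) ->
  (forall s t, 0 <= s -> s < t -> subdifferential TVL (V t) ((t - s)^-1 *: (V s - V t))) ->
  forall t, 0 <= t <= T -> l2norm (u t - V t) <= l2norm (u 0 - V 0).
Proof.
move=> T0 [uc uac ud _] L0 VL Vs.
apply: (inorm_flow_le ipC ipDl ipZl ip_ge0 (L := L)) => //.
- move=> t tT e e0; have tT' : `[0, T]%classic t by rewrite /= in_itv.
  have := @L2norm_cvg0 _ (within_filter _ (nbhs_filter (t : R))) _ (uc t tT') e e0; rewrite near_withinE => H; have [d /= d0 Hd] := (nbhs_ballP _ _).1 H.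
  exists d => // s sT st; apply: Hd; last by rewrite /= in_itv.
  by rewrite /ball/= distrC.
- move=> a b a0 ab bT e e0; have [d d0 Hd] := uac a b a0 ab bT _ e0.
  exists d => // n s t [st1 st2] std; have := Hd n s t st1 st2 std.
  rewrite (eq_bigr (fun i => (l2norm (u (t i) - u (s i)))%:E)) => [|i _]; last by rewrite L2normE.
  by rewrite sumEFin lte_fin => /ltW.
- by move=> s t /andP[s0 _] /andP[t0 _]; exact: VL.
- case: ud => A [mA A0 sA]; exists A; split => // t nt; apply: sA => /= ud.
  apply: nt => /= tT; have [w uw pw] := ud tT; exists w; split.
  + move=> e e0; have := @L2norm_cvg0 _ (within_filter _ (nbhs_filter (0 : R))) _ uw e e0.
    rewrite near_withinE => H; have [d /= d0 Hd] := (nbhs_ballP _ _).1 H.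
    by exists d => // h h0 hd; apply: Hd => //; rewrite /ball/= sub0r normrN.
  + move=> s /andP[s0 st]; exact: (subdifferential_TV_monotone pw (Vs _ _ s0 st)).
Qed.

Lemma TV_flow_subdifferential T (g : L2) (u : R -> L2) : radial mO g -> 0 < T ->
  TV_flow T g u -> forall t, 0 < t <= T -> subdifferential TVL (u t) (t^-1 *: (g - u t)).
Proof.
move=> rg T0 uf t /andP[t0 tT]; apply: subdifferential_TV_closed => // e e0.
have t1 : 0 < 1 + 2 * t^-1 by rewrite addr_gt0// mulr_gt0// invr_gt0.
(* Both [g - V 0] and [u t - V t] have norm at most [d], so the subgradients differ by at most
   [2 d / t]; this [d] makes [d + 2 d / t = e]. *)
pose d := e / (1 + 2 * t^-1); have d0 : 0 < d by rewrite divr_gt0.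
have dE : d + 2 * t^-1 * d = e by rewrite /d; field; rewrite !gt_eqF//; lra.
have td : 0 <= 2 * t^-1 * d by rewrite !mulr_ge0 ?invr_ge0// ltW.
have [n [w gw]] := step_dense N_gt0 r_gt0 rg d0.
have [V [L [V0 L0 VL Vs]]] := step_path N_gt0 r_gt0 n w.
have u0 : l2norm (u 0 - g) = 0.
  by apply: inorm_ae0; case: uf => _ _ _; apply: filterS => x /(_ I) ux; rewrite L2_subE ux subrr.
have uV : l2norm (u t - V t) <= d.
  have t0T : 0 <= t <= T by rewrite ltW.
  apply: le_trans (TV_flow_step_path_le T0 uf L0 VL Vs t0T) _.
  rewrite V0 -(subrKA g); apply: le_trans (inormD ipC ipDl ipZl ip_ge0 _ _) _.
  by rewrite u0 add0r.
exists (t^-1 *: (V 0 - V t)), (V t); split.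
- by have := Vs _ _ (lexx 0) t0; rewrite subr0.
- rewrite -scalerBr (inormZ ipC ipZl) gtr0_norm ?invr_gt0//.
  have -> : g - u t - (V 0 - V t) = (g - V 0) - (u t - V t).
    by rewrite !opprB addrACA [RHS]addrACA; congr (_ + _); rewrite addrC.
  have : l2norm (g - V 0 - (u t - V t)) <= d + d.
    apply: le_trans (inormB ipC ipDl ipZl ip_ge0 _ _) _; apply: lerD => //.
    by rewrite V0.
  rewrite -(ler_pM2l (_ : 0 < t^-1)) ?invr_gt0// => /le_trans; apply; lra.
- by apply: le_trans uV _; lra.
Qed.

End flow.

Theorem theorem4p7 (R : realType) (N : nat) (N_ge2 : (2 <= N)%N)
    (r : R) (r_gt0 : 0 < r)
    (g : L2 (measurable_eball R N r))
    (g_radial : radial (measurable_eball R N r) g)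
    (T : R) (T_gt0 : 0 < T)
    (u : R -> L2 (measurable_eball R N r))
    (u_flow : TV_flow T g u) :
  forall t : R, 0 < t <= T ->
    is_unique_minimizer_on (measurable_eball R N r)
      (BV (measurable_eball R N r))
      (ROF_energy (measurable_eball R N r) t g)
      (u t).
Proof.
move=> t tT; have /andP[t_gt0 _] := tT.
have N_gt0 : (0 < N)%N by exact: ltnW.
apply: ROF_unique_minimizer => //.
exact: (TV_flow_subdifferential N_gt0 r_gt0 g_radial T_gt0 u_flow tT).
Qed.
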